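(* Let $\lambda,\mu>0$, $k\ge1$ an integer and $\nu\in(0,1)$. The inter-phase times of a $\nu$-fractional $M/E_k/1$ queue (with arrival rate $\lambda$, $k$ phases and phase rate $k\mu$) are i.i.d. Mittag-Leffler random variables with fractional index $\nu$ and parameter $k\mu$.
   Context: Classical queue: let $\mathcal{S}^*=\{(n,s): n\ge 1,\ 1\le s\le k\}$ ($n,s$ integers) and $\mathcal{S}=\mathcal{S}^*\cup\{(0,0)\}$. The state-phase process $Q(t)=(N(t),S(t))$ of the classical $M/E_k/1$ queue ($N$ = number of customers in the system, $S$ = phase of the customer currently being served, $S=0$ if $N=0$) is the continuous-time Markov chain on $\mathcal{S}$ with transition rates: $(0,0)\to(1,k)$ at rate $\lambda$; $(n,s)\to(n+1,s)$ at rate $\lambda$ for $(n,s)\in\mathcal{S}^*$ (arrivals); $(n,s)\to(n,s-1)$ at rate $k\mu$ for $s\ge2$; $(n,1)\to(n-1,k)$ at rate $k\mu$ for $n\ge2$; $(1,1)\to(0,0)$ at rate $k\mu$ (phase completions). Fractional queue: let $\{\sigma_\nu(t)\}_{t\ge0}$ be a $\nu$-stable subordinator independent of $Q$, with $\mathbb{E}[e^{-v\sigma_\nu(t)}]=e^{-tv^\nu}$ for $v>0$, and let $L_\nu(t)=\inf\{s\ge0:\sigma_\nu(s)>t\}$. The $\nu$-fractional $M/E_k/1$ queue has state-phase process $Q^\nu(t)=(N^\nu(t),S^\nu(t)):=Q(L_\nu(t))$. An inter-phase time is the duration of a single service phase, from the instant it begins (completion of the preceding phase with the system still nonempty, or arrival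 of a customer to an empty system) to the instant it is completed. A Mittag-Leffler random variable $T$ with fractional index $\nu$ and parameter $\theta>0$, denoted $T\sim ML_\nu(\theta)$, has distribution function $F_T(t)=1-E_\nu(-\theta t^\nu)$, $t\ge0$, where $E_\nu(z)=\sum_{j=0}^{+\infty}\frac{z^j}{\Gamma(\nu j+1)}$. *)

(* Defs.v *)
From HB Require Import structures.
From mathcomp Require Import all_boot all_order all_algebra.
From mathcomp Require Import all_classical all_reals all_analysis.

Set Implicit Arguments.
Unset Strict Implicit.
Unset Printing Implicit Defensive.

Import Order.TTheory GRing.Theory Num.Theory.
Import numFieldNormedType.Exports.

Local Open Scope classical_set_scope.
Local Open Scope ring_scope.

(* The Gamma function only where the integral converges, i.e. for [0 < z]. *)
Definition Gamma {R : realType} (z : R) : R :=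
  \int[lebesgue_measure]_(x in `]0, +oo[) (x `^ (z - 1) * expR (- x)).

Definition mittag_leffler {R : realType} (nu z : R) : R :=
  limn (series (fun j : nat => z ^+ j / Gamma (nu * j%:R + 1))).

Section Probability.
Context {R : realType} {d : measure_display} {T : measurableType d}.
Variable P : probability T R.

(* X ~ ML_nu(theta).  As [cdf X 0 = 0] is the case [t = 0], negative arguments
   need not be mentioned. *)
Definition mittag_leffler_rv (nu theta : R) (X : {RV P >-> R}) : Prop :=
  forall t : R, 0 <= t ->
    cdf X t = (1 - mittag_leffler nu (- (theta * t `^ nu)))%:E.

Definition mutually_independent {I : eqType} (X : I -> T -> R) : Prop :=
  forall (s : seq I) (A : I -> set R), uniq s ->
    (forall i, measurable (A i)) ->
    P (\bigcap_(i in [set` s]) (X i @^-1` A i)) =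
    (\prod_(i <- s) P (X i @^-1` A i))%E.

(* The sigma-algebra generated by the process (X t), t >= 0, where [M] is the
   sigma-algebra of the state space [U]. *)
Definition process_sigma {U : Type} (M : set (set U)) (X : R -> T -> U) :
    set (set T) :=
  <<s [set E | exists t A, [/\ 0 <= t, M A & E = X t @^-1` A]] >>.

Definition independent_processes {U V : Type} (MU : set (set U))
    (MV : set (set V)) (X : R -> T -> U) (Y : R -> T -> V) : Prop :=
  forall A B, process_sigma MU X A -> process_sigma MV Y B ->
    P (A `&` B) = (P A * P B)%E.

Record stable_subordinator (nu : R) (sigma : R -> {RV P >-> R}) : Prop := {
  sub_start : {ae P, forall w, sigma 0 w = 0};
  sub_nondecreasing : {ae P, forall w,
    forall s t, 0 <= s -> s <= t -> sigma s w <= sigma t w};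
  sub_right_continuous : {ae P, forall w,
    forall t, 0 <= t -> sigma s w @[s --> t^'+] --> sigma t w};
  sub_independent_increments :
    forall (n : nat) (t : nat -> R), 0 <= t 0%N ->
      (forall i, (i < n)%N -> t i <= t i.+1) ->
      mutually_independent
        (fun (i : 'I_n) (w : T) => sigma (t i.+1) w - sigma (t i) w);
  sub_stationary_increments :
    forall (s t : R) (A : set R), 0 <= s -> s <= t -> measurable A ->
      P [set w | A (sigma t w - sigma s w)] = P [set w | A (sigma (t - s) w)];
  sub_laplace :
    forall v t : R, 0 < v -> 0 <= t ->
      ('E_P[fun w => expR (- (v * sigma t w))] = (expR (- (t * v `^ nu)))%:E)%E
}.

Definition inverse_subordinator (sigma : R -> T -> R) (t : R) (w : T) : R :=
  inf [set s | 0 <= s /\ t < sigma s w].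

Section MarkovChain.
Variable S : countType.

(* Standard transition function with conservative rates [q x y], [x != y]:
   p_h(x, y) = q(x, y) h + o(h) for y != x and
   p_h(x, x) = 1 - (\sum_(y != x) q(x, y)) h + o(h). *)
Record transition_function (q : S -> S -> R) (p : R -> S -> S -> R) : Prop := {
  tf_ge0 : forall t x y, 0 <= t -> 0 <= p t x y;
  tf_sum1 : forall t x, 0 <= t -> \esum_(y in [set: S]) (p t x y)%:E = 1%E;
  tf_start : forall x y, p 0 x y = (x == y)%:R;
  tf_semigroup : forall s t x z, 0 <= s -> 0 <= t ->
    (p (s + t) x z)%:E = \esum_(y in [set: S]) (p s x y * p t y z)%:E;
  tf_rate : forall x y, x != y -> p h x y / h @[h --> 0^'+] --> q x y;
  tf_exit_rate : forall x,
    ((1 - p h x x) / h)%:E @[h --> 0^'+]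
      --> \esum_(y in [set y | y != x]) (q x y)%:E
}.

(* Cadlag time-homogeneous Markov chain on the discrete space [S], with
   transition rates [q] and arbitrary initial law. *)
Record markov_chain (q : S -> S -> R) (X : R -> T -> S) : Prop := {
  mc_measurable : forall t (A : set S), 0 <= t -> measurable (X t @^-1` A);
  mc_right_continuous : {ae P, forall w,
    forall t, 0 <= t -> \forall u \near t^'+, X u w = X t w};
  mc_left_limits : {ae P, forall w,
    forall t, 0 < t -> exists x, \forall u \near t^'-, X u w = x};
  mc_markov : exists2 p : R -> S -> S -> R, transition_function q p &
    forall (n : nat) (t : nat -> R) (x : nat -> S), 0 <= t 0%N ->
      (forall i, (i < n)%N -> t i <= t i.+1) ->
      P [set w | forall i, (i <= n)%N -> X (t i) w = x i] =
      (P [set w | X (t 0%N) w = x 0%N] *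
       (\prod_(i < n) p (t i.+1 - t i) (x i) (x i.+1))%:E)%E
}.

End MarkovChain.

End Probability.

Section ErlangQueue.
Variable k : nat.

Definition state_phase : pred (nat * nat) :=
  fun x => (x == (0, 0)%N) || [&& (1 <= x.1)%N, (1 <= x.2)%N & (x.2 <= k)%N].

Definition queue_state : Type := {x : nat * nat | state_phase x}.
HB.instance Definition _ := Countable.on queue_state.

(* The following two relations between states are disjoint; they are only
   used for states satisfying [state_phase]. *)
Definition arrival (x y : nat * nat) : bool :=
  ((x == (0, 0)%N) && (y == (1, k)%N)) ||
  ((1 <= x.1)%N && (y == (x.1.+1, x.2))).

Definition phase_completion (x y : nat * nat) : bool :=
  [|| (2 <= x.2)%N && (y == (x.1, x.2.-1)),
      [&& (2 <= x.1)%N, x.2 == 1%N & y == (x.1.-1, k)]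
    | (x == (1, 1)%N) && (y == (0, 0)%N)].

Definition phase_start (x y : nat * nat) : bool :=
  (phase_completion x y && (y != (0, 0)%N)) ||
  (arrival x y && (x == (0, 0)%N)).

Definition queue_rate {R : realType} (lam mu : R) (x y : queue_state) : R :=
  if arrival (val x) (val y) then lam
  else if phase_completion (val x) (val y) then k%:R * mu
  else 0.

Section Paths.
Context {R : realType}.
Variable x : R -> nat * nat.

Definition jump (t : R) (a b : nat * nat) : Prop :=
  [/\ 0 < t, \forall u \near t^'-, x u = a & x t = b].

Definition phase_starts_at (t : R) : Prop :=
  exists a b, jump t a b /\ phase_start a b.

Definition phase_completed_at (t : R) : Prop :=
  exists a b, jump t a b /\ phase_completion a b.

(* [D] is the sequence of all inter-phase times along the path [x], in
   chronological order: [B j] is the instant at which the j-th phase begins and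
   [C j] the instant at which it is completed.  A phase already in progress at
   time 0 is not counted, as the path does not show its beginning. *)
Definition inter_phase_times (D : nat -> R) : Prop :=
  exists B C : nat -> R,
    [/\ forall j, B j < B j.+1,
        forall t, phase_starts_at t <-> exists j, t = B j,
        forall j, [/\ B j < C j, phase_completed_at (C j) &
          forall t, B j < t -> t < C j -> ~ phase_completed_at t] &
        forall j, D j = C j - B j].

End Paths.

End ErlangQueue.

Section FractionalQueue.
Context {R : realType} {d : measure_display} {T : measurableType d}.

Definition fractional_process {U : Type} (Q : R -> T -> U) (sigma : R -> T -> R)
  (t : R) (w : T) : U := Q (inverse_subordinator sigma t w) w.

End FractionalQueue.

(* Main.v *)
(* Almost surely [sigma] is strictly increasing and unbounded, so the fractional
   path [t |-> Q (L t)] runs through the same states as [Q], and a jump of [Q] at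
   time [J] becomes a jump at the left limit [sigma (J-)].  The j-th inter-phase
   time is therefore [D j = sigma (C j -) - sigma (B j -)], where [B j] and [C j]
   delimit the j-th service phase of [Q].

   The joint Laplace transform of [D 0, D 1, ...] is computed without the strong
   Markov property.  Observe [Q] on a grid of mesh [h] and replace [D j] by the sum
   of the increments of [sigma] over the cells in which the j-th phase is in
   progress.  Given the observed states, an increment charged at [v] contributes
   [exp (- h v^nu)].  Multiply the exponential accumulated so far by the product of
   [theta / (theta + v r ^ nu)], [theta = k mu], over the phases [r] not yet
   completed: the result has constant expectation up to [O(h^2)] per step, because
   the rates of [Q] are known to first order and the completion rate of a phase is
   [theta] in every state.  Letting [h] tend to 0 gives
     E exp (- sum_r v r * D r) = prod_r theta / (theta + v r ^ nu).

   Termwise integration shows that [theta / (theta + v^nu)] is the transform of the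
   Mittag-Leffler law, and the injectivity of the Laplace transform, applied to one
   variable at a time, yields the marginal laws and the independence. *)
Require Import Defs.
From HB Require Import structures.
From mathcomp Require Import all_boot all_order all_algebra.
From mathcomp Require Import all_classical all_reals all_analysis.
From mathcomp Require Import measurable_realfun.
From mathcomp Require Import ring lra zify.

Set Implicit Arguments.
Unset Strict Implicit.
Unset Printing Implicit Defensive.

Import Order.TTheory GRing.Theory Num.Theory.
Import numFieldNormedType.Exports.

Local Open Scope classical_set_scope.
Local Open Scope ring_scope.

(** * Counting service phases along a path *)

(** The Markov property is given only for finite-dimensional distributions, while a phase is
    delimited by random times; so whatever is integrated must depend on finitely many observations.
    Phases are therefore counted by an automaton reading successive states, which counts alike on a
    grid and on the jump chain once the mesh is below the holding times concerned. No stopping time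
    is needed either: the factor for uncompleted phases is 1 once all the charged phases are
    completed, so a deterministic number of steps tending to infinity suffices. Path regularity is a
    second obstacle: that [Q] makes only the prescribed jumps and begins infinitely many phases has
    to be extracted from the transition function. A forbidden transition has probability [O(h^2)]
    per cell, against [O(1/h)] cells in bounded time; and in a cell of suitable fixed length the
    service advances with probability bounded below, whatever the state. Finally, termwise
    integration of the Mittag-Leffler series is justified only for large [v], so injectivity must
    work from transforms known on a half-line [v > c]. *)

Section ServiceAutomaton.
Variable k : nat.

Notation idle := ((0, 0)%N : nat * nat).

(* The state [(b, f)] records the number [b] of service phases begun so far and
   whether ([f]) the last of them is still in progress. *)
Definition service_update (a : nat * bool) (x y : nat * nat) : nat * bool :=
  if phase_start k x y then (a.1.+1, true) else (a.1, a.2 && (y != idle)).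

Fixpoint service_state (y : nat -> nat * nat) (i : nat) : nat * bool :=
  if i is i'.+1 then service_update (service_state y i') (y i') (y i)
  else (0%N, false).

Lemma phase_startN0 x y : phase_start k x y -> y != idle.
Proof.
rewrite /phase_start /arrival => /orP[/andP[_ //]|/andP[/orP[/andP[_ /eqP->]//|]]].
by move=> /andP[x1 _] /eqP xE; rewrite xE in x1.
Qed.

Lemma phase_start_busy x y : x != idle -> phase_start k x y ->
  phase_completion k x y.
Proof. by move=> /negPf x0; rewrite /phase_start x0 andbF orbF => /andP[]. Qed.

Lemma phase_completion_idle x y : phase_completion k x y -> ~~ phase_start k x y ->
  y = idle.
Proof. by rewrite /phase_start => -> /=; rewrite negb_or negbK => /andP[/eqP]. Qed.

Lemma phase_completion_from_idle y : phase_completion k idle y = false.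
Proof. by []. Qed.

Lemma phase_completion_neq x y : phase_completion k x y -> y != x.
Proof.
case: x y => [n s] [n' s']; rewrite /phase_completion /= !xpair_eqE; lia.
Qed.

Lemma arrival_neq x y : arrival k x y -> y != x.
Proof.
case: x y => [n s] [n' s']; rewrite /arrival /= !xpair_eqE; lia.
Qed.

Lemma phase_start_neq x y : phase_start k x y -> y != x.
Proof.
by move=> /orP[/andP[/phase_completion_neq//]|/andP[/arrival_neq]].
Qed.

Lemma arrival_notin_completion x y : state_phase k x -> arrival k x y ->
  phase_completion k x y = false.
Proof.
case: x y => [n s] [n' s'].
rewrite /state_phase /arrival /phase_completion /= !xpair_eqE; lia.
Qed.

Lemma arrival_idle y : arrival k idle y -> phase_start k idle y.
Proof. by rewrite /phase_start => ->; rewrite orbT. Qed.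

Lemma arrivalN0 x y : arrival k x y -> y != idle.
Proof.
case: x y => [n s] [n' s']; rewrite /arrival /= !xpair_eqE; lia.
Qed.

Lemma service_state_busy y i : (service_state y i).2 -> y i != idle.
Proof.
case: i => //= i; rewrite /service_update; case: ifPn => [/phase_startN0//|_].
by move=> /= /andP[].
Qed.

Lemma eq_service_state y y' n : (forall i, (i <= n)%N -> y i = y' i) ->
  service_state y n = service_state y' n.
Proof.
elim: n => //= n IHn yy'; rewrite IHn => [|i i_n]; last by rewrite yy' ?leqW.
by rewrite yy' ?leqnSn// yy'.
Qed.

Lemma service_state_pos y i : (service_state y i).2 -> (0 < (service_state y i).1)%N.
Proof.
elim: i => //= i IHi; rewrite /service_update; case: ifP => //= _.
by move=> /andP[/IHi].
Qed.

(** Observing a state repeatedly leaves the automaton unchanged, so a fine grid and the jump chain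
    drive it through the same states. *)
Lemma service_update_id y i :
  service_update (service_state y i) (y i) (y i) = service_state y i.
Proof.
rewrite /service_update; case: ifPn => [/phase_start_neq|_]; first by rewrite eqxx.
have := @service_state_busy y i; case: (service_state y i) => b [] //= -> //.
Qed.

Lemma service_count_mono y i j : (i <= j)%N ->
  ((service_state y i).1 <= (service_state y j).1)%N.
Proof.
elim: j => [|j IHj]; first by rewrite leqn0 => /eqP->.
rewrite leq_eqVlt ltnS => /orP[/eqP->//|/IHj {}IHj].
by apply: (leq_trans IHj); rewrite /= /service_update; case: ifP.
Qed.

Section EmbeddedChain.
Variable y : nat -> nat * nat.
Hypothesis y_state : forall i, state_phase k (y i).
Hypothesis y_step : forall i,
  arrival k (y i) (y i.+1) || phase_completion k (y i) (y i.+1).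
Hypothesis y_starts : forall i0, exists2 i, (i0 <= i)%N & phase_start k (y i) (y i.+1).

Let cnt i := (service_state y i).1.

Let cntS i : cnt i.+1 = (cnt i + phase_start k (y i) (y i.+1))%N.
Proof. by rewrite /cnt /= /service_update; case: ifP => _ /=; lia. Qed.

Lemma service_count_unbounded j : exists i, (j < (service_state y i).1)%N.
Proof.
elim: j => [|j [i ji]].
  by have [i _ si] := y_starts 0; exists i.+1; rewrite -/(cnt _) cntS si addn1.
have [i' ii' si'] := y_starts i.
exists i'.+1; rewrite -/(cnt _) cntS si' addn1 ltnS.
by apply: (leq_trans ji); exact: service_count_mono.
Qed.

(** With a single server, a phase can begin in a busy system only when the previous one is
    completed, so phases do not overlap. Transition [i] leads from [y i] to [y i.+1]; phase [j],
    begun by transition [rb j] and completed by transition [rc j], is thus in progress at the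
    indices [rb j < i <= rc j]. *)
Lemma service_phase_indices : exists rb rc : nat -> nat,
  [/\ forall j, (rb j < rb j.+1)%N,
      forall i, phase_start k (y i) (y i.+1) <-> exists j, i = rb j,
      forall j, [/\ (rb j < rc j)%N, phase_completion k (y (rc j)) (y (rc j).+1) &
        forall i, (rb j < i < rc j)%N -> ~~ phase_completion k (y i) (y i.+1)] &
      forall i j, (service_state y i == (j.+1, true)) = (rb j < i <= rc j)%N].
Proof.
have exb j : exists i, (j < cnt i.+1)%N.
  have [i ji] := service_count_unbounded j; exists i; apply: (leq_trans ji).
  exact: service_count_mono.
pose rb j := ex_minn (exb j).
have rbP j : [/\ cnt (rb j) = j, cnt (rb j).+1 = j.+1 &
    phase_start k (y (rb j)) (y (rb j).+1)].
  rewrite /rb; case: ex_minnP => i ji imin.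
  have : (cnt i <= j)%N.
    case: i ji imin => [//|i] _ imin; rewrite leqNgt; apply/negP => /imin.
    by rewrite ltnn.
  by move: ji; rewrite cntS; case: phase_start => /= ji ile; split=> //; lia.
have cntle i i' : (i <= i')%N -> (cnt i <= cnt i')%N by exact: service_count_mono.
have rbS j : (rb j < rb j.+1)%N.
  rewrite ltnNge; apply/negP => /cntle.
  by have [-> _ _] := rbP j; have [-> _ _] := rbP j.+1; rewrite ltnn.
(* Without a completion the system would stay busy, but a phase that begins in a busy system, as at
   [rb j.+1], begins by a completion. *)
have exc j : exists i, (rb j < i)%N && phase_completion k (y i) (y i.+1).
  apply: contrapT => /forallNP noc.
  have busy i : (rb j < i)%N -> y i != idle.
    elim: i => // i IHi; rewrite ltnS leq_eqVlt => /orP[/eqP<-|ji].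
      by have [_ _ /phase_startN0] := rbP j.
    have := noc i; rewrite ji /= => /negP/negPf nc.
    by have := y_step i; rewrite nc orbF => /arrivalN0.
  have [_ _ sb] := rbP j.+1.
  by apply: (noc (rb j.+1)); rewrite rbS phase_start_busy// busy.
pose rc j := ex_minn (exc j).
have rcP j : [/\ (rb j < rc j)%N, phase_completion k (y (rc j)) (y (rc j).+1) &
    forall i, (rb j < i < rc j)%N -> ~~ phase_completion k (y i) (y i.+1)].
  rewrite /rc; case: ex_minnP => i /andP[ji ci] imin; split => // i' /andP[ji' i'i].
  by apply/negP => ci'; have := imin i'; rewrite ji' ci' leqNgt i'i => /(_ isT).
have inphase j i : (rb j < i <= rc j)%N -> service_state y i = (j.+1, true).
  have [brc crc nrc] := rcP j.
  elim: i => // i IHi /andP[]; rewrite ltnS leq_eqVlt => /orP[/eqP<-|ji] irc.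
    have [cb _ sb] := rbP j.
    by rewrite /= /service_update sb -/(cnt _) cb.
  have sti := IHi _; rewrite ji (ltnW irc) in sti; have {}sti := sti isT.
  have bi : y i != idle by apply: service_state_busy; rewrite sti.
  have nc : ~~ phase_completion k (y i) (y i.+1) by apply: nrc; rewrite ji irc.
  have := y_step i; rewrite (negPf nc) orbF => /arrivalN0 bi1.
  rewrite /= /service_update sti bi1 /=; case: ifPn => // /(phase_start_busy bi) ci.
  by rewrite ci in nc.
(* Once completed, phase [j] is never resumed: either a later phase has begun or the flag stays
   down. *)
have afterphase0 j i : (rc j < i)%N ->
    (j.+2 <= cnt i)%N || (service_state y i == (j.+1, false)).
  elim: i => // i IHi; rewrite ltnS leq_eqVlt => /orP[/eqP<-|/IHi{IHi}].
    have [brc crc nrc] := rcP j.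
    have := inphase j (rc j); rewrite brc leqnn => /(_ isT) src.
    rewrite {1}/cnt /= /service_update src.
    case: ifPn => [_|/(phase_completion_idle crc) ->] /=; first by rewrite leqnn.
    by rewrite eqxx orbT.
  move=> /orP[ji|/eqP sti]; first by apply/orP; left; apply: (leq_trans ji); exact: cntle.
  rewrite {1}/cnt /= /service_update sti; case: ifP => _ /=; first by rewrite leqnn.
  by rewrite eqxx orbT.
have afterphase j i : (rc j < i)%N -> service_state y i != (j.+1, true).
  move=> /afterphase0/orP[|/eqP->]; last by rewrite xpair_eqE andbF.
  by rewrite /cnt; case: service_state => [b f] /=; rewrite xpair_eqE; lia.
exists rb, rc; split => // [i|i j].
- split => [si|[j ->]]; last by have [] := rbP j.
  exists (cnt i); apply/eqP; rewrite eqn_leq; apply/andP; split; last first.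
    by rewrite {1}/rb; case: ex_minnP => m _; apply; rewrite cntS si addn1.
  rewrite leqNgt; apply/negP => /cntle; have [_ -> _] := rbP (cnt i).
  by rewrite ltnn.
- apply/idP/idP => [/eqP sti|/inphase-> //].
  apply/andP; split.
    rewrite ltnNge; apply/negP => /cntle.
    by have [-> _ _] := rbP j; rewrite /cnt sti /= ltnn.
  by rewrite leqNgt; apply/negP => /afterphase; rewrite sti eqxx.
Qed.

End EmbeddedChain.
End ServiceAutomaton.

(** * Step functions and their time changes *)

Section StepPaths.
Context {R : realType}.
Implicit Types (t h : R) (J : nat -> R).

Lemma nbhs_right_itv (P : R -> Prop) t : (\forall u \near t^'+, P u) ->
  exists2 e, 0 < e & forall u, t < u < t + e -> P u.
Proof.
move=> [e /= e0 He]; exists e => // u /andP[tu ute]; apply: He => //=.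
by rewrite distrC ger0_norm ?subr_ge0 1?ltW// ltrBlDl.
Qed.

Lemma nbhs_left_itv (P : R -> Prop) t : (\forall u \near t^'-, P u) ->
  exists2 e, 0 < e & forall u, t - e < u < t -> P u.
Proof.
move=> [e /= e0 He]; exists e => // u /andP[tu ut]; apply: He => //=.
by rewrite ger0_norm ?subr_ge0 1?ltW// ltrBlDr -ltrBlDl.
Qed.

Section Defs.
Context {U : Type}.

(** [y] is the embedded jump chain and [J i] its entrance time into [y i]. The last field forbids
    fictitious jumps, so that every [J i.+1] is a time where [x] really changes value. *)
Record step_path (x : R -> U) (J : nat -> R) (y : nat -> U) : Prop := {
  step_path0 : J 0%N = 0;
  step_path_lt : forall i, J i < J i.+1;
  step_path_unbounded : forall t, exists i, t < J i;
  step_path_val : forall i t, J i <= t -> t < J i.+1 -> x t = y i;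
  step_path_neq : forall i, y i.+1 <> y i
}.

Section Theory.
Context {x : R -> U} {J : nat -> R} {y : nat -> U}.
Hypothesis xJy : step_path x J y.

Lemma step_path_le i j : (i <= j)%N -> J i <= J j.
Proof.
elim: j => [|j IHj]; first by rewrite leqn0 => /eqP->.
rewrite leq_eqVlt => /orP[/eqP-> //|]; rewrite ltnS => /IHj/le_trans; apply.
exact/ltW/(step_path_lt xJy).
Qed.

Lemma step_path_mono i j : (J i < J j) = (i < j)%N.
Proof.
apply/idP/idP => [|ij]; first by apply: contraTT; rewrite -leqNgt -leNgt => /step_path_le.
exact: lt_le_trans (step_path_lt xJy i) (step_path_le ij).
Qed.

Lemma step_path_ge0 i : 0 <= J i.
Proof. by rewrite -(step_path0 xJy) step_path_le. Qed.

Lemma step_path_index t : 0 <= t -> exists i, J i <= t < J i.+1.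
Proof.
move=> t0; have [n tn] := step_path_unbounded xJy t.
case: (ex_minnP (ex_intro (fun i => t < J i) n tn)) => -[|i] ti imin.
  by move: ti; rewrite (step_path0 xJy) ltNge t0.
exists i; rewrite ti andbT leNgt; apply/negP => /imin.
by rewrite ltnn.
Qed.

Lemma step_path_index_uniq t i j : J i <= t < J i.+1 -> J j <= t < J j.+1 -> i = j.
Proof.
move=> /andP[it ti] /andP[jt tj].
have := le_lt_trans it tj; have := le_lt_trans jt ti.
by rewrite !step_path_mono !ltnS => ji ij; apply/eqP; rewrite eqn_leq ji ij.
Qed.

End Theory.

(** The jump times are obtained by iterating the infimum of the later times with a different value.
    Right continuity makes each of them strictly later than the previous one, left limits exclude
    accumulation, and the last hypothesis excludes absorption. *)
Lemma cadlag_step_path (x : R -> U) :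
  (forall t, 0 <= t -> \forall u \near t^'+, x u = x t) ->
  (forall t, 0 < t -> exists a, \forall u \near t^'-, x u = a) ->
  (forall t, 0 <= t -> exists2 u, t < u & x u <> x t) ->
  exists J y, step_path x J y.
Proof.
move=> xr xl xn.
pose D t := [set u | t < u /\ x u <> x t].
pose next t := inf (D t).
have D0 t : 0 <= t -> D t !=set0 by move=> /xn[u tu xu]; exists u.
have Dlb t : has_lbound (D t) by exists t => u [/ltW].
have next_gt t : 0 <= t -> t < next t.
  move=> t0; have [e e0 He] := nbhs_right_itv (xr _ t0).
  apply: (@lt_le_trans _ _ (t + e)); first by rewrite ltrDl.
  apply: lb_le_inf; first exact: D0.
  move=> u [tu xu]; rewrite leNgt; apply/negP => ute; apply: xu.
  by apply: He; rewrite tu.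
have next_val t u : 0 <= t -> t <= u -> u < next t -> x u = x t.
  move=> t0; rewrite le_eqVlt => /orP[/eqP-> //|tu] un; apply: contrapT => xu.
  by move: un; rewrite ltNge => /negP; apply; apply: ge_inf.
(* Otherwise right continuity at [next t] would prolong the constancy beyond the infimum. *)
have next_neq t : 0 <= t -> x (next t) <> x t.
  move=> t0 xnt; have n0 : 0 <= next t by exact/ltW/(le_lt_trans t0)/next_gt.
  have [e e0 He] := nbhs_right_itv (xr _ n0).
  have : next t + e <= next t.
    apply: lb_le_inf; first exact: D0.
    move=> u [tu xu]; rewrite leNgt; apply/negP => une; apply: xu.
    have [un|] := ltP u (next t); first exact: next_val (ltW tu) un.
    by rewrite le_eqVlt => /orP[/eqP<- //|nu]; rewrite -xnt; apply: He; rewrite nu.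
  by rewrite gerDl leNgt e0.
pose J i := iter i next 0.
have J0 i : 0 <= J i by elim: i => //= i IHi; exact/ltW/(le_lt_trans IHi)/next_gt.
have Jlt i : J i < J i.+1 by exact: next_gt.
have Jle i j : (i <= j)%N -> J i <= J j.
  elim: j => [|j IHj]; first by rewrite leqn0 => /eqP->.
  rewrite leq_eqVlt => /orP[/eqP-> //|]; rewrite ltnS => /IHj/le_trans; apply.
  exact/ltW/Jlt.
exists J, (x \o J); split; [by []|exact: Jlt| 
  |exact: (fun i t => @next_val _ t (J0 i))|exact: (fun i => next_neq _ (J0 i))].
(* Bounded jump times would increase to their supremum; the left limit there would make the path
   constant on a left neighbourhood, which contains successive jumps. *)
move=> t; apply: contrapT => /forallNP Jt.
have Jub : has_ubound (range J).
  by exists t => _ [i _ <-]; rewrite leNgt; exact/negP/Jt.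
have Js i : J i <= sup (range J) by apply: ub_le_sup => //; exists i.
have s0 : 0 < sup (range J) by exact: lt_le_trans (Jlt 0%N) (Js 1%N).
have [a xa] := xl _ s0; have [e e0 He] := nbhs_left_itv xa.
have [_ [i _ <-] ei] : exists2 z, range J z & sup (range J) - e < z.
  by apply: sup_adherent => //; split => //; exists (J 0%N), 0%N.
have vala j : (i <= j)%N -> x (J j) = a.
  move=> ij; apply: He; rewrite (lt_le_trans ei (Jle _ _ ij)) /=.
  exact: lt_le_trans (Jlt j) (Js j.+1).
have := next_neq _ (J0 i); rewrite -/(J i.+1) (vala i) ?(vala i.+1) ?leqnSn//.
Qed.

End Defs.

Section Jumps.
Context {x : R -> nat * nat} {J : nat -> R} {y : nat -> nat * nat}.
Hypothesis xJy : step_path x J y.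

(** Just before [t] the path has the value [y j] for which [J j < t <= J j.+1]; hence [a <> b]
    forces [t] to be a jump time. *)
Lemma jump_step_path t a b : a <> b ->
  jump x t a b <-> exists i, [/\ t = J i.+1, a = y i & b = y i.+1].
Proof.
move=> ab; split => [[t0 /nbhs_left_itv[e e0 He] xtb]|[i [-> -> ->]]].
  have [i /andP[it ti]] := step_path_index xJy (ltW t0).
  have b_eq : b = y i by rewrite -xtb (step_path_val xJy it ti).
  have left_val j : J j < t -> t <= J j.+1 -> y j = a.
    move=> jt tj; pose u := (Num.max (J j) (t - e) + t) / 2.
    have mt : Num.max (J j) (t - e) < t by rewrite gt_max jt gtrBl e0.
    have [mu ut] : Num.max (J j) (t - e) < u /\ u < t.
      by rewrite /u; split; lra.
    move: mu; rewrite gt_max => /andP[ju teu].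
    rewrite -(step_path_val xJy (ltW ju) (lt_le_trans ut tj)); apply: He.
    by rewrite teu ut.
  move: it; rewrite le_eqVlt => /orP[/eqP Jt|it]; last first.
    by case: ab; rewrite b_eq (left_val i it (ltW ti)).
  case: i Jt ti b_eq => [|i] Jt ti b_eq.
    by move: t0; rewrite -Jt (step_path0 xJy) ltxx.
  by exists i; split => //; rewrite (left_val i) -?Jt// (step_path_lt xJy).
split.
- exact: le_lt_trans (step_path_ge0 xJy i) (step_path_lt xJy i).
- near=> u; apply: (step_path_val xJy); last by near: u; exact: nbhs_left_lt.
  by apply/ltW; near: u; apply: nbhs_left_gt; exact: (step_path_lt xJy).
- by apply: (step_path_val xJy) => //; exact: (step_path_lt xJy).
Unshelve. all: by end_near.
Qed.

Lemma step_path_inter_phase_times k :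
  (forall i, state_phase k (y i)) ->
  (forall i, arrival k (y i) (y i.+1) || phase_completion k (y i) (y i.+1)) ->
  forall rb rc : nat -> nat,
  (forall j, (rb j < rb j.+1)%N) ->
  (forall i, phase_start k (y i) (y i.+1) <-> exists j, i = rb j) ->
  (forall j, [/\ (rb j < rc j)%N, phase_completion k (y (rc j)) (y (rc j).+1) &
    forall i, (rb j < i < rc j)%N -> ~~ phase_completion k (y i) (y i.+1)]) ->
  inter_phase_times k x (fun j => J (rc j).+1 - J (rb j).+1).
Proof.
move=> ystate ystep rb rc rbS rbP rcP.
exists (fun j => J (rb j).+1), (fun j => J (rc j).+1); split => //.
- by move=> j; rewrite (step_path_mono xJy) ltnS.
- move=> t; split.
    move=> [a [b [tab sab]]].
    have ab : a <> b by move=> ab; have := phase_start_neq sab; rewrite ab eqxx.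
    have [i [-> ai bi]] := (jump_step_path t ab).1 tab.
    have /rbP[j ->] : phase_start k (y i) (y i.+1) by rewrite -ai -bi.
    by exists j.
  move=> [j ->]; exists (y (rb j)), (y (rb j).+1); split; last by apply/rbP; exists j.
  apply/jump_step_path; last by exists (rb j).
  exact/nesym/(step_path_neq xJy).
- move=> j; have [brc crc nrc] := rcP j; split.
  + by rewrite (step_path_mono xJy) ltnS.
  + exists (y (rc j)), (y (rc j).+1); split => //.
    by apply/jump_step_path; [exact/nesym/(step_path_neq xJy)|exists (rc j)].
  + move=> t bt tc [a [b [tab cab]]].
    have ab : a <> b by move=> ab; have := phase_completion_neq cab; rewrite ab eqxx.
    have [i [ti ai bi]] := (jump_step_path t ab).1 tab.
    move: bt tc; rewrite ti !(step_path_mono xJy) !ltnS => bi' ic.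
    by have := nrc i; rewrite bi' ic -ai -bi cab => /(_ isT).
Qed.

End Jumps.

(* As [sup set0 = 0], the left limit at [0] is [0]. *)
Definition left_limit (s : R -> R) t : R := sup [set s r | r in [set r | 0 <= r < t]].

Lemma left_limit0 s : left_limit s 0 = 0.
Proof.
suff H : [set s r | r in [set r | 0 <= r < 0]] = set0 by rewrite /left_limit H sup0.
apply/seteqP; split => // z [r /= /andP[r0 r1] _].
by move: (le_lt_trans r0 r1); rewrite ltxx.
Qed.

Section TimeChange.
Variable s : R -> R.
Hypothesis s0 : s 0 = 0.
Hypothesis s_incr : forall r t, 0 <= r -> r < t -> s r < s t.
Hypothesis s_unbounded : forall t, exists2 r, 0 <= r & t < s r.

Let s_ndecr r t : 0 <= r -> r <= t -> s r <= s t.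
Proof.
move=> r0; rewrite le_eqVlt => /orP[/eqP-> //|rt].
by apply/ltW/s_incr.
Qed.

Let left_limit_ub t : has_ubound [set s r | r in [set r | 0 <= r < t]].
Proof. by exists (s t) => _ [r /= /andP[r0 /ltW rt] <-]; exact: s_ndecr. Qed.

Lemma left_limit_ge r t : 0 <= r -> r < t -> s r <= left_limit s t.
Proof. by move=> r0 rt; apply: ub_le_sup => //; exists r => //=; rewrite r0. Qed.

Lemma left_limit_le t u : 0 <= t -> t <= u -> left_limit s t <= s u.
Proof.
move=> t0 tu; have := t0; rewrite le_eqVlt => /orP[/eqP t00|t_gt0].
  by rewrite -t00 left_limit0 -s0 s_ndecr// t00.
apply: ge_sup; first by exists (s 0), 0 => //=; rewrite lexx.
by move=> _ [r /= /andP[r0 /ltW rt] <-]; apply: s_ndecr => //; exact: le_trans tu.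
Qed.

Lemma left_limit_gtP t u : 0 < t -> u < left_limit s t ->
  exists2 r, 0 <= r < t & u < s r.
Proof.
move=> t0; move=> ut.
have [_ [r /= rt <-] ur] : exists2 z, [set s r | r in [set r | 0 <= r < t]] z &
    left_limit s t - (left_limit s t - u) < z.
  apply: sup_adherent; first by rewrite subr_gt0.
  by split => //; exists (s 0), 0 => //=; rewrite lexx.
by exists r => //; move: ur; rewrite subKr.
Qed.

Lemma cvg_left_limit t (r : nat -> R) : 0 < t -> (forall n, 0 <= r n < t) ->
  r n @[n --> \oo] --> t -> s (r n) @[n --> \oo] --> left_limit s t.
Proof.
move=> t0 rt rcvg; apply/cvgrPdist_lt => e e0.
have [q /andP[q0 qt] sq] : exists2 q, 0 <= q < t & left_limit s t - e < s q.
  by apply: left_limit_gtP => //; rewrite gtrBl.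
near=> n.
have /andP[rn0 rnt] := rt n.
rewrite ger0_norm ?subr_ge0 ?left_limit_ge//.
rewrite ltrBlDl -ltrBlDr; apply: (lt_le_trans sq); apply: s_ndecr => //.
near: n; have : 0 < t - q by rewrite subr_gt0.
move/cvgrPdist_lt : rcvg => /[apply]; apply: filterS => n.
have /andP[rn0 rnt] := rt n.
move=> /ltr_normlW; rewrite ltrBlDr => tq; apply/ltW; move: tq; lra.
Unshelve. all: by end_near.
Qed.

(** This is [inverse_subordinator] along one fixed path [s]. *)
Definition first_passage t : R := inf [set r | 0 <= r /\ t < s r].

Let passage_lb t : has_lbound [set r | 0 <= r /\ t < s r].
Proof. by exists 0 => r []. Qed.

Lemma first_passage_ge0 t : 0 <= first_passage t.
Proof. by apply: lb_le_inf; [have [r] := s_unbounded t; exists r|move=> r []]. Qed.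

(** The level [t] is passed strictly before [u] exactly when some [s r] with [r < u] exceeds it.
    This is why a jump at [u] is carried to the left limit of [s] at [u] and not to [s u]. *)
Lemma first_passage_lt t u : 0 < u -> 0 <= t ->
  (first_passage t < u) = (t < left_limit s u).
Proof.
move=> u0 t0; apply/idP/idP.
  apply: contraTT; rewrite -!leNgt => ut.
  apply: lb_le_inf; first by have [r] := s_unbounded t; exists r.
  move=> r [r0 tr]; rewrite leNgt; apply/negP => ru.
  by have := lt_le_trans tr (le_trans (left_limit_ge r0 ru) ut); rewrite ltxx.
move=> /(left_limit_gtP u0)[r /andP[r0 ru] tr].
by apply: le_lt_trans ru; apply: ge_inf.
Qed.

Lemma step_path_first_passage {U} {x : R -> U} {J y} : step_path x J y ->
  step_path (x \o first_passage) (fun i => left_limit s (J i)) y.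
Proof.
move=> xJy; have J0 := step_path_ge0 xJy; have Jlt := step_path_lt xJy.
have Jgt0 i : 0 < J i.+1 by exact: le_lt_trans (J0 i) (Jlt i).
have l0 : left_limit s (J 0%N) = 0 by rewrite (step_path0 xJy) left_limit0.
split => //.
(* The midpoint separates the two left limits: [left_limit s (J i) <= s (J i) < s m <= left_limit s
   (J i.+1)]. *)
- move=> i; pose m := (J i + J i.+1) / 2.
  have [im mi] : J i < m /\ m < J i.+1 by have := Jlt i; rewrite /m; split; lra.
  have m0 : 0 <= m by exact: le_trans (J0 i) (ltW im).
  apply: (@le_lt_trans _ _ (s (J i))); first exact: left_limit_le.
  apply: (@lt_le_trans _ _ (s m)); first exact: s_incr.
  exact: left_limit_ge.
- move=> t; have [r r0 tr] := s_unbounded t.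
  have [i ri] := step_path_unbounded xJy r; exists i.
  by apply: (lt_le_trans tr); exact: left_limit_ge.
- move=> i t it ti /=.
  have t0 : 0 <= t.
    apply: le_trans it; case: i {ti} => [|i]; first by rewrite l0.
    by rewrite -s0 left_limit_ge.
  apply: (step_path_val xJy); last by rewrite first_passage_lt.
  case: i it {ti} => [|i] it; first by rewrite (step_path0 xJy) first_passage_ge0.
  by rewrite leNgt first_passage_lt// -leNgt.
- exact: step_path_neq xJy.
Qed.

End TimeChange.
End StepPaths.

(** * Approximation along a grid *)

Section Skeleton.
Context {R : realType}.
Variable k : nat.

Definition skeleton {U : Type} (x : R -> U) (h : R) (i : nat) : U := x (i%:R * h).

(** Each cell is attributed to the phase in progress at its right end-point. Phases are numbered
    from 0, so phase [j] is the one in progress when [j.+1] phases have begun. *)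
Definition phase_increment (x : R -> nat * nat) (s : R -> R) (h : R) (N j : nat) : R :=
  \sum_(i < N) (service_state k (skeleton x h) i.+1 == (j.+1, true))%:R *
    (s (i.+1%:R * h) - s (i%:R * h)).

Lemma grid_index (h t : R) : 0 < h -> 0 < t ->
  exists i, i%:R * h < t <= i.+1%:R * h.
Proof.
move=> h0 t0; have th : 0 <= t / h by rewrite divr_ge0// ltW.
have ex : exists i, t <= i.+1%:R * h.
  exists (Num.trunc (t / h)); rewrite -ler_pdivrMr//.
  exact/ltW/truncnS_gt.
case: (ex_minnP ex) => i ti imin; exists i; rewrite ti andbT.
case: i ti imin => [|i] _ imin; first by rewrite mul0r.
by rewrite ltNge; apply/negP => /imin; rewrite ltnn.
Qed.

Section Matching.
Context {x : R -> nat * nat} {J : nat -> R} {y : nat -> nat * nat}.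
Hypothesis xJy : step_path x J y.

(** When the mesh does not exceed the holding times, a cell contains at most one jump: the grid then
    shows every state of the jump chain in turn, and repetitions do not move the automaton. *)
Lemma skeleton_service_state (h : R) r : 0 < h ->
  (forall i, (i < r)%N -> h <= J i.+1 - J i) ->
  forall i, i%:R * h < J r -> exists2 q, J q <= i%:R * h < J q.+1 &
    service_state k (skeleton x h) i = service_state k y q.
Proof.
move=> h0 hr; elim=> [|i IHi] ir.
  by exists 0%N => //; rewrite mul0r (step_path0 xJy) lexx -{1}(step_path0 xJy) (step_path_lt xJy).
have iS : i.+1%:R * h = i%:R * h + h by rewrite -natr1 mulrDl mul1r.
have ilt : i%:R * h < i.+1%:R * h by rewrite iS ltrDl.
have [q /andP[qi iq] sti] := IHi (lt_trans ilt ir).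
have xi : skeleton x h i = y q by exact: (step_path_val xJy qi iq).
have [iq1|iq1] := ltP (i.+1%:R * h) (J q.+1).
  exists q; first by rewrite (le_trans qi (ltW ilt)) iq1.
  have xi1 : skeleton x h i.+1 = y q.
    exact: (step_path_val xJy (le_trans qi (ltW ilt)) iq1).
  by rewrite /= sti xi xi1 service_update_id.
have qr : (q.+1 < r)%N by rewrite -(step_path_mono xJy); exact: le_lt_trans ir.
have iq2 : i.+1%:R * h < J q.+2.
  by have := hr _ qr; rewrite iS; move: iq; lra.
exists q.+1; first by rewrite iq1 iq2.
have xi1 : skeleton x h i.+1 = y q.+1 by exact: (step_path_val xJy iq1 iq2).
by rewrite /= sti xi xi1.
Qed.

Lemma skeleton_count (h : R) r i : 0 < h ->
  (forall i, (i <= r)%N -> h <= J i.+1 - J i) -> J r.+1 <= i%:R * h ->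
  ((service_state k y r).1 <= (service_state k (skeleton x h) i).1)%N.
Proof.
move=> h0 hr ri.
have J10 : 0 < J r.+1 by exact: le_lt_trans (step_path_ge0 xJy r) (step_path_lt xJy r).
(* [i0] is the last grid point before [J r.+1]; since the holding time in [y r] is at least [h], it
   is not before [J r], so the grid shows [y r] there. *)
have [i0 /andP[i0r ri0]] := grid_index h0 J10.
have i0i : (i0 <= i)%N.
  rewrite leqNgt; apply/negP => ii0; have := lt_le_trans i0r ri.
  by rewrite ltr_pM2r// ltr_nat ltnNge (ltnW ii0).
apply: leq_trans (service_count_mono k (skeleton x h) i0i).
have [|q /andP[qi iq] ->] := skeleton_service_state h0 _ i0r; first by move=> ?; exact: hr.
suff -> : q = r by [].
apply: (step_path_index_uniq xJy (t := i0%:R * h)); first by rewrite qi.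
rewrite i0r andbT; have := hr r (leqnn r).
by move: ri0; rewrite -natr1 mulrDl mul1r; lra.
Qed.

End Matching.

Lemma grid_telescope (s : R -> R) (h : R) (a b N : nat) : (a <= b)%N -> (b <= N)%N ->
  \sum_(i < N) (a <= i < b)%N%:R * (s (i.+1%:R * h) - s (i%:R * h)) =
  s (b%:R * h) - s (a%:R * h).
Proof.
move=> ab bN; rewrite -(big_mkord xpredT (fun i => (a <= i < b)%N%:R *
  (s (i.+1%:R * h) - s (i%:R * h)))) (big_cat_nat (leq0n b) bN)//=
  (big_cat_nat (leq0n a) ab)//=.
rewrite big_nat_cond big1 ?add0r => [|i]; last first.
  by rewrite andbT => /andP[_ ia]; rewrite leqNgt ia mul0r.
rewrite [X in _ + X]big_nat_cond [X in _ + X]big1 ?addr0 => [|i]; last first.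
  by rewrite andbT => /andP[bi _]; rewrite [(i < b)%N]ltnNge bi andbF mul0r.
rewrite -(@telescope_sumr _ _ _ (fun i => s (i%:R * h)))//.
rewrite big_nat_cond [RHS]big_nat_cond; apply: eq_bigr => i.
by rewrite andbT => ->; rewrite mul1r.
Qed.

Section Limit.
Context {x : R -> nat * nat} {J : nat -> R} {y : nat -> nat * nat}.
Hypothesis xJy : step_path x J y.
Hypothesis y_state : forall i, state_phase k (y i).
Hypothesis y_step : forall i,
  arrival k (y i) (y i.+1) || phase_completion k (y i) (y i.+1).
Hypothesis y_starts : forall i0, exists2 i, (i0 <= i)%N & phase_start k (y i) (y i.+1).

Variables (h : nat -> R) (N : nat -> nat).
Hypothesis h_gt0 : forall n, 0 < h n.
Hypothesis h_cvg : h n @[n --> \oo] --> (0 : R).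
Hypothesis N_cvg : forall t, \forall n \near \oo, t <= (N n)%:R * h n.

Let h_fine r : \forall n \near \oo, forall i, (i < r)%N -> h n <= J i.+1 - J i.
Proof.
elim: r => [|r IHr]; first by near=> n.
have : \forall n \near \oo, h n < J r.+1 - J r.
  by apply: (cvgr_lt 0) => //; rewrite subr_gt0 (step_path_lt xJy).
apply: filterS2 IHr => n hn hr i; rewrite ltnS leq_eqVlt => /orP[/eqP->|]; last exact: hn.
exact: ltW.
Unshelve. all: by end_near.
Qed.

Lemma skeleton_count_unbounded m : \forall n \near \oo,
  (m < (service_state k (skeleton x (h n)) (N n)).1)%N.
Proof.
have [r mr] := service_count_unbounded y_starts m.
near=> n; apply: (leq_trans mr); apply: (skeleton_count xJy) => //.
  move=> i ir; move: i ir; near: n; exact: (h_fine r.+1).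
by near: n; exact: N_cvg.
Unshelve. all: by end_near.
Qed.

Variables rb rc : nat -> nat.
Hypothesis rbc : forall j, (rb j < rc j)%N.
Hypothesis rbcP : forall i j,
  (service_state k y i == (j.+1, true)) = (rb j < i <= rc j)%N.

(** The mesh must work for all [i] at once. The index [r] is taken so large that phase [j.+1] has
    already begun at [y r]: up to [J r.+1] the grid reproduces the jump chain, and beyond it both
    sides are false. *)
Lemma skeleton_phase_indicator j : \forall n \near \oo, forall i,
  (service_state k (skeleton x (h n)) i == (j.+1, true)) =
  (J (rb j).+1 <= i%:R * h n) && (i%:R * h n < J (rc j).+1).
Proof.
have [r jr] := service_count_unbounded y_starts j.+1.
near=> n => i.
have fine q : (q <= r)%N -> h n <= J q.+1 - J q.
  by move: q; near: n; exact: (h_fine r.+1).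
have [ir|ri] := ltP (i%:R * h n) (J r.+1).
  have [q /andP[qi iq] ->] := skeleton_service_state (r := r.+1) xJy (h_gt0 n) fine ir.
  rewrite rbcP; congr andb; apply/idP/idP.
  - by move=> bq; apply: le_trans qi; exact: (step_path_le xJy).
  - by move=> /le_lt_trans/(_ iq); rewrite (step_path_mono xJy) ltnS.
  - by move=> qc; apply: (lt_le_trans iq); exact: (step_path_le xJy).
  - by move=> /(le_lt_trans qi); rewrite (step_path_mono xJy) ltnS.
have := skeleton_count xJy (h_gt0 n) fine ri.
move=> /(leq_trans jr) jst; transitivity false.
  by apply/eqP => st; rewrite st /= ltnn in jst.
apply/esym/negbTE; rewrite negb_and -!leNgt -ltNge; apply/orP; right.
apply: le_trans ri; apply: (step_path_le xJy); rewrite ltnS leqNgt; apply/negP => rrc.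
have : ((service_state k y r).1 <= (service_state k y (rc j)).1)%N.
  by apply: service_count_mono; exact: ltnW.
have /eqP-> : service_state k y (rc j) == (j.+1, true) by rewrite rbcP rbc leqnn.
by rewrite leqNgt jr.
Unshelve. all: by end_near.
Qed.

Variable s : R -> R.
Hypothesis s_incr : forall r t, 0 <= r -> r < t -> s r < s t.

(** The sum telescopes between [kb n] and [kc n], the last grid points strictly before the beginning
    and the completion of the phase. They approach these instants strictly from below, which
    produces left limits. *)
Lemma cvg_phase_increment j :
  phase_increment x s (h n) (N n) j @[n --> \oo] -->
  left_limit s (J (rc j).+1) - left_limit s (J (rb j).+1).
Proof.
have Jgt0 i : 0 < J i.+1.
  by exact: le_lt_trans (step_path_ge0 xJy i) (step_path_lt xJy i).
have /choice[kb kbP] n : exists i, i%:R * h n < J (rb j).+1 <= i.+1%:R * h n.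
  exact: grid_index.
have /choice[kc kcP] n : exists i, i%:R * h n < J (rc j).+1 <= i.+1%:R * h n.
  exact: grid_index.
have cvgk (t : R) (kk : nat -> nat) :
    (forall n, (kk n)%:R * h n < t <= (kk n).+1%:R * h n) -> 0 < t ->
    s ((kk n)%:R * h n) @[n --> \oo] --> left_limit s t.
  move=> kkP t0; apply: cvg_left_limit => //.
    by move=> n; have /andP[-> _] := kkP n; rewrite mulr_ge0// ltW.
  apply/cvgrPdist_lt => e e0; near=> n; have /andP[kt tk] := kkP n.
  rewrite gtr0_norm ?subr_gt0//.
  have : h n < e by near: n; exact: (cvgr_lt 0 h_cvg).
  by move: tk; rewrite -natr1 mulrDl mul1r; lra.
apply: (@cvg_trans _ (s ((kc n)%:R * h n) - s ((kb n)%:R * h n) @[n --> \oo])); last first.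
  by apply: cvgB; exact: cvgk.
apply: near_eq_cvg; near=> n.
have ind : forall i, (service_state k (skeleton x (h n)) i == (j.+1, true)) =
    (J (rb j).+1 <= i%:R * h n) && (i%:R * h n < J (rc j).+1).
  by near: n; exact: skeleton_phase_indicator.
have hn := h_gt0 n.
have lt_grid a b : (a%:R * h n < b%:R * h n) = (a < b)%N by rewrite ltr_pM2r// ltr_nat.
have /andP[b1 b2] := kbP n; have /andP[c1 c2] := kcP n.
rewrite -(@grid_telescope s (h n) (kb n) (kc n) (N n)).
- rewrite /phase_increment; apply: eq_bigr => i _; rewrite ind; congr (_%:R * _).
  congr (nat_of_bool _); congr andb; apply/idP/idP.
  + by move=> bi; apply: (le_trans b2); rewrite ler_pM2r// ler_nat.
  + by move=> /(lt_le_trans b1); rewrite lt_grid ltnS.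
  + by move=> ic; apply: le_lt_trans c1; rewrite ler_pM2r// ler_nat.
  + by move=> /lt_le_trans/(_ c2); rewrite lt_grid ltnS.
- have : (kb n)%:R * h n < J (rc j).+1.
    by apply: (lt_le_trans b1); rewrite (step_path_le xJy)// ltnS ltnW.
  by move=> /lt_le_trans/(_ c2); rewrite lt_grid ltnS.
- have : J (rc j).+1 <= (N n)%:R * h n by near: n; exact: N_cvg.
  by move=> /(lt_le_trans c1); rewrite lt_grid => /ltnW.
Unshelve. all: by end_near.
Qed.

End Limit.
End Skeleton.

(** * First-order expansion of the transition function *)

Section ESum.
Context {R : realType} {S : choiceType}.
Local Open Scope ereal_scope.

Lemma esum_ge_seq (A : set S) (a : S -> \bar R) (s : seq S) : uniq s ->
  [set` s] `<=` A -> \sum_(i <- s) a i <= \esum_(i in A) a i.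
Proof.
move=> us sA; apply: esum_ge; exists [set` s]; last by rewrite -fsbig_seq.
by split => //; exact: finite_seq.
Qed.

Lemma esum_supp_seq (A : set S) (a : S -> \bar R) (s : seq S) : uniq s ->
  [set` s] `<=` A -> (forall i, A i -> 0 <= a i) ->
  (forall i, A i -> i \notin s -> a i = 0) ->
  \esum_(i in A) a i = \sum_(i <- s) a i.
Proof.
move=> us sA a0 as0.
rewrite (esumID [set` s])// [X in _ + X]esum1 ?adde0; last first.
  by move=> i [Ai /= /negP si]; exact: as0.
rewrite (_ : A `&` [set` s] = [set` s]); last by apply/setIidPr.
rewrite (fsbig_seq _ _ us); apply: esum_fset; first exact: finite_seq.
by move=> i /set_mem/sA; exact: a0.
Qed.

Lemma esumZl (A : set S) (c : R) (a : S -> \bar R) : (0 <= c)%R ->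
  (forall i, 0 <= a i) ->
  \esum_(i in A) (c%:E * a i) = c%:E * \esum_(i in A) a i.
Proof.
move=> c0 a0.
(* One inequality suffices: for [c > 0], applying it to [c^-1] and the family [c * a] gives the
   converse. *)
have le (e : R) (b : S -> \bar R) : (0 <= e)%R -> (forall i, 0 <= b i) ->
    \esum_(i in A) (e%:E * b i) <= e%:E * \esum_(i in A) b i.
  move=> e0 b0; apply: ge_ereal_sup => _ [F [finF FA] <-].
  rewrite -ge0_mule_fsumr//; apply: lee_wpmul2l; first by rewrite lee_fin.
  by apply: esum_ge; exists F.
apply/eqP; rewrite eq_le le//=.
have /orP[/eqP<-|c_gt0] : ((0 == c) || (0 < c))%R by rewrite -le_eqVlt.
  by rewrite mul0e esum_ge0// => i _; rewrite mul0e.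
have c_gt0' : 0 < c%:E by rewrite lte_fin.
have ca0 i : 0 <= c%:E * a i by rewrite mule_ge0// ltW.
rewrite -(@lee_pmul2l _ c^-1%:E) ?lte_fin ?invr_gt0//.
rewrite muleA -EFinM mulVf ?gt_eqF// mul1e.
apply: le_trans (le _ _ _ ca0); rewrite ?invr_ge0//; apply: le_esum => i _.
by rewrite muleA -EFinM mulVf ?mul1e// gt_eqF.
Qed.

End ESum.

Section TransitionFunction.
Context {R : realType} {S : countType}.
Variables (q : S -> S -> R) (p : R -> S -> S -> R).
Hypothesis pP : transition_function q p.

Lemma tf_le1 t x y : 0 <= t -> p t x y <= 1.
Proof.
move=> t0; rewrite -lee_fin -(tf_sum1 pP x t0).
have := @esum_ge_seq R S setT (fun y => (p t x y)%:E) [:: y] isT.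
by rewrite big_seq1; apply.
Qed.

Lemma tf_sum_le1 t x (s : seq S) : 0 <= t -> uniq s -> \sum_(y <- s) p t x y <= 1.
Proof.
move=> t0 us; rewrite -lee_fin -(tf_sum1 pP x t0) -sumEFin.
exact: esum_ge_seq.
Qed.

Lemma tf_semigroup_ge s t x z (l : seq S) : 0 <= s -> 0 <= t -> uniq l ->
  \sum_(y <- l) p s x y * p t y z <= p (s + t) x z.
Proof.
move=> s0 t0 ul; rewrite -lee_fin (tf_semigroup pP)// -sumEFin.
exact: esum_ge_seq.
Qed.

Local Notation exit_rate x := (\esum_(y in [set y | y != x]) (q x y)%:E).

Lemma tf_rate_ge0 x y : x != y -> 0 <= q x y.
Proof.
move=> xy; have := tf_rate pP xy => /cvgr_to_ge; apply.
near=> h; have h0 : 0 < h by near: h; exact: nbhs_right_gt.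
by rewrite divr_ge0 ?(tf_ge0 pP)// ltW.
Unshelve. all: by end_near.
Qed.

Let cvg_subdivision (f : R -> R) (l t : R) : 0 < t -> f h @[h --> 0^'+] --> l ->
  f (t / n.+1%:R) @[n --> \oo] --> l.
Proof.
move=> t0 /cvg_at_rightP; apply; split => [n|]; first by rewrite divr_gt0.
by rewrite -[X in _ --> X](mulr0 t); apply: cvgM; [exact: cvg_cst|exact: cvg_harmonic].
Qed.

(* [t |-> 1 - p t x x] is subadditive, hence bounded by [t] times its right
   derivative at [0]. *)
Lemma tf_stay (C t : R) x : (exit_rate x <= C%:E)%E -> 0 <= t ->
  1 - C * t <= p t x x.
Proof.
move=> xC; rewrite le_eqVlt => /orP[/eqP<-|t0].
  by rewrite (tf_start pP) eqxx mulr0 subr0.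
have er0 : (0 <= exit_rate x)%E.
  by apply: esum_ge0 => y /= yx; rewrite lee_fin tf_rate_ge0// eq_sym.
have erf : exit_rate x \is a fin_num.
  by rewrite ge0_fin_numE//; apply: le_lt_trans xC _; rewrite ltry.
pose r := fine (exit_rate x).
have rC : r <= C by rewrite -lee_fin fineK.
have cvgr : (1 - p h x x) / h @[h --> 0^'+] --> r.
  have := tf_exit_rate pP (x := x); rewrite -[exit_rate x]fineK//.
  by move/fine_cvgP => [].
pose u n := t / n.+1%:R.
have ut n : n.+1%:R * u n = t by rewrite /u mulrC mulfVK// pnatr_eq0.
have u0 n : 0 < u n by rewrite /u divr_gt0.
have cvgu := cvg_subdivision t0 cvgr.
have sub n d : 0 <= d -> 1 - p (n%:R * d) x x <= n%:R * (1 - p d x x).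
  move=> d0; elim: n => [|n IHn]; first by rewrite !mul0r (tf_start pP) eqxx subrr.
  rewrite -natr1 !mulrDl !mul1r.
  have nd0 : 0 <= n%:R * d by rewrite mulr_ge0.
  have := @tf_semigroup_ge _ _ x x [:: x] nd0 d0 isT.
  rewrite big_seq1.
  have := mulr_ge0 (_ : 0 <= 1 - p (n%:R * d) x x) (_ : 0 <= 1 - p d x x).
  rewrite !subr_ge0 !tf_le1// => /(_ isT isT).
  move: IHn; set a := p (_ * _) x x; set b := p d x x.
  set c := p _ x x; set e := n%:R * (1 - b); lra.
have : (1 - p t x x) / t <= r.
  apply: (cvgr_to_ge cvgu); near=> n.
  have -> : (1 - p (t / n.+1%:R) x x) / (t / n.+1%:R) =
      n.+1%:R * (1 - p (u n) x x) / t.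
    by rewrite invf_div mulrA [_ * n.+1%:R]mulrC.
  rewrite ler_pM2r ?invr_gt0//.
  by have := sub n.+1 (u n) (ltW (u0 n)); rewrite ut.
rewrite ler_pdivrMr// => /le_trans/(_ (ler_wpM2r (ltW t0) rC)).
by lra.
Unshelve. all: by end_near.
Qed.

(** The limit in [tf_rate] carries no uniformity in the states. Cut the time [t] into small pieces
    and keep the paths seen first at [x] and then at [y]: in the limit each piece contributes
    [q x y] times its length, with a loss of at most [q x y * C * t ^+ 2 + C ^+ 2 * t ^+ 2]. The
    final constant comes from [q x y <= C]. *)
Lemma tf_jump_ge (C t : R) x y : x != y -> (exit_rate x <= C%:E)%E ->
  (exit_rate y <= C%:E)%E -> 0 <= t ->
  q x y * t - 2 * C ^+ 2 * t ^+ 2 <= p t x y.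
Proof.
move=> xy xC yC; rewrite le_eqVlt => /orP[/eqP<-|t0].
  by rewrite (tf_start pP) (negPf xy) expr0n mulr0 !mulr0 subrr.
have qC : q x y <= C.
  rewrite -lee_fin; apply: le_trans xC.
  have := @esum_ge_seq R S [set z | z != x] (fun z => (q x z)%:E) [:: y] isT.
  by rewrite big_seq1; apply => z /=; rewrite inE => /eqP->; rewrite eq_sym.
have q0 := tf_rate_ge0 xy.
have C0 : 0 <= C by exact: le_trans qC.
pose u n := t / n.+1%:R.
have ut n : n.+1%:R * u n = t by rewrite /u mulrC mulfVK// pnatr_eq0.
have u0 n : 0 < u n by rewrite /u divr_gt0.
have cvgu := cvg_subdivision t0 (tf_rate pP xy).
have sub n d : 0 < d -> n%:R * d <= t ->
    n%:R * (p d x y * (1 - C * t) - C * d * (C * t)) <= p (n%:R * d) x y.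
  move=> d0; elim: n => [|n IHn] ndt.
    by rewrite !mul0r (tf_start pP) (negPf xy).
  have nd0 : 0 <= n%:R * d by rewrite mulr_ge0// ltW.
  move: ndt; rewrite -natr1 !mulrDl !mul1r => ndt.
  have {}IHn := IHn (le_trans (ler_wpDr (ltW d0) (lexx _)) ndt).
  have uxy : uniq [:: x; y] by rewrite /= inE xy.
  have := @tf_semigroup_ge _ _ x y [:: x; y] nd0 (ltW d0) uxy.
  rewrite big_cons big_seq1.
  have axx := tf_stay xC nd0; have ayy := tf_stay yC (ltW d0).
  have ndt' : n%:R * d <= t by rewrite (le_trans _ ndt)// ler_wpDr// ltW.
  have axy : p (n%:R * d) x y <= C * t.
    have := @tf_sum_le1 _ x [:: x; y] nd0 uxy; rewrite big_cons big_seq1.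
    by have := ler_wpM2l C0 ndt'; move: axx; lra.
  have h1 : (1 - C * t) * p d x y <= p (n%:R * d) x x * p d x y.
    apply: ler_wpM2r; first exact: (tf_ge0 pP _ _ (ltW d0)).
    by have := ler_wpM2l C0 ndt'; move: axx; lra.
  have h2 : p (n%:R * d) x y * (1 - C * d) <= p (n%:R * d) x y * p d y y.
    by apply: ler_wpM2l => //; exact: (tf_ge0 pP).
  have h3 : C * d * p (n%:R * d) x y <= C * d * (C * t).
    by apply: ler_wpM2l => //; rewrite mulr_ge0// ltW.
  by move: IHn h1 h2 h3; lra.
have lim : q x y * (1 - C * t) * t - C ^+ 2 * t ^+ 2 <= p t x y.
  apply: (@cvgr_to_le _ \oo _ _ (fun n => p (u n) x y / u n * (1 - C * t) * t
      - C ^+ 2 * t ^+ 2)).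
    apply: cvgB; last exact: cvg_cst.
    by apply: cvgM; [apply: cvgM; [exact: cvgu|exact: cvg_cst]|exact: cvg_cst].
  near=> n; have := sub n.+1 (u n) (u0 n); rewrite ut lexx => /(_ isT).
  apply: le_trans; rewrite le_eqVlt; apply/orP; left; apply/eqP.
  have un0 := lt0r_neq0 (u0 n).
  have -> : n.+1%:R = t / u n by rewrite -(ut n) mulfK.
  by field.
apply: le_trans lim.
have : 0 <= (C - q x y) * C * t ^+ 2.
  by apply: mulr_ge0; [apply: mulr_ge0; rewrite ?subr_ge0|exact: sqr_ge0].
by rewrite expr2; lra.
Unshelve. all: by end_near.
Qed.

(** Only lower bounds on [p] are available, from [tf_stay] and [tf_jump_ge]; they give the lower
    estimate. Since the total mass is 1 and the main term is affine in [g], the lower estimate for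
    [1 - g] is the upper one for [g]. *)
Lemma tf_one_step (C h : R) x (out : seq S) (g : S -> R) :
  uniq (x :: out) -> (forall y, y != x -> y \notin out -> q x y = 0) ->
  (forall y, (exit_rate y <= C%:E)%E) -> 0 <= h -> (forall y, 0 <= g y <= 1) ->
  exists2 r, \esum_(y in [set: S]) (p h x y * g y)%:E = r%:E &
  `|r - (g x + h * \sum_(y <- out) q x y * (g y - g x))| <=
    2 * (size out)%:R * C ^+ 2 * h ^+ 2.
Proof.
move=> uxo q0 exC h0 g01.
have e_x : exit_rate x = (\sum_(y <- out) q x y)%:E.
  move: uxo => /= /andP[xo uo]; rewrite -sumEFin; apply: esum_supp_seq => //.
  - by move=> y /= yo; apply: contra xo => /eqP<-.
  - by move=> y /= yx; rewrite lee_fin tf_rate_ge0// eq_sym.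
  - by move=> y /= yx yo; rewrite q0.
pose M (g : S -> R) := g x + h * \sum_(y <- out) q x y * (g y - g x).
pose K := 2 * (size out)%:R * C ^+ 2 * h ^+ 2.
have lower (f : S -> R) : (forall y, 0 <= f y <= 1) ->
    ((M f - K)%:E <= \esum_(y in [set: S]) (p h x y * f y)%:E)%E.
  move=> f01.
  apply: le_trans (@esum_ge_seq _ _ setT (fun y => (p h x y * f y)%:E) _ uxo _) => //.
  rewrite sumEFin lee_fin big_cons.
  have stay : (1 - (\sum_(y <- out) q x y) * h) * f x <= p h x x * f x.
    have /andP[f0 _] := f01 x.
    by apply: ler_wpM2r => //; apply: tf_stay => //; rewrite e_x.
  have jump : \sum_(y <- out) (q x y * h * f y - 2 * C ^+ 2 * h ^+ 2) <=
      \sum_(y <- out) p h x y * f y.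
    rewrite big_seq [leRHS]big_seq; apply: ler_sum => y yo.
    have xy : x != y.
      by move: uxo => /= /andP[xo _]; apply: contraNneq xo => ->.
    have /andP[f0 f1] := f01 y.
    apply: le_trans (ler_wpM2r f0 (tf_jump_ge xy (exC x) (exC y) h0)).
    have : 2 * C ^+ 2 * h ^+ 2 * f y <= 2 * C ^+ 2 * h ^+ 2.
      rewrite ler_piMr//; apply: mulr_ge0; last exact: sqr_ge0.
      by apply: mulr_ge0 => //; exact: sqr_ge0.
    by lra.
  apply: le_trans (lerD stay jump).
  rewrite le_eqVlt; apply/orP; left; apply/eqP.
  have -> : \sum_(y <- out) (q x y * h * f y - 2 * C ^+ 2 * h ^+ 2) =
      h * (\sum_(y <- out) q x y * f y) - (size out)%:R * (2 * C ^+ 2 * h ^+ 2).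
    rewrite sumrB big_const_seq count_predT iter_addr_0 -[_ *+ size out]mulr_natl; congr (_ - _).
    by rewrite mulr_sumr; apply: eq_bigr => y _; ring.
  have E : \sum_(y <- out) q x y * (f y - f x) =
      (\sum_(y <- out) q x y * f y) - (\sum_(y <- out) q x y) * f x.
    by rewrite mulr_suml -sumrB; apply: eq_bigr => y _; ring.
  rewrite /M /K E.
  by ring.
have e0 (f : S -> R) : (forall y, 0 <= f y <= 1) -> forall y : S, setT y ->
    (0 <= (p h x y * f y)%:E)%E.
  by move=> f01 y _; have /andP[f0 _] := f01 y; rewrite lee_fin mulr_ge0// (tf_ge0 pP).
have g'01 y : 0 <= 1 - g y <= 1.
  by have /andP[f0 f1] := g01 y; rewrite subr_ge0 f1 lerBlDr lerDl.
have split1 : ((\esum_(y in [set: S]) (p h x y * g y)%:E) +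
    (\esum_(y in [set: S]) (p h x y * (1 - g y))%:E) = 1)%E.
  rewrite -esumD; [|exact: e0|exact: e0].
  rewrite -(tf_sum1 pP x h0); apply: eq_esum => y _.
  by rewrite -EFinD -mulrDr addrC subrK mulr1.
have l1 := lower _ g01; have l2 := lower _ g'01.
have f1 := esum_ge0 (e0 _ g01); have f2 := esum_ge0 (e0 _ g'01).
move: split1 l1 l2 f1 f2.
set A := esum _ _; set B := esum _ _.
case: A B => [a| |] [b| |]//= [ab1] l1 l2 _ _; exists a => //.
rewrite lee_fin in l1; rewrite lee_fin in l2.
have MM : M (fun y => 1 - g y) = 1 - M g.
  rewrite /M [in RHS]opprD addrA -[in RHS]mulrN -sumrN; congr (_ + h * _).
  by apply: eq_bigr => y _; ring.
rewrite -/(M g) -/K ler_norml; rewrite MM in l2.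
by move: l1 l2 ab1; lra.
Qed.

End TransitionFunction.

(** * Generator of the queue and the approximate one-step martingale *)

Section QueueRates.
Context {R : realType}.
Variable k : nat.
Hypothesis k_gt0 : (0 < k)%N.
Notation idle := ((0, 0)%N : nat * nat).
Definition arrival_target (x : nat * nat) : nat * nat :=
  if x == idle then (1, k)%N else (x.1.+1, x.2).

(** From [(1, 1)] the system empties. The value at the idle state is a default, discarded by the
    condition [x != idle] in [completionE]. *)
Definition completion_target (x : nat * nat) : nat * nat :=
  if (2 <= x.2)%N then (x.1, x.2.-1) else if (2 <= x.1)%N then (x.1.-1, k) else idle.

Lemma arrivalE x y : state_phase k x -> arrival k x y = (y == arrival_target x).
Proof.
case: x y => [n s] [n' s']; rewrite /state_phase /arrival /arrival_target /=.
by rewrite !xpair_eqE; case: ifP; rewrite /= xpair_eqE; lia.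
Qed.

Lemma completionE x y : state_phase k x ->
  phase_completion k x y = (x != idle) && (y == completion_target x).
Proof.
case: x y => [n s] [n' s']; rewrite /state_phase /phase_completion /completion_target /=.
by rewrite !xpair_eqE; case: ifP => /=; [|case: ifP => /=]; rewrite ?xpair_eqE; lia.
Qed.

Lemma state_phase_arrival_target x : state_phase k x -> state_phase k (arrival_target x).
Proof.
case: x => [n s]; rewrite /state_phase /arrival_target /=.
by rewrite !xpair_eqE; case: ifP => /=; rewrite ?xpair_eqE; lia.
Qed.

Lemma state_phase_completion_target x :
  state_phase k x -> state_phase k (completion_target x).
Proof.
case: x => [n s]; rewrite /state_phase /completion_target /=.
by rewrite !xpair_eqE; case: ifP => /=; [|case: ifP => /=]; rewrite ?xpair_eqE; lia.
Qed.

Definition next_arrival (x : queue_state k) : queue_state k :=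
  exist _ (arrival_target (val x)) (state_phase_arrival_target (valP x)).

Definition next_completion (x : queue_state k) : queue_state k :=
  exist _ (completion_target (val x)) (state_phase_completion_target (valP x)).

Lemma arrival_next x y : arrival k (val x) (val y) = (y == next_arrival x).
Proof. by rewrite arrivalE ?(valP x)// -val_eqE. Qed.

Lemma completion_next x y : phase_completion k (val x) (val y) =
  (val x != idle) && (y == next_completion x).
Proof. by rewrite completionE ?(valP x)// -val_eqE. Qed.

Definition neighbours (x : queue_state k) : seq (queue_state k) :=
  if val x == idle then [:: next_arrival x] else [:: next_arrival x; next_completion x].

Lemma neighbours_uniq x : uniq (x :: neighbours x).
Proof.
have xa : next_arrival x != x.
  by have := arrival_next x (next_arrival x); rewrite eqxx => /arrival_neq.
rewrite /neighbours; case: ifPn => [_|x0]; rewrite /= !inE !(eq_sym x) (negPf xa)//=.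
have cx : phase_completion k (val x) (val (next_completion x)).
  by rewrite completion_next x0 eqxx.
rewrite -val_eqE (negPf (phase_completion_neq cx))/= andbT.
apply/eqP => ac; have := arrival_next x (next_arrival x).
by rewrite {1}ac eqxx => /(arrival_notin_completion (valP x)); rewrite cx.
Qed.

Lemma next_completion_neq_arrival x : val x != idle ->
  (next_completion x == next_arrival x) = false.
Proof.
move=> x0; have := neighbours_uniq x; rewrite /neighbours (negPf x0) /= !inE.
by move=> /andP[_ /andP[/negPf + _]]; rewrite eq_sym.
Qed.

Lemma neighboursP x y : y \in neighbours x =
  arrival k (val x) (val y) || phase_completion k (val x) (val y).
Proof.
rewrite arrival_next completion_next /neighbours.
by case: ifPn => _; rewrite !inE ?orbF.
Qed.

Variables lam mu : R.
Hypotheses (lam_gt0 : 0 < lam) (mu_gt0 : 0 < mu).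
Notation theta := (k%:R * mu).

Lemma queue_rate_arrival x : queue_rate lam mu x (next_arrival x) = lam.
Proof. by rewrite /queue_rate arrival_next eqxx. Qed.

Lemma queue_rate_completion x : val x != idle ->
  queue_rate lam mu x (next_completion x) = theta.
Proof.
by move=> x0; rewrite /queue_rate arrival_next next_completion_neq_arrival//
  completion_next x0 eqxx.
Qed.

Lemma queue_rate0 x y : y \notin neighbours x -> queue_rate lam mu x y = 0.
Proof. by rewrite neighboursP negb_or /queue_rate => /andP[/negPf-> /negPf->]. Qed.

Lemma theta_gt0 : 0 < theta. Proof. by rewrite mulr_gt0// ltr0n. Qed.

Lemma queue_rate_ge0 (x y : queue_state k) : 0 <= queue_rate lam mu x y.
Proof.
rewrite /queue_rate; case: ifP => _; first exact: ltW.
by case: ifP => // _; exact/ltW/theta_gt0.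
Qed.

(** A bound independent of the state is what makes all the later error terms uniform. *)
Lemma queue_exit_rate (x : queue_state k) :
  (\esum_(y in [set y | y != x]) (queue_rate lam mu x y)%:E <= (lam + theta)%:E)%E.
Proof.
rewrite (@esum_supp_seq _ _ _ _ (neighbours x)).
- rewrite sumEFin lee_fin /neighbours; case: ifPn => x0.
    by rewrite big_seq1 queue_rate_arrival lerDl ltW// theta_gt0.
  by rewrite big_cons big_seq1 queue_rate_arrival queue_rate_completion.
- by have := neighbours_uniq x => /= /andP[].
- move=> y /= yx; have := neighbours_uniq x => /= /andP[+ _].
  by apply: contraNneq => yE; rewrite -{1}yE.
- by move=> y _; rewrite lee_fin queue_rate_ge0.
- by move=> y _ /queue_rate0->.
Qed.

Variable p : R -> queue_state k -> queue_state k -> R.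
Hypothesis pP : transition_function (@queue_rate k R lam mu) p.

Definition queue_generator (g : queue_state k -> R) x : R :=
  lam * (g (next_arrival x) - g x) +
  if val x == idle then 0 else theta * (g (next_completion x) - g x).

Lemma queue_one_step (h : R) x (g : queue_state k -> R) : 0 <= h ->
  (forall y, 0 <= g y <= 1) ->
  exists2 r, \esum_(y in [set: queue_state k]) (p h x y * g y)%:E = r%:E &
  `|r - (g x + h * queue_generator g x)| <= 4 * (lam + theta) ^+ 2 * h ^+ 2.
Proof.
move=> h0 g01.
have [|r rE] := tf_one_step pP (neighbours_uniq x) _ queue_exit_rate h0 g01.
  by move=> y _ /queue_rate0.
move=> rM; exists r => //; apply: le_trans (le_trans _ rM) _; last first.
  (* A state has at most two neighbours. *)
  have -> : 4 = 2 * 2%:R :> R by rewrite -natrM.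
  apply: ler_wpM2r; first exact: sqr_ge0.
  apply: ler_wpM2r; first exact: sqr_ge0.
  by rewrite ler_pM2l// ler_nat /neighbours; case: ifP.
rewrite le_eqVlt; apply/orP; left; apply/eqP; congr (`|_ - (_ + _ * _)|).
rewrite /queue_generator /neighbours; case: ifPn => x0.
  by rewrite big_seq1 queue_rate_arrival addr0.
by rewrite big_cons big_seq1 queue_rate_arrival queue_rate_completion.
Qed.

Section Weights.
Variables (U : nat -> R) (B : R) (m : nat).
Hypothesis U_ge0 : forall r, 0 <= U r.
Hypothesis U_le : forall r, U r <= B.
Hypothesis U_supp : forall r, (m <= r)%N -> U r = 0.

(** The expected contribution of the phases from [j] on, where [U r] stands for [v r] to the power
    [nu]; phases from [m] on are not charged. *)
Definition phase_laplace (j : nat) : R := \prod_(j <= r < m) (theta / (theta + U r)).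

(** With the flag read as 0 or 1, [a.1 - a.2] is the number of completed phases. *)
Definition service_weight (a : nat * bool) : R := phase_laplace (a.1 - a.2).

Definition service_cost (u : nat -> R) (a : nat * bool) : R := if a.2 then u a.1.-1 else 0.

(** This is the balance between the gain [theta * (phase_laplace j.+1 - phase_laplace j)] at a
    completion and the charge [U j * phase_laplace j] during the phase. It persists for [m <= j],
    where the charge is 0 and both products are empty. *)
Lemma phase_laplaceS j :
  (theta + U j) * phase_laplace j = theta * phase_laplace j.+1.
Proof.
have t0 := theta_gt0; have Uj := U_ge0 j.
have tU : theta + U j != 0 by rewrite lt0r_neq0// ltr_pwDl.
rewrite /phase_laplace; have [jm|mj] := ltnP j m.
  by rewrite (big_ltn jm) mulrA mulrCA divff// mulr1.
by rewrite !big_geq ?leqW// U_supp// addr0.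
Qed.

Lemma phase_laplace01 j : 0 <= phase_laplace j <= 1.
Proof.
have t0 := theta_gt0; apply: (big_ind (fun z => 0 <= z <= 1)).
- by rewrite ler01 lexx.
- by move=> a b /andP[a0 a1] /andP[b0 b1]; rewrite mulr_ge0//= mulr_ile1.
- move=> r _; have Ur := U_ge0 r.
  have tU : 0 < theta + U r by rewrite ltr_pwDl.
  apply/andP; split; first by rewrite divr_ge0// ltW.
  by rewrite ler_pdivrMr// mul1r lerDl.
Qed.

(** For the upper bound, [expR z >= 1 + z] and [(1 + z) * (1 - z + z ^+ 2) = 1 + z ^+ 3 >= 1]. *)
Lemma expR_quadratic (z : R) : 0 <= z -> 1 - z <= expR (- z) <= 1 - z + z ^+ 2.
Proof.
move=> z0; rewrite expR_ge1Dx/= expRN.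
have z1 : 0 < 1 + z by rewrite ltr_pwDl.
apply: (@le_trans _ _ (1 + z)^-1); first by rewrite lef_pV2 ?posrE ?expR_gt0// expR_ge1Dx.
rewrite -(ler_pM2l z1) divff ?lt0r_neq0//.
have : 0 <= z ^+ 3 by rewrite exprn_ge0.
by rewrite !exprS expr0; lra.
Qed.

(** The exponential is the mean of the factor charged on the increment of [sigma] over the cell. The
    charge is read off after the transition, in agreement with [phase_increment]. *)
Definition next_value (h : R) (y : nat -> queue_state k) i (z : queue_state k) : R :=
  let a := service_update k (service_state k (val \o y) i) (val (y i)) (val z) in
  expR (- (h * service_cost U a)) * service_weight a.

Lemma next_value01 h y i z : 0 <= h -> 0 <= next_value h y i z <= 1.
Proof.
move=> h0; rewrite /next_value; set a := service_update _ _ _ _.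
have /andP[w0 w1] : 0 <= service_weight a <= 1 by exact: phase_laplace01.
have e1 : expR (- (h * service_cost U a)) <= 1.
  by rewrite expR_le1 oppr_le0 mulr_ge0// /service_cost; case: ifP.
by rewrite mulr_ge0 ?expR_ge0//= mulr_ile1// expR_ge0.
Qed.

(* [phase_laplace] is chosen so that the generator, applied to the weighted
   functional, vanishes to first order. *)
Lemma service_martingale (h : R) y i : 0 <= h ->
  exists2 r, \esum_(z in [set: queue_state k]) (p h (y i) z * next_value h y i z)%:E = r%:E &
  `|r - service_weight (service_state k (val \o y) i)| <=
    (4 * (lam + theta) ^+ 2 + B ^+ 2 + (lam + theta) * B) * h ^+ 2.
Proof.
move=> h0; have t0 := theta_gt0.
have [r rE rM] := queue_one_step (y i) h0 (fun z => next_value01 y i z h0).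
exists r => //.
set a := service_state k (val \o y) i.
suff : `|next_value h y i (y i) + h * queue_generator (next_value h y i) (y i) -
    service_weight a| <= (B ^+ 2 + (lam + theta) * B) * h ^+ 2.
  move: rM; rewrite !ler_norml.
  by move=> /andP[r1 r2] /andP[r3 r4]; apply/andP; split; lra.
have ebnd u : 0 <= u <= B -> 0 <= 1 - expR (- (h * u)) <= h * B.
  move=> /andP[u0 uB]; have hu : 0 <= h * u by rewrite mulr_ge0.
  rewrite subr_ge0 expR_le1 oppr_le0 hu /=.
  have /andP[e1 _] := expR_quadratic hu.
  by have := ler_wpM2l h0 uB; lra.
have UB r' : 0 <= U r' <= B by rewrite U_ge0 U_le.
have B0 : 0 <= B by exact: le_trans (U_ge0 0%N) (U_le 0%N).
have same : next_value h y i (y i) = expR (- (h * service_cost U a)) * service_weight a.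
  by rewrite /next_value service_update_id.
have afalse : val (y i) == idle -> a.2 = false.
  move=> yi; apply/negbTE/negP => /service_state_busy.
  by rewrite /= yi.
rewrite /queue_generator same.
have start z : phase_start k (val (y i)) (val z) ->
    next_value h y i z = expR (- (h * U a.1)) * phase_laplace (a.1.+1 - 1).
  by move=> sz; rewrite /next_value /service_update sz.
(* From the idle state an arrival begins a phase but completes none: the weight is unchanged, and
   charging the cell costs at most [h * B] with probability of order [h]. *)
have [x0|x0] := boolP (val (y i) == idle).
  have -> : next_value h y i (next_arrival (y i)) =
      expR (- (h * U a.1)) * phase_laplace a.1.
    rewrite start ?subn1// /phase_start arrival_next eqxx x0 orbT//.
  rewrite /service_cost /service_weight afalse//= mulr0 oppr0 expR0 subn0 mul1r addr0.
  have /andP[e0 e1] := ebnd _ (UB a.1).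
  have /andP[V0 V1] := phase_laplace01 a.1.
  rewrite addrAC subrr add0r normrM (ger0_norm h0) normrM (gtr0_norm lam_gt0).
  rewrite -{2}[phase_laplace a.1]mul1r -mulrBl normrM distrC (ger0_norm e0) (ger0_norm V0).
  apply: (@le_trans _ _ (h * (lam * (h * B * 1)))).
    by rewrite ler_wpM2l// ler_pM2l// ler_pM.
  have : 0 <= (B ^+ 2 + theta * B) * h ^+ 2.
    by rewrite mulr_ge0 ?sqr_ge0// addr_ge0 ?sqr_ge0// mulr_ge0// ltW.
  by rewrite !expr2; lra.
have na : next_value h y i (next_arrival (y i)) =
    expR (- (h * service_cost U a)) * service_weight a.
  have ar : arrival k (val (y i)) (val (next_arrival (y i))) by rewrite arrival_next.
  rewrite /next_value /service_update ifF.
    by rewrite (arrivalN0 ar) andbT -/a -surjective_pairing.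
  apply/negbTE/negP => /(phase_start_busy x0).
  by rewrite (arrival_notin_completion (valP _) ar).
have cz : phase_completion k (val (y i)) (val (next_completion (y i))).
  by rewrite completion_next x0 eqxx.
(* After a completion the cell is charged for the next phase if one begins and is free otherwise; in
   both cases the factor is within [h * B] of 1. *)
have [u /andP[u0 uB] nc] : exists2 u, 0 <= u <= B &
    next_value h y i (next_completion (y i)) = expR (- (h * u)) * phase_laplace a.1.
  have [sz|sz] := boolP (phase_start k (val (y i)) (val (next_completion (y i)))).
    by exists (U a.1) => //; rewrite start// subn1.
  exists 0; first by rewrite lexx.
  rewrite /next_value /service_update (negPf sz) (phase_completion_idle cz sz) eqxx.
  by rewrite andbF /service_cost /service_weight /= subn0.
rewrite na nc subrr mulr0 add0r.
have /andP[e0 e1] := ebnd u (introT andP (conj u0 uB)).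
have /andP[V0 V1] := phase_laplace01 a.1.
rewrite /service_cost /service_weight.
have [a2|a2] := boolP a.2; last first.
  rewrite mulr0 oppr0 expR0 mul1r subn0 addrAC subrr add0r.
  rewrite normrM (ger0_norm h0) normrM (gtr0_norm t0).
  rewrite -{2}[phase_laplace a.1]mul1r -mulrBl normrM distrC (ger0_norm e0) (ger0_norm V0).
  apply: (@le_trans _ _ (h * (theta * (h * B * 1)))).
    by rewrite ler_wpM2l// ler_pM2l// ler_pM.
  have : 0 <= (B ^+ 2 + lam * B) * h ^+ 2.
    by rewrite mulr_ge0 ?sqr_ge0// addr_ge0 ?sqr_ge0// mulr_ge0// ltW.
  by rewrite !expr2; lra.
have a1 : (0 < a.1)%N := service_state_pos a2.
rewrite subn1; set j := a.1.-1.
have jE : a.1 = j.+1 by rewrite /j prednK.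
have := phase_laplaceS j; rewrite -jE.
have /andP[W0 W1] := phase_laplace01 j.
have hU : 0 <= h * U j by rewrite mulr_ge0.
have /andP[q1 q2] := expR_quadratic hU.
have /andP[e0' e1'] := ebnd _ (UB j).
move: e0 e1 e0' e1' q1 q2 V0 V1 W0 W1.
move: (expR (- (h * u))) (expR (- (h * U j))) (phase_laplace a.1) (phase_laplace j) => eu eU Vn Vj.
move=> e0 e1 e0' e1' q1 q2 V0 V1 W0 W1 VS.
(* By [phase_laplaceS] the terms of first order cancel. There remain the quadratic error of the
   exponential and [h * theta] times a difference of two numbers between 0 and [h * B]. *)
have -> : eU * Vj + h * (theta * (eu * Vn - eU * Vj)) - Vj =
    Vj * (eU - (1 - h * U j)) + h * theta * ((1 - eU) * Vj - (1 - eu) * Vn).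
  have -> : theta * (eu * Vn - eU * Vj) = theta * Vn - theta * Vj +
     theta * ((1 - eU) * Vj - (1 - eu) * Vn) by ring.
  rewrite -VS; ring.
apply: le_trans (ler_normD _ _) _.
have b1 : `|Vj * (eU - (1 - h * U j))| <= B ^+ 2 * h ^+ 2.
  rewrite normrM (ger0_norm W0) ger0_norm ?subr_ge0//.
  have z2 : (h * U j) ^+ 2 <= B ^+ 2 * h ^+ 2.
    by rewrite -exprMn mulrC ler_pXn2r ?nnegrE ?mulr_ge0// ler_wpM2r.
  rewrite -[leRHS]mul1r ler_pM ?subr_ge0//.
  by apply: le_trans z2; lra.
have b2 : `|h * theta * ((1 - eU) * Vj - (1 - eu) * Vn)| <= theta * B * h ^+ 2.
  have -> : theta * B * h ^+ 2 = h * theta * (h * B) by rewrite expr2; ring.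
  have ht : 0 <= h * theta by rewrite mulr_ge0// ltW.
  rewrite normrM (ger0_norm ht) ler_wpM2l// ler_norml.
  have p1 : (1 - eU) * Vj <= h * B * 1 by rewrite ler_pM.
  have p2 : (1 - eu) * Vn <= h * B * 1 by rewrite ler_pM.
  have p3 : 0 <= (1 - eU) * Vj by rewrite mulr_ge0.
  have p4 : 0 <= (1 - eu) * Vn by rewrite mulr_ge0.
  by apply/andP; split; lra.
have : 0 <= lam * B * h ^+ 2 by rewrite !mulr_ge0// ?ltW// sqr_ge0.
by move: b1 b2; rewrite !expr2; lra.
Qed.

End Weights.
End QueueRates.

(** * Integration of independent factors *)

Import HBNNSimple.

Section Lifting.
Context {R : realType} {d : measure_display} {T : measurableType d}.
Variable P : probability T R.
Local Open Scope ereal_scope.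

Section MulComp.
Variables (W X : T -> R).
Hypotheses (mW : measurable_fun setT W) (mX : measurable_fun setT X).
Hypothesis W_ge0 : forall w, (0 <= W w)%R.

Let mWE : measurable_fun setT (EFin \o W).
Proof. exact/measurable_EFinP. Qed.

Lemma measurable_preimageT (B : set R) : measurable B -> measurable (X @^-1` B).
Proof. by move=> mB; rewrite -[_ @^-1` _]setTI; exact: mX. Qed.

Lemma integral_mul_indic (B : set R) : measurable B ->
  \int[P]_w ((W w)%:E * (\1_B (X w))%:E) = \int[P]_(w in X @^-1` B) (W w)%:E.
Proof.
move=> mB; rewrite [RHS]integral_mkcond; apply: eq_integral => w _.
rewrite patchE indicE; have [XB|XB] := boolP (w \in X @^-1` B).
  by have : X w \in B by []; move=> ->; rewrite mule1.
by have /negPf-> : X w \notin B by []; rewrite mule0.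
Qed.

Lemma integral_mul_nnsfun (h : {nnsfun R >-> R}) :
  \int[P]_w ((W w)%:E * (h (X w))%:E) =
  \sum_(y \in range h) (y%:E * \int[P]_(w in X @^-1` (h @^-1` [set y])) (W w)%:E).
Proof.
have mh y : measurable (h @^-1` [set y]) by exact: measurable_sfunP.
have m1 y : measurable_fun setT (fun w => (\1_(h @^-1` [set y]) (X w))%:E).
  apply/measurable_EFinP; apply: measurableT_comp (measurable_indic (mh y)) mX.
transitivity (\int[P]_w (\sum_(y \in range h)
    ((W w)%:E * (y * \1_(h @^-1` [set y]) (X w))%:E))).
  apply: eq_integral => w _; rewrite fimfunE -fsumEFin; last exact: fimfunP.
  by rewrite ge0_mule_fsumr// => y; exact: nnfun_muleindic_ge0.
rewrite ge0_integral_fsum//; last 2 first.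
- move=> y; apply: emeasurable_funM => //.
  under eq_fun do rewrite EFinM; apply: emeasurable_funM => //; exact: measurable_cst.
- by move=> y w _; rewrite mule_ge0 ?lee_fin//; exact: nnfun_muleindic_ge0.
apply: eq_fsbigr => y _; have [y0|y0] := leP 0%R y; last first.
  have h0 : h @^-1` [set y] = set0.
    apply/seteqP; split => // z /= hz; move: y0; rewrite -hz ltNge.
    by rewrite fun_ge0.
  rewrite h0 preimage_set0 integral_set0 mule0 integral0_eq// => w _.
  by rewrite indicE in_set0 mulr0 mule0.
rewrite -integral_mul_indic// -ge0_integralZl//.
- by apply: eq_integral => w _; rewrite EFinM muleCA.
- by apply: emeasurable_funM.
- by move=> w _; rewrite mule_ge0// lee_fin.
Qed.

Lemma integral_mul_comp_cvg (g : R -> R) (mg : measurable_fun setT g) :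
  (forall x, (0 <= g x)%R) ->
  \int[P]_w ((W w)%:E * (nnsfun_approx measurableT ((measurable_EFinP _ _).2 mg) n (X w))%:E)
    @[n --> \oo] --> \int[P]_w ((W w)%:E * (g (X w))%:E).
Proof.
move=> g0; set h := nnsfun_approx _ _.
have -> : (fun w => (W w)%:E * (g (X w))%:E) =
    (fun w => limn (fun n => (W w)%:E * (h n (X w))%:E)).
  apply/funext => w; apply/esym/cvg_lim => //; apply: cvgeM.
  - by rewrite mule_def_fin.
  - exact: cvg_cst.
  - by apply: cvg_nnsfun_approx => // x _; rewrite lee_fin.
apply: cvg_monotone_convergence => //.
- move=> n; apply: emeasurable_funM => //; apply/measurable_EFinP.
  exact: measurableT_comp.
- by move=> n w _; rewrite mule_ge0// lee_fin.
- move=> w _ m n mn; apply: lee_pmul => //; rewrite ?lee_fin//.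
  exact/lefP/nd_nnsfun_approx.
Qed.

End MulComp.

(** The hypothesis states the factorization for indicators of [X]; simple functions and monotone
    convergence extend it to [g]. *)
Lemma integral_mul_comp (W X : T -> R) (c : R) (g : R -> R) :
  measurable_fun setT W -> measurable_fun setT X -> (forall w, 0 <= W w)%R ->
  (forall B, measurable B ->
    \int[P]_(w in X @^-1` B) (W w)%:E = c%:E * P (X @^-1` B)) ->
  measurable_fun setT g -> (forall x, 0 <= g x)%R ->
  \int[P]_w ((W w)%:E * (g (X w))%:E) = c%:E * \int[P]_w (g (X w))%:E.
Proof.
move=> mW mX W0 H mg g0.
have lim := integral_mul_comp_cvg mW mX W0 mg g0.
have m1 : measurable_fun [set: T] (fun=> 1%R : R) by exact: measurable_cst.
have lim1 := integral_mul_comp_cvg m1 mX (fun _ => ler01) mg g0.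
have -> : \int[P]_w (g (X w))%:E = \int[P]_w (1%:E * (g (X w))%:E).
  by apply: eq_integral => w _; rewrite mul1e.
apply: (cvg_unique _ lim) => //.
rewrite [X in X @ _](_ : _ = (fun n => c%:E * \int[P]_w (1%:E *
    (nnsfun_approx measurableT ((measurable_EFinP _ _).2 mg) n (X w))%:E))).
  by apply: cvgeZl.
apply/funext => n; rewrite !integral_mul_nnsfun//; set h := nnsfun_approx _ _ _.
rewrite ge0_mule_fsumr => [|y]; last first.
  have [y0|y0] := leP 0%R y; first by rewrite mule_ge0// integral_ge0.
  rewrite (_ : h @^-1` [set y] = set0) ?preimage_set0 ?integral_set0 ?mule0//.
  apply/seteqP; split => // z /= hz; move: y0; rewrite -hz ltNge.
  by rewrite fun_ge0.
apply: eq_fsbigr => y _; rewrite muleCA; congr (_ * _).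
by rewrite H// integral_cst ?mul1e//; exact: measurable_preimageT.
Qed.

(** The event [A] is kept arbitrary for the induction: the indicator of [A] times the first [n]
    factors is a weight for the last variable, and its integral over the event that [Y n] lies in
    [B] is the induction hypothesis for [A] intersected with that event. *)
Lemma integral_prod_indep (n : nat) (A : set T) (Y : nat -> T -> R)
    (f : nat -> R -> R) (e : nat -> R) : measurable A ->
  (forall i, measurable_fun setT (Y i)) -> (forall i, measurable_fun setT (f i)) ->
  (forall i x, 0 <= f i x)%R -> (forall i, \int[P]_w (f i (Y i w))%:E = (e i)%:E) ->
  (forall B : nat -> set R, (forall i, measurable (B i)) ->
    P (A `&` [set w | forall i, (i < n)%N -> B i (Y i w)]) =
    P A * \prod_(i < n) P (Y i @^-1` B i)) ->
  \int[P]_(w in A) (\prod_(i < n) f i (Y i w))%:E = P A * (\prod_(i < n) e i)%:E.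
Proof.
move=> + mY mf f0 fe; elim: n A => [|n IHn] A mA H.
  under eq_integral do rewrite big_ord0.
  by rewrite big_ord0 integral_cst// mul1e mule1.
have pfin B : measurable B -> P B \is a fin_num by move=> ?; exact: fin_num_measure.
have mYB i B : measurable B -> measurable (Y i @^-1` B).
  by move=> mB; exact: measurable_preimageT.
have PAn B : measurable B -> P (A `&` Y n @^-1` B) = P A * P (Y n @^-1` B).
  move=> mB; have := H (fun i => if i == n then B else setT).
  rewrite big_ord_recr /= eqxx big1 ?mul1e => [|i _]; last first.
    by rewrite (ltn_eqF (ltn_ord i)) preimage_setT probability_setT.
  move=> <- => [|i]; last by case: ifP.
  congr (P (A `&` _)); apply/seteqP; split => w /= Bw.
    by move=> i _; case: eqP => [->|].
  by have := Bw n (ltnSn n); rewrite eqxx.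
pose W w := (\1_A w * \prod_(i < n) f i (Y i w))%R.
have mprod : measurable_fun setT (fun w => \prod_(i < n) f i (Y i w))%R.
  by apply: measurable_prod => i _; exact: measurableT_comp.
have mW : measurable_fun setT W by apply: measurable_funM.
have prod0 w : (0 <= \prod_(i < n) f i (Y i w))%R by exact: prodr_ge0.
have W0 w : (0 <= W w)%R by rewrite mulr_ge0.
have WE B : measurable B -> \int[P]_(w in B) (W w)%:E =
    \int[P]_(w in A `&` B) (\prod_(i < n) f i (Y i w))%:E.
  move=> mB; rewrite setIC integral_mkcondr; apply: eq_integral => w _.
  by rewrite patchE /W indicE; case: ifPn; rewrite ?mul1r ?mul0r.
have HW B : measurable B -> \int[P]_(w in Y n @^-1` B) (W w)%:E =
    (fine (P A) * \prod_(i < n) e i)%:E * P (Y n @^-1` B).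
  move=> mB; rewrite WE; last exact: mYB.
  rewrite IHn; last 2 first.
  - by apply: measurableI => //; exact: mYB.
  - move=> C mC; have := H (fun i => if i == n then B else C i).
    rewrite big_ord_recr /= eqxx PAn// => H'.
    rewrite -muleA [P _ * \prod_(_ < _) _]muleC.
    rewrite (eq_bigr (fun i : 'I_n => P (Y i @^-1` (if i == n :> nat then B else C i)))).
      rewrite -H' => [|i]; last by case: ifP.
      congr (P _); apply/seteqP; split => w /=.
        move=> [[Aw Bw] Cw]; split => // i; rewrite ltnS leq_eqVlt.
        by case: eqP => [->//|_ /=]; exact: Cw.
      move=> [Aw Cw]; split; first by split => //; have := Cw n (ltnSn n); rewrite eqxx.
      by move=> i i_n; have := Cw i (ltnW i_n); rewrite (ltn_eqF i_n).
    by move=> i _; rewrite (ltn_eqF (ltn_ord i)).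
  by rewrite PAn// EFinM fineK ?pfin// muleAC.
have := integral_mul_comp mW (mY n) W0 HW (mf n) (f0 n).
rewrite fe => IW.
transitivity (\int[P]_w ((W w)%:E * (f n (Y n w))%:E)).
  rewrite integral_mkcond; apply: eq_integral => w _.
  rewrite patchE /W indicE big_ord_recr/=; case: ifPn => _.
    by rewrite mul1r EFinM.
  by rewrite mul0r mul0e.
by rewrite IW big_ord_recr/= !EFinM fineK ?pfin// muleA.
Qed.

Lemma integral_partition {S : countType} (X : T -> S) (D : set T) (f : T -> \bar R) :
  (forall s, measurable (X @^-1` [set s])) -> measurable D ->
  measurable_fun D f -> (forall w, D w -> 0 <= f w) ->
  \int[P]_(w in D) f w = \esum_(s in [set: S]) \int[P]_(w in D `&` X @^-1` [set s]) f w.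
Proof.
move=> mX mD mf f0.
(* The pieces are indexed by natural numbers through [pickle]; numbers that encode no state
   contribute the empty set. *)
pose F n := if @pickle_inv S n is Some s then D `&` X @^-1` [set s] else set0.
have FE s : F (pickle s) = D `&` X @^-1` [set s] by rewrite /F pickleK_inv.
have DF : D = \bigcup_n F n.
  apply/seteqP; split => w.
    by move=> Dw; exists (pickle (X w)) => //; rewrite FE.
  by move=> [n _]; rewrite /F; case: pickle_inv => // s [].
have mF n : measurable (F n).
  by rewrite /F; case: pickle_inv => // s; exact: measurableI.
have tF : trivIset setT F.
  apply/trivIsetP => i j _ _ ij; apply/seteqP; split => // w.
  rewrite /F => -[]; have := @pickle_invK S i; have := @pickle_invK S j.
  case: pickle_inv => [s /= sj|//]; case: pickle_inv => [s' /= s'i|//].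
  move=> [_ /= Xs'] [_ /= Xs]; move: ij; rewrite -sj -s'i -Xs' -Xs.
  by rewrite eqxx.
have F0 n : 0 <= \int[P]_(w in F n) f w.
  by apply: integral_ge0 => w Fw; apply: f0; rewrite DF; exists n.
rewrite {1}DF ge0_integral_bigcup//; last 2 first.
- by rewrite -DF.
- by move=> w; rewrite -DF; exact: f0.
rewrite nneseries_esumT//.
rewrite (esumID (range (@pickle S)))// [X in _ + X]esum1 ?adde0; last first.
  move=> n [_ /= nr]; rewrite (_ : F n = set0) ?integral_set0//.
  rewrite /F; have := @pickle_invK S n; case: pickle_inv => //= s sn.
  by exfalso; apply: nr; exists s.
rewrite setTI esum_image; last by move=> s s' _ _; exact: (pcan_inj pickleK).
by apply: eq_esum => s _; rewrite FE.
Qed.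

Lemma probability_partition {S : countType} (X : T -> S) (D : set T) :
  (forall s, measurable (X @^-1` [set s])) -> measurable D ->
  P D = \esum_(s in [set: S]) P (D `&` X @^-1` [set s]).
Proof.
move=> mX mD; have := @integral_partition S X D (cst 1) mX mD (measurable_cst _) (fun _ _ => lee01).
rewrite integral_cst// mul1e => ->.
by apply: eq_esum => s _; rewrite integral_cst ?mul1e//; exact: measurableI.
Qed.

End Lifting.

Section DiscreteMeasurable.
Context {d : measure_display} {T : measurableType d}.

Definition discrete_measurable {S : countType} (X : T -> S) : Prop :=
  forall A : set S, measurable (X @^-1` A).

Lemma discrete_measurable1 {S : countType} (X : T -> S) :
  (forall s, measurable (X @^-1` [set s])) -> discrete_measurable X.
Proof.
move=> mX A.
rewrite (_ : _ @^-1` _ = \bigcup_s (if `[< A s >] then X @^-1` [set s] else set0)).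
  apply: countable_bigcupT_measurable; first exact: countableP.
  by move=> s; case: ifP.
apply/seteqP; split => w /=.
  by move=> AX; exists (X w) => //; rewrite asboolT.
by move=> [s _]; case: ifP => // /asboolP As /= ->.
Qed.

Lemma discrete_measurable_pair {S S' : countType} (X : T -> S) (Y : T -> S') :
  discrete_measurable X -> discrete_measurable Y ->
  discrete_measurable (fun w => (X w, Y w)).
Proof.
move=> mX mY; apply: discrete_measurable1 => -[s s'].
rewrite (_ : _ @^-1` _ = X @^-1` [set s] `&` Y @^-1` [set s']).
  exact: measurableI.
by apply/seteqP; split => w /= [-> ->].
Qed.

Lemma discrete_measurable_comp {S S' : countType} (X : T -> S) (f : S -> S') :
  discrete_measurable X -> discrete_measurable (f \o X).
Proof. by move=> mX A; rewrite comp_preimage; exact: mX. Qed.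

Lemma discrete_measurable_fun {S : countType} {d'} {T' : measurableType d'}
    (X : T -> S) (f : S -> T') :
  discrete_measurable X -> measurable_fun setT (f \o X).
Proof. by move=> mX _ B _; rewrite setTI comp_preimage; exact: mX. Qed.

Lemma discrete_measurable_service_state k (Y : nat -> T -> nat * nat) i :
  (forall i, discrete_measurable (Y i)) ->
  discrete_measurable (fun w => service_state k (Y ^~ w) i).
Proof.
move=> mY; elim: i => [|i IHi]; first by move=> A; rewrite preimage_cst; case: ifP.
have := discrete_measurable_pair (discrete_measurable_pair IHi (mY i)) (mY i.+1).
exact: (discrete_measurable_comp (fun z => service_update k z.1.1 z.1.2 z.2)).
Qed.

End DiscreteMeasurable.

(** * Cylinder events of the chain on a grid *)

Section Cylinders.
Context {R : realType} {d : measure_display} {T : measurableType d}.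
Variable P : probability T R.
Context {S : countType}.
Variables (q : S -> S -> R) (Q : R -> T -> S) (p : R -> S -> S -> R).
Hypothesis mQ : forall t (A : set S), 0 <= t -> measurable (Q t @^-1` A).
Hypothesis QP : forall (n : nat) (t : nat -> R) (x : nat -> S), 0 <= t 0%N ->
  (forall i, (i < n)%N -> t i <= t i.+1) ->
  P [set w | forall i, (i <= n)%N -> Q (t i) w = x i] =
  (P [set w | Q (t 0%N) w = x 0%N] *
   (\prod_(i < n) p (t i.+1 - t i) (x i) (x i.+1))%:E)%E.
Variables (t : nat -> R) (h : R).
Hypotheses (t0_ge0 : 0 <= t 0%N) (h_ge0 : 0 <= h).
Hypothesis tS : forall i, t i.+1 = t i + h.

Definition cylinder (n : nat) (x : nat -> S) : set T :=
  [set w | forall i, (i <= n)%N -> Q (t i) w = x i].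

Definition extend (x : nat -> S) (n : nat) (y : S) (i : nat) : S :=
  if (i <= n)%N then x i else y.

Lemma grid_ge0 i : 0 <= t i.
Proof. by elim: i => // i IHi; rewrite tS addr_ge0. Qed.

Lemma measurable_cylinder n x : measurable (cylinder n x).
Proof.
rewrite (_ : cylinder n x = \bigcap_(i in `I_n.+1) Q (t i) @^-1` [set x i]).
  by apply: fin_bigcap_measurable => // i _; exact/mQ/grid_ge0.
by apply/seteqP; split => w /= xw i /= ?; apply: xw.
Qed.

Lemma probability_cylinderS n x :
  P (cylinder n.+1 x) = (P (cylinder n x) * (p h (x n) (x n.+1))%:E)%E.
Proof.
rewrite /cylinder !QP//; last 2 first.
- by move=> i _; rewrite tS lerDl.
- by move=> i _; rewrite tS lerDl.
by rewrite big_ord_recr/= tS addrAC subrr add0r EFinM muleA.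
Qed.

Lemma cylinder_extend n x y :
  cylinder n x `&` Q (t n.+1) @^-1` [set y] = cylinder n.+1 (extend x n y).
Proof.
apply/seteqP; split => w /= => [[xw yw] i|xw].
  rewrite /extend leq_eqVlt => /orP[/eqP->|]; first by rewrite ltnn.
  by rewrite ltnS => i_n; rewrite i_n xw.
split => [i i_n|]; first by rewrite xw ?leqW// /extend i_n.
by rewrite xw// /extend ltnn.
Qed.

Lemma probability_cylinder_extend n x y :
  P (cylinder n.+1 (extend x n y)) = (P (cylinder n x) * (p h (x n) y)%:E)%E.
Proof.
rewrite probability_cylinderS /extend leqnn ltnn; congr (P _ * _)%E.
by apply/seteqP; split => w /= xw i i_n; have := xw i i_n; rewrite i_n.
Qed.

Lemma integral_cylinder n x (f : T -> \bar R) : measurable_fun setT f ->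
  (forall w, 0 <= f w)%E ->
  (\int[P]_(w in cylinder n x) f w =
   \esum_(y in [set: S]) \int[P]_(w in cylinder n.+1 (extend x n y)) f w)%E.
Proof.
move=> mf f0; rewrite (@integral_partition _ _ _ P _ (Q (t n.+1)))//.
- by apply: eq_esum => y _; rewrite cylinder_extend.
- by move=> y; exact/mQ/grid_ge0.
- exact: measurable_cylinder.
- exact: measurable_funTS.
Qed.

(* If [r] bounds the chance that the next transition is [bad], from any state,
   then [r ^+ N] bounds the chance of [N] consecutive bad transitions. *)
Lemma probability_all_bad (bad : S -> S -> bool) (r : R) : 0 <= r ->
  (forall x, \esum_(y in [set: S]) (p h x y * (bad x y)%:R)%:E <= r%:E)%E ->
  (forall x y, 0 <= p h x y) ->
  forall N n x, (P (cylinder n x `&`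
    [set w | forall i, (i < N)%N -> bad (Q (t (n + i)%N) w) (Q (t (n + i).+1) w)]) <=
    P (cylinder n x) * (r ^+ N)%:E)%E.
Proof.
move=> r0 badr p0; elim=> [|N IHN] n x.
  rewrite expr0 mule1 (_ : [set _ | _] = setT) ?setIT//.
  by apply/seteqP; split.
set A := [set _ | _].
have mA : measurable A.
  rewrite (_ : A = \bigcap_(i in `I_N.+1)
     [set w | bad (Q (t (n + i)%N) w) (Q (t (n + i).+1) w)]).
    apply: fin_bigcap_measurable => // i _.
    have := @discrete_measurable_pair _ _ _ _ (Q (t (n + i)%N)) (Q (t (n + i).+1))
      (fun A => mQ A (grid_ge0 _)) (fun A => mQ A (grid_ge0 _)).
    by move=> /(_ [set z | bad z.1 z.2]).
  by apply/seteqP; split.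
have pfin B : measurable B -> P B \is a fin_num by move=> ?; exact: fin_num_measure.
rewrite (@probability_partition _ _ _ P _ (Q (t n.+1))); last 2 first.
- by move=> y; exact/mQ/grid_ge0.
- by apply: measurableI => //; exact: measurable_cylinder.
apply: (@le_trans _ _ (\esum_(y in [set: S]) ((fine (P (cylinder n x)) * r ^+ N)%:E *
    (p h (x n) y * (bad (x n) y)%:R)%:E)))%E.
  apply: le_esum => y _; rewrite setIAC cylinder_extend.
  have [bxy|bxy] := boolP (bad (x n) y); last first.
    rewrite mulr0 mule0 (_ : _ `&` _ = set0) ?measure0//.
    apply/seteqP; split => // w /= [cw /(_ 0%N isT)]; rewrite addn0.
    by rewrite (cw n (leqnSn n)) (cw n.+1 (leqnn _)) /extend leqnn ltnn (negPf bxy).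
  rewrite mulr1.
  have := IHN n.+1 (extend x n y); rewrite probability_cylinder_extend.
  rewrite EFinM fineK ?pfin//; last exact: measurable_cylinder.
  rewrite muleAC; apply: le_trans; apply: le_measure; rewrite ?inE.
  - by apply: measurableI => //; exact: measurable_cylinder.
  - apply: measurableI; first exact: measurable_cylinder.
    rewrite (_ : [set _ | _] = \bigcap_(i in `I_N)
       [set w | bad (Q (t (n.+1 + i)%N) w) (Q (t (n.+1 + i).+1) w)]).
      apply: fin_bigcap_measurable => // i _.
      have := @discrete_measurable_pair _ _ _ _ (Q (t (n.+1 + i)%N)) (Q (t (n.+1 + i).+1))
        (fun A => mQ A (grid_ge0 _)) (fun A => mQ A (grid_ge0 _)).
      by move=> /(_ [set z | bad z.1 z.2]).
    by apply/seteqP; split.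
  - apply: setIS => w /= Aw i iN; have := Aw i.+1.
    by rewrite ltnS addnS addSn; apply.
rewrite esumZl; last 2 first.
- by rewrite mulr_ge0// ?fine_ge0// exprn_ge0.
- by move=> y; rewrite lee_fin mulr_ge0.
rewrite exprSr !EFinM fineK ?pfin//; last exact: measurable_cylinder.
by rewrite muleA; apply: lee_wpmul2l => //; rewrite mule_ge0// lee_fin exprn_ge0.
Qed.

End Cylinders.

(** * Stable subordinators *)

Section Subordinator.
Context {R : realType} {d : measure_display} {T : measurableType d}.
Variable P : probability T R.
Variables (nu : R) (sigma : R -> {RV P >-> R}).
Hypothesis nu_gt0 : 0 < nu.
Hypothesis subP : stable_subordinator nu sigma.

Lemma measurable_increment (s t : R) :
  measurable_fun setT (fun w => sigma t w - sigma s w).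
Proof. by apply: measurable_funB. Qed.

Lemma measurable_exp_scale {d'} {T' : measurableType d'} (X : T' -> R) (v : R) :
  measurable_fun setT X -> measurable_fun setT (fun w => expR (- (v * X w))).
Proof.
move=> mX; apply: measurableT_comp => //.
apply: measurableT_comp => //.
by apply: measurable_funM => //; exact: measurable_cst.
Qed.

(** The case [v = 0], absent from [sub_laplace], is that of a cell without charge; both sides are
    then 1, as a positive power of 0 vanishes. *)
Lemma increment_laplace (s t v : R) : 0 <= s -> s <= t -> 0 <= v ->
  (\int[P]_w (expR (- (v * (sigma t w - sigma s w))))%:E =
   (expR (- ((t - s) * v `^ nu)))%:E)%E.
Proof.
move=> s0 st; rewrite le_eqVlt => /orP[/eqP<-|v0].
  under eq_integral do rewrite mul0r oppr0 expR0.
  rewrite integral_cst// mul1e powR0 ?gt_eqF// mulr0 oppr0 expR0.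
  exact: probability_setT.
have ts : 0 <= t - s by rewrite subr_ge0.
rewrite -(sub_laplace subP v0 ts) unlock.
have mid : measurable_fun setT (fun x : R => (expR (- (v * x)))%:E).
  by apply/measurable_EFinP; exact: (measurable_exp_scale v (@measurable_id _ R setT)).
have mi := measurable_increment s t.
have push (X : T -> R) (mX : measurable_fun setT X) :
    (\int[P]_w (expR (- (v * X w)))%:E =
     \int[pushforward P X]_x (expR (- (v * x)))%:E)%E.
  by rewrite (ge0_integral_pushforward mX)// => x _; rewrite lee_fin expR_ge0.
rewrite (push _ mi) (push (sigma (t - s)))//.
apply: eq_measure_integral => A mA _.
exact: (sub_stationary_increments subP s0 st mA).
Qed.

Lemma measurable_sublevel (X : T -> R) (a : R) : measurable_fun setT X ->
  measurable [set w | X w <= a].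
Proof.
move=> mX; rewrite -[X in measurable X]setTI.
by apply: measurable_fun_le => //; exact: measurable_cst.
Qed.

(** The exponential Markov inequality, which turns the decay of a Laplace transform into an almost
    sure property. *)
Lemma probability_le_exp (X : T -> R) (v a : R) : measurable_fun setT X -> 0 <= v ->
  (P [set w | (X w <= a)%R] <=
   (expR (v * a))%:E * \int[P]_w (expR (- (v * X w)))%:E)%E.
Proof.
move=> mX v0.
have mA := measurable_sublevel a mX.
have mE := measurable_exp_scale v mX.
have mEE : measurable_fun setT (fun w => (expR (- (v * X w)))%:E).
  exact/measurable_EFinP.
have E0 w : [set: T] w -> (0 <= (expR (- (v * X w)))%:E)%E.
  by rewrite lee_fin expR_ge0.
have c0 : (0 <= (expR (v * a))%:E)%E by rewrite lee_fin expR_ge0.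
rewrite -(ge0_integralZl P measurableT mEE E0 c0).
rewrite -[X in (P X <= _)%E]setIT -integral_indic//.
apply: ge0_le_integral => //.
- by apply/measurable_EFinP; exact: measurable_indic.
- by apply: emeasurable_funM; [exact: measurable_cst|exact/measurable_EFinP].
- move=> w _; rewrite -EFinM lee_fin -expRD indicE.
  have [|_] := boolP (w \in _); last by rewrite expR_ge0.
  rewrite inE /= => Xa; rewrite -mulrBr -[leLHS]expR0 ler_expR.
  by rewrite mulr_ge0// subr_ge0.
Qed.

Lemma le0_expN (x : \bar R) : (forall n, x <= (expR (- n%:R))%:E)%E -> (x <= 0)%E.
Proof.
move=> xn; apply: (cvge_to_ge (a := \oo) (f := fun n => (expR (- n%:R))%:E : \bar R)).
  apply: cvg_EFin; first exact: nearW.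
  exact: cvgn_expR.
exact: nearW.
Qed.

Lemma ae_increment_gt0 (s t : R) : 0 <= s -> s < t ->
  {ae P, forall w, sigma s w < sigma t w}.
Proof.
move=> s0 st.
exists [set w | sigma t w - sigma s w <= 0]; split.
- exact/measurable_sublevel/measurable_increment.
- apply/eqP; rewrite eq_le measure_ge0 andbT; apply: le0_expN => n.
  have ts : 0 < t - s by rewrite subr_gt0.
  (* Chosen so that the Laplace transform of the increment at [v] is [expR (- n)]. *)
  pose v := (n%:R / (t - s)) `^ nu^-1.
  have vE : (t - s) * v `^ nu = n%:R.
    rewrite /v -powRrM mulVf ?gt_eqF// powRr1; last by rewrite divr_ge0// ltW.
    by rewrite mulrC divfK// gt_eqF.
  have v0 : 0 <= v by exact: powR_ge0.
  apply: le_trans (probability_le_exp 0 (measurable_increment s t) v0) _.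
  by rewrite mulr0 expR0 mul1e (increment_laplace s0 (ltW st) v0) vE.
- by move=> w /= /negP; rewrite -leNgt subr_le0.
Qed.

(** Strict increase is almost sure for all pairs of rationals at once; two rationals inserted
    between [s] and [t], together with monotonicity, give all pairs of reals. *)
Lemma ae_subordinator_incr : {ae P, forall w,
  forall s t : R, 0 <= s -> s < t -> sigma s w < sigma t w}.
Proof.
have H (n : nat) : {ae P, forall w, if @unpickle (rat * rat)%type n is Some (a, b) then
    0 <= ratr a :> R -> ratr a < ratr b :> R -> sigma (ratr a) w < sigma (ratr b) w
    else True}.
  case: unpickle => [[a b]|]; last by apply: aeW.
  have [a0|a0] := leP 0 (ratr a : R); last by apply: aeW.
  have [ab|ab] := ltP (ratr a : R) (ratr b); last by apply: aeW.
  by have := ae_increment_gt0 a0 ab; apply: filterS => w.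
have /ae_foralln Hall := H.
apply: filterS2 (sub_nondecreasing subP) Hall => w mono Hw s t s0 st.
have [a] := rat_in_itvoo st; rewrite in_itv/= => /andP[sa at_].
have [b] := rat_in_itvoo at_; rewrite in_itv/= => /andP[ab bt].
have a0 : 0 <= ratr a :> R by exact: le_trans s0 (ltW sa).
apply: le_lt_trans (mono _ _ s0 (ltW sa)) _.
apply: lt_le_trans (mono _ _ (le_trans a0 (ltW ab)) (ltW bt)).
by have := Hw (pickle (a, b)); rewrite pickleK; apply.
Qed.

Lemma ae_subordinator_unbounded : {ae P, forall w,
  forall t : R, exists2 r : R, 0 <= r & t < sigma r w}.
Proof.
have H (K : nat) : {ae P, forall w, exists n : nat, K%:R < sigma n%:R w}.
  pose A n := [set w | sigma n%:R w <= K%:R].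
  have mA n : measurable (A n) by exact: measurable_sublevel.
  exists (\bigcap_n A n); split; first exact: bigcapT_measurable.
    apply/eqP; rewrite eq_le measure_ge0 andbT; apply: le0_expN => n.
    (* At time [K + n], the exponential inequality with [v = 1] bounds the probability of staying
       below [K] by [expR (K - (K + n)) = expR (- n)]. *)
    apply: (@le_trans _ _ (P (A (K + n)%N))).
      apply: le_measure; rewrite ?inE//; first exact: bigcapT_measurable.
      exact: bigcap_inf.
    have msig : measurable_fun setT (sigma (K + n)%:R) by [].
    have := probability_le_exp K%:R msig ler01.
    have := sub_laplace subP (@ltr01 R) (ler0n R (K + n)).
    rewrite unlock => ->; rewrite powR1 mulr1 mul1r -EFinM -expRD => /le_trans; apply.
    by rewrite lee_fin ler_expR natrD opprD addrA subrr add0r.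
  by move=> w /= /forallNP nw n _; rewrite /A /= leNgt; apply/negP/nw.
have /ae_foralln Hall := H.
apply: filterS Hall => w Hw t; have [n nt] := Hw (Num.bound t).
exists n%:R => //; apply: le_lt_trans nt.
have [t0|/ltW t0] := leP 0 t; first by have /ltW := archi_boundP t0.
exact: le_trans t0 _.
Qed.

Section GridIncrements.
Variables (t : nat -> R).
Hypotheses (t0 : 0 <= t 0%N) (t_mono : forall i, t i <= t i.+1).

Lemma probability_increments n (B : nat -> set R) : (forall i, measurable (B i)) ->
  P [set w | forall i, (i < n)%N -> B i (sigma (t i.+1) w - sigma (t i) w)] =
  (\prod_(i < n) P ((fun w => sigma (t i.+1) w - sigma (t i) w)%R @^-1` B i))%E.
Proof.
move=> mB.
have := @sub_independent_increments _ _ _ _ _ _ subP n t t0 (fun i _ => t_mono i)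
  (enum 'I_n) (fun i => B i) (enum_uniq _) (fun i => mB i).
rewrite big_enum/= => <-; congr (P _).
apply/seteqP; split => w /= Bw i; first by move=> _ /=; exact: Bw.
by move=> i_n; have := Bw (Ordinal i_n); apply; rewrite /= mem_enum.
Qed.

End GridIncrements.

Section IndependentOfChain.
Context {U : Type}.
Variables (MU : set (set U)) (Q : R -> T -> U).
Hypothesis indep : independent_processes P MU (@measurable _ R) Q sigma.

(** Independence is assumed between generated sigma-algebras, so events about increments must be
    shown to belong to that of [sigma]. *)
Lemma process_sigma_sub_increments (t : nat -> R) n (B : nat -> set R) :
  (forall i, 0 <= t i) -> (forall i, measurable (B i)) ->
  process_sigma (@measurable _ R) sigma
    [set w | forall i, (i < n)%N -> B i (sigma (t i.+1) w - sigma (t i) w)].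
Proof.
move=> t0 mB; rewrite /process_sigma; set G := [set E | _].
have msig i : measurable_fun (setT : set (g_sigma_algebraType G)) (sigma (t i)).
  move=> _ C mC; rewrite setTI; apply: sub_sigma_algebra.
  by exists (t i), C.
rewrite (_ : [set w | _] = \bigcap_(i in `I_n)
   ((fun w => sigma (t i.+1) w - sigma (t i) w) @^-1` B i)); last first.
  by apply/seteqP; split.
have : measurable ((\bigcap_(i in `I_n)
   ((fun w => sigma (t i.+1) w - sigma (t i) w) @^-1` B i)) : set (g_sigma_algebraType G)).
  apply: fin_bigcap_measurable => // i _.
  rewrite -[X in measurable X]setTI.
  by apply: (measurable_funB (msig i.+1) (msig i)).
by [].
Qed.

Lemma process_sigma_finite_dim (t : nat -> R) n (A : nat -> set U) :
  (forall i, 0 <= t i) -> (forall i, MU (A i)) ->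
  process_sigma MU Q [set w | forall i, (i <= n)%N -> A i (Q (t i) w)].
Proof.
move=> t0 mA; rewrite /process_sigma; set G := [set E | _].
rewrite (_ : [set w | _] = \bigcap_(i in `I_n.+1) (Q (t i) @^-1` A i)); last first.
  by apply/seteqP; split => w /= Aw i /= i_n; apply: Aw.
have : measurable ((\bigcap_(i in `I_n.+1) (Q (t i) @^-1` A i)) :
    set (g_sigma_algebraType G)).
  apply: fin_bigcap_measurable => // i _; apply: sub_sigma_algebra.
  by exists (t i), (A i).
by [].
Qed.

End IndependentOfChain.
End Subordinator.

(** * The Laplace transform on a grid *)

Section Expectation.
Context {R : realType} {d : measure_display} {T : measurableType d}.
Variable P : probability T R.
Variables (k : nat) (lam mu nu : R) (Q : R -> T -> queue_state k) (sigma : R -> {RV P >-> R}).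
Hypotheses (k_gt0 : (0 < k)%N) (lam_gt0 : 0 < lam) (mu_gt0 : 0 < mu) (nu_gt0 : 0 < nu).
Variable p : R -> queue_state k -> queue_state k -> R.
Hypothesis pP : transition_function (@queue_rate k R lam mu) p.
Hypothesis mQ : forall t (A : set (queue_state k)), 0 <= t -> measurable (Q t @^-1` A).
Hypothesis QP : forall (n : nat) (t : nat -> R) (x : nat -> queue_state k), 0 <= t 0%N ->
  (forall i, (i < n)%N -> t i <= t i.+1) ->
  P [set w | forall i, (i <= n)%N -> Q (t i) w = x i] =
  (P [set w | Q (t 0%N) w = x 0%N] *
   (\prod_(i < n) p (t i.+1 - t i) (x i) (x i.+1))%:E)%E.
Hypothesis subP : stable_subordinator nu sigma.
Hypothesis indep :
  independent_processes P [set: set (queue_state k)] (@measurable _ R) Q sigma.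
Variables (v : nat -> R) (B : R) (m : nat).
Hypothesis v_ge0 : forall r, 0 <= v r.
Hypothesis v_le : forall r, v r `^ nu <= B.
Hypothesis v_supp : forall r, (m <= r)%N -> v r = 0.

Notation theta := (k%:R * mu).
Notation U := (fun r => v r `^ nu).
Local Notation K := (4 * (lam + theta) ^+ 2 + B ^+ 2 + (lam + theta) * B).
Notation weight := (service_weight k mu U m).

Definition queue_path (w : T) (t : R) : nat * nat := val (Q t w).

Variable h : R.
Hypothesis h_gt0 : 0 < h.

Let grid (i : nat) : R := i%:R * h.

Let grid0 : 0 <= grid 0. Proof. by rewrite /grid mul0r. Qed.
Let h_ge0 : 0 <= h. Proof. exact: ltW. Qed.
Let gridS i : grid i.+1 = grid i + h. Proof. by rewrite /grid -natr1 mulrDl mul1r. Qed.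
Let grid_ge0 i : 0 <= grid i. Proof. by rewrite /grid mulr_ge0. Qed.
Let grid_le i : grid i <= grid i.+1. Proof. by rewrite gridS lerDl. Qed.

Let st (w : T) (i : nat) := service_state k (skeleton (queue_path w) h) i.
Let inc (i : nat) (w : T) : R := sigma (grid i.+1) w - sigma (grid i) w.

(** The true increments of [sigma] appear here; they are averaged only once the observed states are
    fixed. The last factor anticipates the phases not yet completed after [n] steps. *)
Definition weighted_path (n : nat) (w : T) : R :=
  (\prod_(i < n) expR (- (service_cost v (st w i.+1) *
     (sigma (i.+1%:R * h) w - sigma (i%:R * h) w)))) * weight (st w n).

Let U0 r : 0 <= v r `^ nu. Proof. exact: powR_ge0. Qed.
Let U_supp r : (m <= r)%N -> v r `^ nu = 0.
Proof. by move=> mr; rewrite v_supp// powR0// gt_eqF. Qed.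

Let weight01 a : 0 <= weight a <= 1.
Proof. exact: phase_laplace01. Qed.

Lemma discrete_measurable_skeleton i :
  discrete_measurable (fun w => skeleton (queue_path w) h i).
Proof. by move=> A; have := mQ (fun z => A (val z)) (grid_ge0 i). Qed.

Let mst i : discrete_measurable (fun w => st w i).
Proof.
apply: discrete_measurable_service_state => j.
exact: discrete_measurable_skeleton.
Qed.

Lemma measurable_skeleton_fun (F : nat * bool -> R) i :
  measurable_fun setT (fun w => F (service_state k (skeleton (queue_path w) h) i)).
Proof. exact: (discrete_measurable_fun (T' := R) F (mst i)). Qed.

Lemma measurable_weighted_path n : measurable_fun setT (weighted_path n).
Proof.
apply: measurable_funM; last exact: measurable_skeleton_fun.
apply: measurable_prod => i _; apply: measurableT_comp => //.
apply: measurableT_comp => //; apply: measurable_funM.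
  exact: (measurable_skeleton_fun (service_cost v)).
exact: measurable_increment.
Qed.

Lemma weighted_path_ge0 n w : 0 <= weighted_path n w.
Proof.
apply: mulr_ge0; first by apply: prodr_ge0 => i _; exact: expR_ge0.
by have /andP[] := weight01 (st w n).
Qed.

Let cyl := cylinder Q grid.

Let mcyl n x : measurable (cyl n x).
Proof. exact: (measurable_cylinder mQ grid0 h_ge0 gridS). Qed.

Let cyl_st n x w : cyl n x w -> forall i, (i <= n)%N ->
  st w i = service_state k (val \o x) i.
Proof.
move=> xw i i_n; apply: eq_service_state => j ji.
by rewrite /= -(xw j)// (leq_trans ji).
Qed.

Let cost_powR a : service_cost v a `^ nu = service_cost U a.
Proof. by rewrite /service_cost; case: ifP => // _; rewrite powR0// gt_eqF. Qed.

Let cost_ge0 a : 0 <= service_cost v a.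
Proof. by rewrite /service_cost; case: ifP. Qed.

Let prefix n (x : nat -> queue_state k) : R :=
  \prod_(i < n) expR (- (h * service_cost U (service_state k (val \o x) i.+1))).

(** On a cylinder the states are known, so the charges are constants; the increments of [sigma],
    independent of one another and of the cylinder, integrate separately. *)
Lemma integral_prefix n x :
  (\int[P]_(w in cyl n x) (\prod_(i < n)
     expR (- (service_cost v (service_state k (val \o x) i.+1) * inc i w)))%:E =
   P (cyl n x) * (prefix n x)%:E)%E.
Proof.
apply: (@integral_prod_indep _ _ _ P n (cyl n x) inc (fun i z =>
  expR (- (service_cost v (service_state k (val \o x) i.+1) * z)))
  (fun i => expR (- (h * service_cost U (service_state k (val \o x) i.+1))))) => //.
- by move=> i; exact: measurable_increment.
- by move=> i; exact: (measurable_exp_scale _ (@measurable_id _ R setT)).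
- move=> i; rewrite /inc (increment_laplace nu_gt0 subP)//.
  by rewrite gridS addrAC subrr add0r cost_powR.
- move=> C mC; rewrite -(probability_increments subP grid0 grid_le)//.
  apply: indep.
    exact: (@process_sigma_finite_dim _ _ _ _ setT Q grid n (fun i => [set x i])).
  exact: process_sigma_sub_increments.
Qed.

(** Induction on the number [N] of steps to come, the first [M] transitions being fixed. Splitting
    over the next state lengthens the cylinder and shortens the future; [service_martingale] then
    sums the main terms with an error [K * h ^+ 2], always in proportion to the probability of the
    cylinder. *)
Lemma weighted_path_cylinder N M x :
  ((fine (P (cyl M x)) * (prefix M x * weight (service_state k (val \o x) M)) -
      fine (P (cyl M x)) * (N%:R * K * h ^+ 2))%:E <=
   \int[P]_(w in cyl M x) (weighted_path (M + N) w)%:E <=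
   (fine (P (cyl M x)) * (prefix M x * weight (service_state k (val \o x) M)) +
      fine (P (cyl M x)) * (N%:R * K * h ^+ 2))%:E)%E.
Proof.
have pfin C : measurable C -> P C \is a fin_num by move=> ?; exact: fin_num_measure.
elim: N M x => [|N IHN] M x.
  rewrite !mul0r mulr0 subr0 addr0 addn0 -eq_le; apply/eqP.
  transitivity (\int[P]_(w in cyl M x) ((weight (service_state k (val \o x) M))%:E *
     (\prod_(i < M) expR (- (service_cost v (service_state k (val \o x) i.+1) *
        inc i w)))%:E))%E.
    rewrite ge0_integralZl//.
    - by rewrite integral_prefix mulrA mulrC !EFinM fineK// ?pfin.
    - apply/measurable_EFinP; apply: measurable_prod => i _.
      apply: measurable_funTS; apply: measurable_exp_scale.
      exact: measurable_increment.
    - by move=> w _; rewrite lee_fin prodr_ge0// => i _; exact: expR_ge0.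
    - by rewrite lee_fin; have /andP[] := weight01 (service_state k (val \o x) M).
  apply: eq_integral => w /set_mem xw; rewrite /weighted_path EFinM muleC.
  rewrite (cyl_st xw (leqnn M)); congr (_%:E * _)%E.
  by apply: eq_bigr => i _; rewrite (cyl_st xw (ltn_ord i)).
set a := fine (P (cyl M x)).
have a0 : 0 <= a by exact: fine_ge0.
have aE : P (cyl M x) = a%:E by rewrite fineK// pfin.
have pfx01 : 0 <= prefix M x <= 1.
  apply: (big_ind (fun z => 0 <= z <= 1)).
  - by rewrite ler01 lexx.
  - by move=> y z /andP[y0 y1] /andP[z0 z1]; rewrite mulr_ge0//= mulr_ile1.
  - move=> i _; rewrite expR_ge0 expR_le1 oppr_le0 mulr_ge0//.
    by rewrite /service_cost; case: ifP.
have p0 y : 0 <= p h (x M) y by exact: (tf_ge0 pP).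
have [r rE rM] := service_martingale k_gt0 lam_gt0 mu_gt0 pP U0 v_le U_supp x M h_ge0.
have g01 y := next_value01 k_gt0 mu_gt0 m U0 x M y h_ge0.
set g := next_value mu U m h x M in rE g01.
have cylE y : P (cyl M.+1 (extend x M y)) = (a * p h (x M) y)%:E.
  by rewrite /cyl (probability_cylinder_extend QP grid0 h_ge0 gridS) -/cyl aE EFinM.
have ext_st y i : (i <= M)%N ->
    service_state k (val \o extend x M y) i = service_state k (val \o x) i.
  by move=> iM; apply: eq_service_state => j ji; rewrite /= /extend (leq_trans ji).
(* The charge of the added cell and the new weight together make up [g y], the integrand of
   [service_martingale]. *)
have extE y : prefix M.+1 (extend x M y) *
    weight (service_state k (val \o extend x M y) M.+1) = prefix M x * g y.
  rewrite /prefix big_ord_recr /= -/(prefix _ _) -mulrA; congr (_ * _).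
    by apply: eq_bigr => i _; rewrite ext_st.
  rewrite /g /next_value /= /extend leqnn ltnn -/(extend x M y).
  by rewrite [service_state k (val \o extend _ _ _) M]ext_st.
have mW := measurable_weighted_path.
rewrite (integral_cylinder P mQ grid0 h_ge0 gridS); last 2 first.
- exact/measurable_EFinP.
- by move=> w; rewrite lee_fin weighted_path_ge0.
have IH y := IHN M.+1 (extend x M y).
rewrite addSnnS in IH.
pose I y := (\int[P]_(w in cyl M.+1 (extend x M y)) (weighted_path (M + N.+1) w)%:E)%E.
have I0 y : (0 <= I y)%E.
  by apply: integral_ge0 => w _; rewrite lee_fin weighted_path_ge0.
pose e := N%:R * K * h ^+ 2.
have K0 : 0 <= K.
  have t0 := theta_gt0 k_gt0 mu_gt0; have B0 : 0 <= B by exact: le_trans (U0 0%N) (v_le 0%N).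
  rewrite !addr_ge0// ?mulr_ge0 ?sqr_ge0// ?addr_ge0 ?ltW//.
have e0 : 0 <= e by rewrite /e !mulr_ge0// sqr_ge0.
have bnd y : ((a * p h (x M) y * (prefix M x * g y) - a * p h (x M) y * e)%:E <= I y <=
    (a * p h (x M) y * (prefix M x * g y) + a * p h (x M) y * e)%:E)%E.
  by have := IH y; rewrite extE cylE.
have sumg : \esum_(y in [set: queue_state k])
    (a * p h (x M) y * (prefix M x * g y))%:E = (a * prefix M x * r)%:E.
  rewrite EFinM -rE -esumZl.
  - by apply: eq_esum => y _; rewrite -EFinM; congr _%:E; ring.
  - by rewrite mulr_ge0//; have /andP[] := pfx01.
  - by move=> y; rewrite lee_fin mulr_ge0//; have /andP[] := g01 y.
have sume : \esum_(y in [set: queue_state k]) (a * p h (x M) y * e)%:E = (a * e)%:E.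
  rewrite -[in RHS](mule1 (a * e)%:E) -(tf_sum1 pP (x M) h_ge0) -esumZl.
  - by apply: eq_esum => y _; rewrite -EFinM; congr _%:E; ring.
  - by rewrite mulr_ge0.
  - by move=> y; rewrite lee_fin.
have ge0g y : (0 <= (a * p h (x M) y * (prefix M x * g y))%:E)%E.
  have /andP[pf0 _] := pfx01; have /andP[gy0 _] := g01 y.
  by rewrite lee_fin; apply: mulr_ge0; apply: mulr_ge0.
have ge0e y : (0 <= (a * p h (x M) y * e)%:E)%E.
  by rewrite lee_fin; apply: mulr_ge0 => //; apply: mulr_ge0.
have upper : (\esum_(y in [set: queue_state k]) I y <= (a * prefix M x * r + a * e)%:E)%E.
  rewrite EFinD -sumg -sume -esumD//; apply: le_esum => y _.
  by rewrite -EFinD; have /andP[] := bnd y.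
have lower : ((a * prefix M x * r - a * e)%:E <= \esum_(y in [set: queue_state k]) I y)%E.
  rewrite EFinB -sumg leeBlDr ?sume// -sume -esumD//; apply: le_esum => y _.
  have /andP[+ _] := bnd y.
  by rewrite EFinB leeBlDr.
have pfxr : `|a * prefix M x * r - a * (prefix M x * weight (service_state k (val \o x) M))|
    <= a * (K * h ^+ 2).
  rewrite mulrA -mulrBr normrM ger0_norm; last first.
    by rewrite mulr_ge0//; have /andP[] := pfx01.
  rewrite -mulrA; apply: ler_wpM2l => //.
  have /andP[pf0 pf1] := pfx01.
  by rewrite -[leRHS]mul1r; apply: ler_pM.
have aN : a * (N.+1%:R * K * h ^+ 2) = a * e + a * (K * h ^+ 2).
  by rewrite -natr1 /e; ring.
move: pfxr; rewrite ler_norml => /andP[r1 r2].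
apply/andP; split.
  by apply: le_trans lower; rewrite lee_fin aN; move: r1 r2; lra.
by apply: le_trans upper _; rewrite lee_fin aN; move: r1 r2; lra.
Qed.

Lemma weighted_path_expectation n :
  ((phase_laplace k mu U m 0 - n%:R * K * h ^+ 2)%:E <=
   \int[P]_w (weighted_path n w)%:E <=
   (phase_laplace k mu U m 0 + n%:R * K * h ^+ 2)%:E)%E.
Proof.
have pfin C : measurable C -> P C \is a fin_num by move=> ?; exact: fin_num_measure.
pose C0 y : set T := cyl 0 (fun=> y).
have C0E y : [set: T] `&` Q (grid 0) @^-1` [set y] = C0 y.
  rewrite setTI; apply/seteqP; split => w /= Qw; last exact: Qw.
  by move=> i; rewrite leqn0 => /eqP->.
have mQ0 y : measurable (Q (grid 0) @^-1` [set y]) by exact: mQ.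
have mW := measurable_weighted_path n.
pose I y := (\int[P]_(w in C0 y) (weighted_path n w)%:E)%E.
have I0 y : (0 <= I y)%E.
  by apply: integral_ge0 => w _; rewrite lee_fin weighted_path_ge0.
have intE : (\int[P]_w (weighted_path n w)%:E = \esum_(y in [set: queue_state k]) I y)%E.
  rewrite (@integral_partition _ _ _ P _ (Q (grid 0)))//.
  - by apply: eq_esum => y _; rewrite C0E.
  - exact/measurable_EFinP.
  - by move=> w _; rewrite lee_fin weighted_path_ge0.
have sum1 : \esum_(y in [set: queue_state k]) (fine (P (C0 y)))%:E = 1%E.
  rewrite -[RHS](probability_setT P) (@probability_partition _ _ _ P _ (Q (grid 0)))//.
  by apply: eq_esum => y _; rewrite C0E fineK// pfin//; exact: mcyl.
pose V := phase_laplace k mu U m 0; pose e := n%:R * K * h ^+ 2.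
have V0 : 0 <= V by have /andP[] := phase_laplace01 k_gt0 mu_gt0 m U0 0.
have e0 : 0 <= e.
  have t0 := theta_gt0 k_gt0 mu_gt0; have B0 : 0 <= B by exact: le_trans (U0 0%N) (v_le 0%N).
  have K0 : 0 <= K by rewrite !addr_ge0// ?mulr_ge0 ?sqr_ge0// ?addr_ge0 ?ltW.
  by rewrite /e !mulr_ge0// sqr_ge0.
have bnd y : ((fine (P (C0 y)) * V - fine (P (C0 y)) * e)%:E <= I y <=
    (fine (P (C0 y)) * V + fine (P (C0 y)) * e)%:E)%E.
  have := weighted_path_cylinder n 0 (fun=> y).
  by rewrite add0n /prefix big_ord0 mul1r.
have sumc c : 0 <= c ->
    \esum_(y in [set: queue_state k]) (fine (P (C0 y)) * c)%:E = c%:E.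
  move=> c0; rewrite -[RHS]mule1 -sum1 -esumZl//.
    by apply: eq_esum => y _; rewrite -EFinM mulrC.
  by move=> y; rewrite lee_fin fine_ge0.
have f0 c y : 0 <= c -> (0 <= (fine (P (C0 y)) * c)%:E)%E.
  by move=> c0; rewrite lee_fin mulr_ge0// fine_ge0.
rewrite intE -/V -/e; apply/andP; split.
  rewrite EFinB leeBlDr// -(sumc _ V0) -[X in (_ <= _ + X)%E](sumc _ e0).
  rewrite -esumD => [|y _|y _]; [|exact: I0|exact: f0].
  apply: le_esum => y _; have /andP[+ _] := bnd y.
  by rewrite EFinB leeBlDr.
rewrite EFinD -(sumc _ V0) -[X in (_ <= _ + X)%E](sumc _ e0).
rewrite -esumD => [|y _|y _]; [|exact: f0|exact: f0].
by apply: le_esum => y _; rewrite -EFinD; have /andP[] := bnd y.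
Qed.

End Expectation.

(** * Almost sure behaviour of the queue *)

Section ChainPaths.
Context {R : realType} {d : measure_display} {T : measurableType d}.
Variable P : probability T R.

Section Bad.
Context {S : countType}.
Variables (q : S -> S -> R) (Q : R -> T -> S) (p : R -> S -> S -> R).
Hypothesis mQ : forall t (A : set S), 0 <= t -> measurable (Q t @^-1` A).
Hypothesis QP : forall (n : nat) (t : nat -> R) (x : nat -> S), 0 <= t 0%N ->
  (forall i, (i < n)%N -> t i <= t i.+1) ->
  P [set w | forall i, (i <= n)%N -> Q (t i) w = x i] =
  (P [set w | Q (t 0%N) w = x 0%N] *
   (\prod_(i < n) p (t i.+1 - t i) (x i) (x i.+1))%:E)%E.
Variables (t : nat -> R) (h : R).
Hypotheses (t0_ge0 : 0 <= t 0%N) (h_ge0 : 0 <= h).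
Hypothesis tS : forall i, t i.+1 = t i + h.
Variables (bad : S -> S -> bool) (r : R).
Hypothesis r0 : 0 <= r.
Hypothesis badr :
  forall x, (\esum_(y in [set: S]) (p h x y * (bad x y)%:R)%:E <= r%:E)%E.
Hypothesis p0 : forall x y, 0 <= p h x y.

Lemma measurable_all_bad N :
  measurable [set w | forall i, (i < N)%N -> bad (Q (t i) w) (Q (t i.+1) w)].
Proof.
rewrite (_ : [set _ | _] = \bigcap_(i in `I_N) [set w | bad (Q (t i) w) (Q (t i.+1) w)]).
  apply: fin_bigcap_measurable => // i _.
  have tge0 := grid_ge0 t0_ge0 h_ge0 tS.
  have := @discrete_measurable_pair _ _ _ _ (Q (t i)) (Q (t i.+1))
    (fun A => mQ A (tge0 _)) (fun A => mQ A (tge0 _)).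
  by move=> /(_ [set z | bad z.1 z.2]).
by apply/seteqP; split.
Qed.

Lemma probability_all_bad_le N :
  (P [set w | forall i, (i < N)%N -> bad (Q (t i) w) (Q (t i.+1) w)] <= (r ^+ N)%:E)%E.
Proof.
have mQ0 y : measurable (Q (t 0%N) @^-1` [set y]) by exact: mQ.
have mA := measurable_all_bad N.
rewrite (@probability_partition _ _ _ P _ (Q (t 0%N)))//.
rewrite -[leRHS]mule1 -(probability_setT P).
rewrite [X in (_ <= _ * X)%E](@probability_partition _ _ _ P _ (Q (t 0%N)))//.
rewrite -esumZl ?exprn_ge0//; apply: le_esum => x _.
have := probability_all_bad mQ QP t0_ge0 h_ge0 tS r0 badr p0 N 0 (fun=> x).
rewrite setIC muleC (_ : cylinder _ _ _ _ = Q (t 0%N) @^-1` [set x]); last first.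
  apply/seteqP; split => w /=; first by move=> /(_ 0%N); apply.
  by move=> Qx i; rewrite leqn0 => /eqP->.
by rewrite setTI.
Qed.

Lemma ae_not_all_bad : r < 1 ->
  {ae P, forall w, exists i, ~~ bad (Q (t i) w) (Q (t i.+1) w)}.
Proof.
move=> r1.
exists (\bigcap_N [set w | forall i, (i < N)%N -> bad (Q (t i) w) (Q (t i.+1) w)]).
split.
- by apply: bigcapT_measurable => N; exact: measurable_all_bad.
- apply/eqP; rewrite eq_le measure_ge0 andbT.
  apply: (cvge_to_ge (a := \oo) (f := fun n => (r ^+ n)%:E : \bar R)).
    apply: cvg_EFin; first exact: nearW.
    by apply: cvg_expr; rewrite ger0_norm.
  apply: nearW => N; apply: le_trans (probability_all_bad_le N).
  apply: le_measure; rewrite ?inE; [|exact: measurable_all_bad|exact: bigcap_inf].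
  by apply: bigcapT_measurable => n; exact: measurable_all_bad.
- move=> w /= /forallNP nb N _ i _; apply: contrapT => /negP bi.
  exact: (nb i).
Qed.

End Bad.

End ChainPaths.

(** * Reading the jumps of a path from its values on grids *)

Section Transitions.
Variables (k : nat).
Hypotheses (k_gt0 : (0 < k)%N).

Notation idle := ((0, 0)%N : nat * nat).

(** A transition of positive rate whose observation between two grid points shows that the service
    has advanced in between, by the beginning or the completion of a phase. *)
Definition progress (x : queue_state k) : queue_state k :=
  if val x == idle then next_arrival k_gt0 x else next_completion k_gt0 x.

Definition forbidden (x y : queue_state k) : bool :=
  (y != x) && (y \notin neighbours k_gt0 x).

Lemma progress_neq x : progress x != x.
Proof.
have := neighbours_uniq k_gt0 x; rewrite /progress /neighbours.
case: ifPn => _; rewrite /= !inE ?negb_or => /andP[xa _]; first by rewrite eq_sym.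
by move: xa; rewrite eq_sym [x == next_completion _ _]eq_sym => /andP[].
Qed.

(** In a busy system arrivals alone increase the number of customers and keep the phase, so they
    cannot imitate a completion. *)
Lemma busy_progress_neq (n s c : nat) x y : val x = (n.+1, s) ->
  val y = (n.+1 + c, s)%N -> y != progress x.
Proof.
move=> xE yE; rewrite -val_eqE yE /progress xE xpair_eqE /= /completion_target xE /=.
have := valP x; rewrite xE /state_phase xpair_eqE /=.
by do ?case: ifP => //=; rewrite ?xpair_eqE; lia.
Qed.

Section StepPath.
Context {R : realType}.
Variables (x : R -> queue_state k) (J : nat -> R) (y : nat -> queue_state k).
Hypothesis xJy : step_path x J y.

Lemma step_path_allowed :
  (forall K n0 : nat, exists2 n, (n0 <= n)%N & forall i, (i < K * 2 ^ n)%N ->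
    ~~ forbidden (x (i%:R / 2 ^+ n)) (x (i.+1%:R / 2 ^+ n))) ->
  forall r, arrival k (val (y r)) (val (y r.+1)) ||
    phase_completion k (val (y r)) (val (y r.+1)).
Proof.
move=> nforb r.
pose g := Num.min (J r.+1 - J r) (J r.+2 - J r.+1).
have g0 : 0 < g by rewrite lt_min !subr_gt0 !(step_path_lt xJy).
have [n0 n0g] : exists n0, forall n, (n0 <= n)%N -> (2 ^+ n)^-1 < g :> R.
  have : (2 ^+ n)^-1 @[n --> \oo] --> (0 : R).
    under eq_fun do rewrite -exprVn.
    by apply: cvg_expr; rewrite ger0_norm ?invr_ge0// invf_lt1// ltr1n.
  by move=> /(cvgr_lt 0)/(_ _ g0)[n0 _ Hn0]; exists n0.
pose K := (Num.bound (J r.+1)).+1.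
have JK : J r.+1 < K%:R.
  by apply: lt_trans (archi_boundP (step_path_ge0 xJy r.+1)) _; rewrite ltr_nat.
have [n n0n nf] := nforb K n0.
have h0 : 0 < (2 ^+ n)^-1 :> R by rewrite invr_gt0 exprn_gt0.
have J0 : 0 < J r.+1 by exact: le_lt_trans (step_path_ge0 xJy r) (step_path_lt xJy r).
have [i /andP[iJ Ji]] := grid_index h0 J0.
have := n0g _ n0n; rewrite lt_min => /andP[g1 g2].
have iS : i.+1%:R / 2 ^+ n = i%:R / 2 ^+ n + (2 ^+ n)^-1 :> R.
  by rewrite -natr1 mulrDl mul1r.
have iK : (i < K * 2 ^ n)%N.
  have := lt_trans iJ JK; rewrite ltr_pdivrMr ?exprn_gt0//.
  by rewrite -natrX -natrM ltr_nat.
have := nf i iK.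
rewrite (step_path_val xJy (i := r)); [|by move: Ji; rewrite iS; lra|exact: iJ].
rewrite (step_path_val xJy (i := r.+1)); [|exact: Ji|by rewrite iS; move: iJ; lra].
rewrite /forbidden negb_and !negbK => /orP[/eqP/(step_path_neq xJy)//|].
by rewrite neighboursP.
Qed.

Lemma step_path_starts (h : R) : 0 < h ->
  (forall j : nat, exists2 i, (j <= i)%N & x (i.+1%:R * h) = progress (x (i%:R * h))) ->
  (forall r, arrival k (val (y r)) (val (y r.+1)) ||
    phase_completion k (val (y r)) (val (y r.+1))) ->
  forall r0, exists2 r, (r0 <= r)%N & phase_start k (val (y r)) (val (y r.+1)).
Proof.
move=> h0 prog allowed r0.
pose j := Num.bound (J r0 / h).
have jJ : J r0 < j%:R * h.
  rewrite -ltr_pdivrMr//; apply: archi_boundP; apply: divr_ge0; last exact: ltW.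
  exact: (step_path_ge0 xJy).
have [i ji xi] := prog j.
have iS : i.+1%:R * h = i%:R * h + h by rewrite -natr1 mulrDl mul1r.
have i0 : 0 <= i%:R * h by rewrite mulr_ge0// ltW.
have [r1 /andP[r1i ir1]] := step_path_index xJy i0.
have [r2 /andP[r2i ir2]] : exists r2, J r2 <= i.+1%:R * h < J r2.+1.
  by apply: (step_path_index xJy); rewrite mulr_ge0// ltW.
have r01 : (r0 <= r1)%N.
  rewrite -ltnS -(step_path_mono xJy); apply: lt_trans ir1; apply: lt_le_trans jJ _.
  by rewrite ler_pM2r// ler_nat.
rewrite (step_path_val xJy r1i ir1) (step_path_val xJy r2i ir2) in xi.
have r12 : (r1 <= r2)%N.
  rewrite -ltnS -(step_path_mono xJy); apply: le_lt_trans r1i _.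
  by apply: le_lt_trans ir2; rewrite iS lerDl ltW.
have := allowed r1.
have [y1|y1] := eqVneq (val (y r1)) idle.
  rewrite {1 2}y1 phase_completion_from_idle orbF => ar; exists r1 => //.
  by rewrite y1; exact: arrival_idle.
move=> _.
(* A completion either begins the next phase or empties the system, and then the following jump is
   an arrival that begins one. *)
suff [r rr c] : exists2 r, (r1 <= r)%N & phase_completion k (val (y r)) (val (y r.+1)).
  have [s|/(phase_completion_idle c) yi] :=
    boolP (phase_start k (val (y r)) (val (y r.+1))).
    by exists r => //; exact: leq_trans rr.
  have := allowed r.+1; rewrite yi phase_completion_from_idle orbF => /arrival_idle.
  by move=> s; exists r.+1; rewrite ?yi// (leq_trans r01)// leqW.
apply: contrapT => noc.
have [n nE] : exists n, (val (y r1)).1 = n.+1.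
  have := valP (y r1); rewrite /state_phase (negPf y1) /=.
  by case: (val (y r1)) => -[|n] s //= _; exists n.
(* If there were no completion, all the jumps from [r1] on would be arrivals, which contradicts the
   progress observed at [r2]. *)
have ind c : val (y (r1 + c)%N) = (n.+1 + c, (val (y r1)).2)%N.
  elim: c => [|c IHc]; first by rewrite !addn0 -nE -surjective_pairing.
  have := allowed (r1 + c)%N; rewrite -addnS => /orP[|cc]; last first.
    by exfalso; apply: noc; exists (r1 + c)%N; rewrite ?leq_addr// -addnS.
  rewrite (arrivalE k_gt0) ?(valP (y _))// IHc /arrival_target xpair_eqE /=.
  by move=> /eqP->; rewrite addnS.
have := @busy_progress_neq n (val (y r1)).2 (r2 - r1) (y r1) (y r2).
rewrite -ind subnKC// -nE -surjective_pairing => /(_ erefl erefl).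
by rewrite xi eqxx.
Qed.

End StepPath.
End Transitions.

Section QueuePaths.
Context {R : realType} {d : measure_display} {T : measurableType d}.
Variable P : probability T R.
Variables (k : nat) (lam mu : R) (Q : R -> T -> queue_state k).
Hypotheses (k_gt0 : (0 < k)%N) (lam_gt0 : 0 < lam) (mu_gt0 : 0 < mu).
Hypothesis mcQ : markov_chain P (queue_rate lam mu) Q.
Notation theta := (k%:R * mu).

Let mQ : forall t (A : set (queue_state k)), 0 <= t -> measurable (Q t @^-1` A) :=
  mc_measurable mcQ.

Lemma queue_generator_progress x :
  queue_generator k_gt0 lam mu (fun y => (y != progress k_gt0 x)%:R) x <=
  - Num.min lam theta.
Proof.
have px : (x != progress k_gt0 x) = true by rewrite eq_sym progress_neq.
rewrite /queue_generator px /progress; case: ifPn => x0.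
  by rewrite eqxx /= addr0 sub0r mulrN1 lerN2 ge_min lexx.
rewrite eqxx eq_sym next_completion_neq_arrival//= subrr mulr0 add0r sub0r mulrN1.
by rewrite lerN2 ge_min lexx orbT.
Qed.

(** With one fixed mesh, progress fails in a cell with probability at most [r < 1], whatever the
    state; so from no grid point on can it fail forever. *)
Lemma ae_progress : exists2 h : R, 0 < h & {ae P, forall w, forall j : nat,
  exists2 i, (j <= i)%N & Q (i.+1%:R * h) w = progress k_gt0 (Q (i%:R * h) w)}.
Proof.
have [p pP QP] := mc_markov mcQ.
have t0 := theta_gt0 k_gt0 mu_gt0.
pose m := Num.min lam theta; pose C := lam + theta.
have m0 : 0 < m by rewrite lt_min lam_gt0.
have mC : m <= C by rewrite ge_min lerDl ltW.
have C0 : 0 < C by rewrite addr_gt0.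
(* The error [4 * C ^+ 2 * h ^+ 2] of [queue_one_step] is then half of the main term [h * m]; what
   remains of the latter is [1 - r]. *)
pose h := m / (8 * C ^+ 2).
have h0 : 0 < h by rewrite divr_gt0// mulr_gt0// exprn_gt0.
pose r := 1 - m ^+ 2 / (16 * C ^+ 2).
have c20 : 0 < 16 * C ^+ 2 by rewrite mulr_gt0// exprn_gt0.
have r1 : r < 1 by rewrite gtrBl divr_gt0// exprn_gt0.
have r0 : 0 <= r.
  rewrite subr_ge0 ler_pdivrMr// mul1r.
  have : m ^+ 2 <= C ^+ 2 by rewrite ler_pXn2r// nnegrE ltW.
  by move: (exprn_ge0 2 (ltW C0)); lra.
exists h => //; apply/ae_foralln => j.
have tS i : (j + i.+1)%:R * h = (j + i)%:R * h + h.
  by rewrite addnS -natr1 mulrDl mul1r.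
have badr x : (\esum_(y in [set: queue_state k])
    (p h x y * (y != progress k_gt0 x)%:R)%:E <= r%:E)%E.
  have [y|r' -> ] := @queue_one_step _ _ k_gt0 _ _ lam_gt0 mu_gt0 _ pP h x
    (fun y => (y != progress k_gt0 x)%:R) (ltW h0).
    by case: eqP => /=; rewrite ?lexx ?ler01.
  rewrite lee_fin ler_norml => /andP[_].
  have := ler_wpM2l (ltW h0) (queue_generator_progress x).
  rewrite -/m -/C eq_sym progress_neq /= => g1 g2.
  have e : 4 * C ^+ 2 * h ^+ 2 = m ^+ 2 / (16 * C ^+ 2).
    by rewrite /h; field; rewrite lt0r_neq0.
  have e' : h * m = 2 * (m ^+ 2 / (16 * C ^+ 2)).
    by rewrite /h; field; rewrite lt0r_neq0.
  rewrite /r; move: g1 g2; rewrite e mulrN e'; lra.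
have t00 : 0 <= (j + 0)%:R * h by rewrite mulr_ge0// ltW.
have p0 x y : 0 <= p h x y by apply: (tf_ge0 pP); exact: ltW.
have := ae_not_all_bad (t := fun i => (j + i)%:R * h) mQ QP t00 (ltW h0) tS r0 badr p0 r1.
apply: filterS => w [i]; rewrite negbK addnS => /eqP Qi.
by exists (j + i)%N; rewrite ?leq_addr.
Qed.

Lemma queue_generator_forbidden x :
  queue_generator k_gt0 lam mu (fun y => (forbidden k_gt0 x y)%:R) x = 0.
Proof.
have fx : forbidden k_gt0 x x = false by rewrite /forbidden eqxx.
have fa : forbidden k_gt0 x (next_arrival k_gt0 x) = false.
  by rewrite /forbidden neighboursP arrival_next eqxx andbF.
rewrite /queue_generator fx fa subrr mulr0 add0r; case: ifPn => // x0.
by rewrite /forbidden neighboursP completion_next x0 eqxx orbT andbF subrr mulr0.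
Qed.

(** The generator annihilates the indicator of forbidden targets, so a cell of length [2 ^- n] shows
    a forbidden transition with probability of order [4 ^- n]. There are [K * 2 ^ n] cells, and the
    union bound tends to 0. *)
Lemma ae_not_forbidden : {ae P, forall w, forall K n0 : nat,
  exists2 n, (n0 <= n)%N & forall i, (i < K * 2 ^ n)%N ->
    ~~ forbidden k_gt0 (Q (i%:R / 2 ^+ n) w) (Q (i.+1%:R / 2 ^+ n) w)}.
Proof.
have [p pP QP] := mc_markov mcQ.
pose C := lam + theta.
apply/ae_foralln => K; apply/ae_foralln => n0.
(* A run of length 1, so that [probability_all_bad_le] with [N = 1] bounds a single cell. *)
pose bad n i := [set w | forall j, (j < 1)%N ->
  forbidden k_gt0 (Q ((i + j)%:R / 2 ^+ n) w) (Q ((i + j.+1)%:R / 2 ^+ n) w)].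
pose F n := \big[setU/set0]_(i < K * 2 ^ n) bad n i.
have tS n i j : (i + j.+1)%:R / 2 ^+ n = (i + j)%:R / 2 ^+ n + (2 ^+ n)^-1 :> R.
  by rewrite addnS -natr1 mulrDl mul1r.
have h0 n : 0 <= (2 ^+ n)^-1 :> R by rewrite invr_ge0 exprn_ge0.
have t00 n i : 0 <= (i + 0)%:R / 2 ^+ n :> R by rewrite mulr_ge0.
have mbad n i : measurable (bad n i) by exact: (measurable_all_bad mQ (t00 n i) (h0 n) (tS n i)).
have mF n : measurable (F n) by exact: bigsetU_measurable.
have Pbad n i : (P (bad n i) <= (4 * C ^+ 2 * (2 ^+ n)^-1 ^+ 2)%:E)%E.
  have r0 : 0 <= 4 * C ^+ 2 * (2 ^+ n)^-1 ^+ 2 :> R.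
    by apply: mulr_ge0; [apply: mulr_ge0 => //|]; exact: sqr_ge0.
  have p0 x y : 0 <= p (2 ^+ n)^-1 x y by exact: (tf_ge0 pP).
  have := probability_all_bad_le mQ QP (t00 n i) (h0 n) (tS n i) r0 _ p0 1.
  rewrite expr1; apply => x.
  have [y|r' -> ] := @queue_one_step _ _ k_gt0 _ _ lam_gt0 mu_gt0 _ pP _ x
    (fun y => (forbidden k_gt0 x y)%:R) (h0 n).
    by case: forbidden; rewrite ?lexx ?ler01.
  rewrite queue_generator_forbidden {1}/forbidden eqxx /= mulr0 !addr0 subr0.
  by rewrite lee_fin => /ler_normlW.
have PF n : (P (F n) <= (K%:R * (4 * C ^+ 2) * (2 ^+ n)^-1)%:E)%E.
  apply: le_trans (Boole_inequality _ _) _ => //.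
  apply: (@le_trans _ _ (\sum_(i < K * 2 ^ n) (4 * C ^+ 2 * (2 ^+ n)^-1 ^+ 2)%:E)%E).
    by apply: lee_sum => i _; exact: Pbad.
  rewrite sumEFin lee_fin sumr_const card_ord -[leLHS]mulr_natr natrM natrX.
  rewrite le_eqVlt; apply/orP; left; apply/eqP; field.
  by rewrite expf_neq0// pnatr_eq0.
exists (\bigcap_n F (n0 + n)%N); split.
- exact: bigcapT_measurable.
- apply/eqP; rewrite eq_le measure_ge0 andbT.
  apply: (cvge_to_ge (a := \oo)
      (f := fun n => (K%:R * (4 * C ^+ 2) * 2^-1 ^+ (n + n0))%:E : \bar R)).
    apply: cvg_EFin; first exact: nearW.
    rewrite -[X in _ --> X](mulr0 (K%:R * (4 * C ^+ 2))).
    apply: cvgM; first exact: cvg_cst.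
    rewrite (cvg_shiftn n0 (fun n => 2^-1 ^+ n : R)).
    by apply: cvg_expr; rewrite ger0_norm ?invr_ge0// invf_lt1// ltr1n.
  apply: nearW => n; rewrite exprVn addnC; apply: le_trans (PF _).
  by apply: le_measure; rewrite ?inE//; [exact: bigcapT_measurable|exact: bigcap_inf].
- move=> w /= nP n _; apply: contrapT => Fn; apply: nP; exists (n0 + n)%N.
    exact: leq_addr.
  move=> i iK; apply/negP => fi; apply: Fn; rewrite /F -bigcup_mkord.
  exists i => // j; rewrite ltnS leqn0 => /eqP->.
  by rewrite addn0 addn1.
Qed.

Lemma ae_queue_step_path : {ae P, forall w, exists J y,
  [/\ step_path (queue_path Q w) J y,
      forall i, state_phase k (y i),
      forall i, arrival k (y i) (y i.+1) || phase_completion k (y i) (y i.+1) &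
      forall i0, exists2 i, (i0 <= i)%N & phase_start k (y i) (y i.+1)]}.
Proof.
have [h h0 prog] := ae_progress.
apply: filterS2 (filterI prog ae_not_forbidden)
  (filterI (mc_right_continuous mcQ) (mc_left_limits mcQ)) => w [{}prog nforb] [Qr Ql].
have [t t0|J [y xJy]] := @cadlag_step_path R _ (fun t => Q t w) Qr Ql.
  pose j := Num.bound (t / h).
  have tj : t < j%:R * h.
    by rewrite -ltr_pdivrMr//; apply: archi_boundP; rewrite divr_ge0// ltW.
  have [i ji Qi] := prog j.
  have ti : t < i%:R * h by apply: (lt_le_trans tj); rewrite ler_pM2r// ler_nat.
  have ti1 : t < i.+1%:R * h by apply: (lt_trans ti); rewrite ltr_pM2r// ltr_nat.
  (* The two ends of a cell of progress carry different states, so one of them differs from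
     [Q t w]. *)
  have [Qt|/eqP Qt] := eqVneq (Q (i%:R * h) w) (Q t w); last by exists (i%:R * h).
  exists (i.+1%:R * h) => //; rewrite Qi -Qt; apply/eqP; exact: progress_neq.
have allowed := step_path_allowed xJy nforb.
exists J, (fun i => val (y i)); split => //.
- split; [exact: (step_path0 xJy)|exact: (step_path_lt xJy)|
    exact: (step_path_unbounded xJy)| |].
    by move=> i t it ti; rewrite /queue_path (step_path_val xJy it ti).
  by move=> i /val_inj; exact: (step_path_neq xJy).
- by move=> i; exact: valP.
- exact: (step_path_starts xJy h0 prog allowed).
Qed.

End QueuePaths.

(** * Injectivity of the Laplace transform *)

Section ExponentialIntegral.
Context {R : realType}.
Notation mu := (@lebesgue_measure R).

Let continuous_expN (v : R) : continuous (fun x : R => expR (- (v * x))).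
Proof.
move=> x; apply: continuous_comp; last exact: continuous_expR.
apply: (@continuousN _ R^o); apply: continuousM; first exact: cst_continuous.
exact: cvg_id.
Qed.

Lemma measurable_expN (v : R) (D : set R) :
  measurable_fun D (fun x : R => expR (- (v * x))).
Proof.
apply: measurable_funTS; apply: measurableT_comp => //; exact: measurableT_comp.
Qed.

Lemma integral_expN (a v : R) : 0 < v ->
  (\int[mu]_(x in `[a, +oo[) (expR (- (v * x)))%:E = (expR (- (v * a)) / v)%:E)%E.
Proof.
move=> v0.
have d1 x : (fun x => - expR (- (v * x)))^`()%classic x = v * expR (- (v * x)).
  have -> : (fun x => - expR (- (v * x))) = (fun x => - expR (- v * x)).
    by apply/funext => z; rewrite mulNr.
  rewrite derive1_comp// derive1N// derive1_id mulN1r derive1_comp// derive1E.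
  have /funeqP -> := @derive_expR R.
  by rewrite derive1Ml// derive1_id mulr1 mulrN opprK mulrC mulNr.
have H : (\int[mu]_(x in `[a, +oo[) (v * expR (- (v * x)))%:E = (expR (- (v * a)))%:E)%E.
  rewrite (@ge0_continuous_FTC2y _ _ (fun x => - expR (- (v * x))) _ 0)//.
  - by rewrite EFinN oppeK add0e.
  - by move=> x _; rewrite mulr_ge0 ?expR_ge0// ltW.
  - apply: continuous_subspaceT => x; apply: cvgM; first exact: cvg_cst.
    exact: continuous_expN.
  - rewrite -oppr0; apply: cvgN.
    apply: (@cvg_comp _ _ _ (fun z => v * z) (fun z => expR (- z)) _ (pinfty_nbhs R)).
      exact: gt0_cvgMry.
    exact: cvgr_expR.
  - by apply: cvgN; apply/cvg_at_right_filter; exact: continuous_expN.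
apply/eqP; rewrite EFinM muleC -[eqbLHS]mul1e -(mulVf (lt0r_neq0 v0)) EFinM -muleA.
rewrite -ge0_integralZl//.
- by under eq_integral do rewrite -EFinM; rewrite H.
- by apply/measurable_EFinP; exact: measurable_expN.
- by rewrite lee_fin ltW.
Qed.

Lemma integrable_expN (v : R) : 0 < v ->
  mu.-integrable `[0, +oo[ (EFin \o (fun x => expR (- (v * x)))).
Proof.
move=> v0; apply/integrableP; split.
  by apply/measurable_EFinP; exact: measurable_expN.
under eq_integral do rewrite /= ger0_norm ?expR_ge0//.
by rewrite integral_expN// ltry.
Qed.

End ExponentialIntegral.

Section ExponentialMoments.
Context {R : realType}.
Notation mu := (@lebesgue_measure R).
Notation D := (`[0, +oo[%classic : set R).
Local Open Scope ring_scope.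

Variable f : R -> R.
Hypothesis f_int : mu.-integrable D (EFin \o f).
Hypothesis f_moments : forall n : nat, \int[mu]_(t in D) (expR (- (n%:R * t)) * f t) = 0.

Let mf : measurable_fun D f.
Proof. by apply/measurable_EFinP; exact: measurable_int f_int. Qed.

Let kernel (y : R) (t : R) : R := 1 - (expR (- t) - y) ^+ 2.

Let expN01 t : D t -> 0 <= expR (- t) <= 1.
Proof.
by rewrite /= in_itv/= andbT => t0; rewrite expR_ge0 expR_le1 oppr_le0.
Qed.

Let kernel01 y t : 0 <= y <= 1 -> D t -> 0 <= kernel y t <= 1.
Proof.
move=> /andP[y0 y1] /expN01/andP[z0 z1]; rewrite /kernel subr_ge0 gerBl sqr_ge0 andbT.
rewrite -[leRHS](expr1n _ 2) -[leLHS]real_normK ?num_real// ler_pXn2r ?nnegrE//.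
by rewrite ler_norml; apply/andP; split; lra.
Qed.

Let mkernel y m n : measurable_fun D (fun t => expR (- (m%:R * t)) * kernel y t ^+ n).
Proof.
apply: measurable_funM; first exact: measurable_expN.
apply: measurable_funX; apply: measurable_funB; first exact: measurable_cst.
apply: measurable_funX; apply: measurable_funB; last exact: measurable_cst.
have -> : (fun t : R => expR (- t)) = (fun t => expR (- (1 * t))).
  by apply/funext => t; rewrite mul1r.
exact: measurable_expN.
Qed.

Let int_kernel y m n : 0 <= y <= 1 -> mu.-integrable D
  (EFin \o (fun t => expR (- (m%:R * t)) * kernel y t ^+ n * f t)).
Proof.
move=> y01; apply: (le_integrable _ _ _ f_int) => //.
  by apply/measurable_EFinP; apply: measurable_funM; [exact: mkernel|exact: mf].
move=> t Dt; rewrite /= lee_fin normrM ger0_norm; last first.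
  have /andP[k0 k1] := kernel01 y01 Dt.
  by rewrite mulr_ge0 ?expR_ge0// exprn_ge0.
rewrite -[leRHS]mul1r ler_wpM2r//.
have /andP[k0 k1] := kernel01 y01 Dt.
apply: mulr_ile1; rewrite ?expR_ge0 ?(exprn_ge0 _ k0) ?exprn_ile1//.
by move: Dt; rewrite /= in_itv/= andbT => t0; rewrite expR_le1 oppr_le0 mulr_ge0.
Qed.

(** The kernel is the polynomial [(1 - y ^+ 2) + 2 * y * z - z ^+ 2] in [z = expR (- t)], so
    multiplying by it only combines moments of orders [m], [m.+1] and [m.+2]. *)
Let kernel_moments y n m : 0 <= y <= 1 ->
  \int[mu]_(t in D) (expR (- (m%:R * t)) * kernel y t ^+ n * f t) = 0.
Proof.
move=> y01; elim: n m => [|n IHn] m.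
  by rewrite -[RHS](f_moments m); apply: eq_Rintegral => t _; rewrite expr0 mulr1.
pose g m t := expR (- (m%:R * t)) * kernel y t ^+ n * f t.
have gi m' : mu.-integrable D (EFin \o g m') by exact: int_kernel.
have gZ c m' : mu.-integrable D (EFin \o (fun t => c * g m' t)).
  exact: (@integrableZl _ _ _ mu D (measurable_itv _) c (EFin \o g m')).
transitivity (\int[mu]_(t in D)
    ((1 - y ^+ 2) * g m t + (2 * y * g m.+1 t - g m.+2 t))).
  apply: eq_Rintegral => t _; rewrite /g exprS /kernel.
  have -> : - (m.+1%:R * t) = - (m%:R * t) + - t by rewrite -natr1; ring.
  have -> : - (m.+2%:R * t) = - (m%:R * t) + - t + - t by rewrite -!natr1; ring.
  by rewrite !expRD; ring.
rewrite RintegralD//; last first.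
  exact: (@integrableB _ _ _ mu D (measurable_itv _) _ _ (gZ (2 * y) m.+1) (gi m.+2)).
rewrite RintegralB// !RintegralZl// !IHn.
by rewrite !mulr0 subrr addr0.
Qed.

(* The kernels [kernel y ^+ n] concentrate at the point where [expR (- t) = y]
   as [n] grows; choosing that point just right of [t0] makes [f t0 > 0]
   incompatible with vanishing moments. *)
Lemma exp_moments_le0 t0 : 0 <= t0 -> f t @[t --> t0^'+] --> f t0 -> f t0 <= 0.
Proof.
move=> t00 ft0; rewrite leNgt; apply/negP => f0.
pose c := f t0 / 2; have c0 : 0 < c by rewrite divr_gt0.
have cf : c < f t0 by rewrite /c; lra.
have [dl dl0 fdl] : exists2 dl, 0 < dl & forall u, t0 <= u < t0 + dl -> c < f u.
  have [e e0 He] := nbhs_right_itv (cvgr_gt _ ft0 _ cf).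
  exists e => // u /andP[]; rewrite le_eqVlt => /orP[/eqP<- //|tu ut].
  by apply: He; rewrite tu.
pose z t : R := expR (- t).
have zlt s t : (z s < z t) = (t < s) by rewrite ltr_expR ltrN2.
have zle s t : (z s <= z t) = (t <= s) by rewrite ler_expR lerN2.
(* The peak is put inside the window where [f > c], since only right continuity at [t0] is known. *)
pose t1 := t0 + dl / 2; pose y := z t1.
have t01 : t0 < t1 by rewrite ltrDl divr_gt0.
have t1d : t1 < t0 + dl by rewrite ltrD2l; lra.
pose a1 := z t0 - y; pose a2 := y - z (t0 + dl).
have a10 : 0 < a1 by rewrite subr_gt0 zlt.
have a20 : 0 < a2 by rewrite subr_gt0 zlt.
(* In the variable [expR (- t)], [eta] is the distance from the peak to the ends of the window. *)
pose eta := Num.min a1 a2.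
have eta0 : 0 < eta by rewrite lt_min a10.
have [eta1 eta2] : eta <= a1 /\ eta <= a2 by rewrite !ge_min !lexx orbT.
have zd0 : 0 < z (t0 + dl) by exact: expR_gt0.
have y2 : 0 < y - eta / 2 by move: eta2; rewrite /a2; lra.
pose t2 := - ln (y - eta / 2).
have zt2 : z t2 = y - eta / 2 by rewrite /z /t2 opprK lnK// posrE.
have t12 : t1 < t2 by rewrite -zlt zt2 -/y; lra.
have t2d : t2 < t0 + dl by rewrite -zlt zt2; move: eta2; rewrite /a2; lra.
have y01 : 0 <= y <= 1.
  by rewrite /y /z expR_ge0 expR_le1 oppr_le0 ltW// (le_lt_trans t00).
have eta_le1 : eta <= 1 by have /andP[_] := y01; move: eta2; rewrite /a2; lra.
(* The kernel is at least [A] on [[t1, t2]], within [eta / 2] of the peak, and at most [B < A]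
   outside the window. *)
pose A := 1 - eta ^+ 2 / 4; pose B := 1 - eta ^+ 2.
have e2 : eta ^+ 2 <= 1 by rewrite expr_le1// ltW.
have e20 : 0 < eta ^+ 2 by rewrite exprn_gt0.
have A0 : 0 < A by rewrite /A; lra.
have B0 : 0 <= B by rewrite subr_ge0.
pose M := \int[mu]_(t in D) `|f t|.
pose I : set R := `[t1, t2]%classic.
have mD : measurable D by exact: measurable_itv.
have mI : measurable I by exact: measurable_itv.
have iabs : mu.-integrable D (EFin \o (fun t => `|f t|)) by exact: integrable_norm.
have iI : mu.-integrable D (EFin \o (\1_I : R -> R)).
  apply: (@integrableS _ _ _ mu setT) => //.
  by apply: integrable_indic_itv.
have intI : \int[mu]_(t in D) (\1_I t : R) = t2 - t1.
  rewrite /Rintegral integral_indic//.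
  have -> : I `&` D = I.
    apply/setIidPl => t; rewrite /I /= !in_itv/= andbT => /andP[t1t _].
    by rewrite (le_trans _ t1t)// (le_trans t00)// ltW.
  have muI : mu I = (t2 - t1)%:E by rewrite /I lebesgue_measure_itv/= lte_fin t12.
  exact: (congr1 fine muI).
(* The vanishing moment splits into three parts: at least the left side on [[t1, t2]], nonnegative
   on the rest of the window, and at least minus the right side outside. Dividing by [A ^+ n] yields
   the contradiction. *)
have key n : c * A ^+ n * (t2 - t1) <= B ^+ n * M.
  rewrite -subr_le0 -[leRHS](kernel_moments n 0 y01) -intI -!RintegralZl//.
  have i1 := @integrableZl _ _ _ mu D mD (c * A ^+ n) _ iI.
  have i2 := @integrableZl _ _ _ mu D mD (B ^+ n) _ iabs.
  rewrite -RintegralB//; apply: le_Rintegral => //.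
  - exact: (@integrableB _ _ _ mu D mD _ _ i1 i2).
  - exact: int_kernel.
  move=> t Dt; rewrite mul0r oppr0 expR0 mul1r.
  have /andP[k0 k1] := kernel01 y01 Dt.
  have kn0 : 0 <= kernel y t ^+ n by rewrite exprn_ge0.
  have [tin|tout] := boolP (t0 <= t < t0 + dl).
    have ft := fdl _ tin.
    have f0' : 0 <= f t by exact/ltW/(lt_trans c0).
    have rhs0 : 0 <= B ^+ n * `|f t| by rewrite mulr_ge0// exprn_ge0.
    rewrite indicE; have [|_] := boolP (t \in I); last first.
      by rewrite mulr0 sub0r (@le_trans _ _ 0)// ?oppr_le0// mulr_ge0.
    rewrite inE /I /= in_itv/= => /andP[t1t tt2].
    rewrite mulr1; apply: (@le_trans _ _ (c * A ^+ n)); first by rewrite gerBl.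
    rewrite mulrC; apply: ler_pM; [exact/exprn_ge0/ltW|exact: ltW| |exact: ltW].
    apply: lerXn2r; [by rewrite nnegrE ltW|by rewrite nnegrE|].
    rewrite /A /kernel lerD2l lerN2.
    have zt_le : z t <= y by rewrite zle.
    have zt_ge : y - eta / 2 <= z t by rewrite -zt2 zle.
    have -> : eta ^+ 2 / 4 = (eta / 2) ^+ 2 by field.
    by rewrite -[leLHS]sqrrN lerXn2r ?nnegrE -/(z t); lra.
  have nI : t \notin I.
    apply: contra tout; rewrite inE /I /= in_itv/= => /andP[t1t tt2].
    by rewrite (le_trans (ltW t01) t1t) (le_lt_trans tt2).
  rewrite indicE (negPf nI) mulr0 sub0r.
  have kB : kernel y t <= B.
    rewrite /kernel lerD2l lerN2.
    move: tout; rewrite negb_and -ltNge -leNgt => /orP[tt0|tt0].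
      have : z t0 < z t by rewrite zlt.
      by move=> zz; apply: lerXn2r; rewrite ?nnegrE -/(z t); move: eta1; rewrite /a1; lra.
    have zz : z t <= z (t0 + dl) by rewrite zle.
    by rewrite -[leRHS]sqrrN; apply: lerXn2r; rewrite ?nnegrE -/(z t);
      move: eta2; rewrite /a2; lra.
  have : `|kernel y t ^+ n * f t| <= B ^+ n * `|f t|.
    rewrite normrM ger0_norm//; apply: ler_wpM2r => //.
    by apply: lerXn2r; rewrite ?nnegrE.
  by rewrite ler_norml => /andP[].
have rho1 : `|B / A| < 1.
  rewrite ger0_norm; last by rewrite divr_ge0// ltW.
  by rewrite ltr_pdivrMr// mul1r /A /B; lra.
suff : c * (t2 - t1) <= 0 by rewrite leNgt mulr_gt0// subr_gt0.
have lim : (B / A) ^+ n * M @[n --> \oo] --> 0 * M.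
  by apply: cvgM; [exact: cvg_expr|exact: cvg_cst].
rewrite mul0r in lim; apply: (cvgr_to_ge lim); apply: nearW => n.
rewrite expr_div_n [leRHS]mulrAC ler_pdivlMr ?exprn_gt0//.
by apply: le_trans (key n); rewrite mulrAC.
Qed.

End ExponentialMoments.

Section LaplaceUniqueness.
Context {R : realType}.
Notation mu := (@lebesgue_measure R).
Notation D := (`[0, +oo[%classic : set R).

Lemma exp_moments_eq0 (f : R -> R) : mu.-integrable D (EFin \o f) ->
  (forall n : nat, \int[mu]_(t in D) (expR (- (n%:R * t)) * f t) = 0) ->
  forall t0, 0 <= t0 -> f t @[t --> t0^'+] --> f t0 -> f t0 = 0.
Proof.
move=> fi fm t0 t00 ft0; apply/eqP; rewrite eq_le (exp_moments_le0 fi fm)//=.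
have mD : measurable D by exact: measurable_itv.
have fiN : mu.-integrable D (EFin \o (fun t => - f t)).
  by have := @integrableN _ _ _ mu D _ fi.
rewrite -oppr_le0; apply: (exp_moments_le0 fiN) => // [n|]; last exact: cvgN.
have bi : mu.-integrable D (EFin \o (fun t => expR (- (n%:R * t)) * f t)).
  apply: (le_integrable _ _ _ fi) => //.
    apply/measurable_EFinP; apply: measurable_funM; first exact: measurable_expN.
    by apply/measurable_EFinP; exact: measurable_int fi.
  move=> t; rewrite /= in_itv/= andbT => t0'.
  rewrite lee_fin normrM -[leRHS]mul1r ler_wpM2r//.
  by rewrite ger0_norm ?expR_ge0// expR_le1 oppr_le0 mulr_ge0.
transitivity (\int[mu]_(t in D) (- 1 * (expR (- (n%:R * t)) * f t))).
  by apply: eq_Rintegral => t _; rewrite mulN1r mulrN.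
by rewrite RintegralZl// fm mulr0.
Qed.

(** A form of Lerch's theorem. Tilting [f - g] by [expR (- (v0 * t))] with [v0 = c + 1] makes it
    integrable, and its exponential moments of integer order are differences of the two transforms
    at [v0 + n]. Right continuity gives equality at each point. *)
Lemma laplace_inj (f g : R -> R) (M c : R) : 0 <= c ->
  measurable_fun D f -> measurable_fun D g ->
  (forall t, 0 <= t -> `|f t| <= M * expR (c * t)) ->
  (forall t, 0 <= t -> `|g t| <= M * expR (c * t)) ->
  (forall v, c < v -> \int[mu]_(t in D) (expR (- (v * t)) * f t) =
                      \int[mu]_(t in D) (expR (- (v * t)) * g t)) ->
  forall t0, 0 <= t0 -> f t @[t --> t0^'+] --> f t0 -> g t @[t --> t0^'+] --> g t0 ->
  f t0 = g t0.
Proof.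
move=> c0 mf mg fM gM fg t0 t00 ft0 gt0.
have mD : measurable D by exact: measurable_itv.
have int (u : R -> R) v : measurable_fun D u ->
    (forall t, 0 <= t -> `|u t| <= M * expR (c * t)) -> c < v ->
    mu.-integrable D (EFin \o (fun t => expR (- (v * t)) * u t)).
  move=> um uM cv; have vc : 0 < v - c by rewrite subr_gt0.
  have ME := @integrableZl _ _ _ mu D mD M _ (integrable_expN vc).
  apply: (le_integrable _ _ _ ME) => //.
    by apply/measurable_EFinP; apply: measurable_funM => //; exact: measurable_expN.
  move=> t; rewrite /= in_itv/= andbT => t0'.
  rewrite lee_fin normrM ger0_norm ?expR_ge0//.
  apply: le_trans (ler_norm _); rewrite mulrC.
  apply: le_trans (ler_wpM2r (expR_ge0 _) (uM t t0')) _.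
  by rewrite -mulrA -expRD mulrBl opprB.
pose v0 := c + 1; have cv0 : c < v0 by rewrite ltrDl.
pose h t := expR (- (v0 * t)) * (f t - g t).
have hE t : h t = expR (- (v0 * t)) * f t - expR (- (v0 * t)) * g t.
  by rewrite /h mulrBr.
have hi : mu.-integrable D (EFin \o h).
  rewrite (_ : EFin \o h = EFin \o (fun t => expR (- (v0 * t)) * f t - expR (- (v0 * t)) * g t)).
    exact: (@integrableB _ _ _ mu D mD _ _ (int f v0 mf fM cv0) (int g v0 mg gM cv0)).
  by apply/funext => t /=; rewrite hE.
have hm (n : nat) : \int[mu]_(t in D) (expR (- (n%:R * t)) * h t) = 0.
  have cvn : c < v0 + n%:R by rewrite ltr_wpDr.
  transitivity (\int[mu]_(t in D)
      (expR (- ((v0 + n%:R) * t)) * f t - expR (- ((v0 + n%:R) * t)) * g t)).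
    apply: eq_Rintegral => t _; rewrite hE mulrBr !mulrA -!expRD.
    by rewrite -!opprD -!mulrDl ![n%:R + _]addrC.
  rewrite RintegralB//; [|exact: int|exact: int].
  by rewrite fg// subrr.
have ht0 : h t @[t --> t0^'+] --> h t0.
  apply: cvgM; last exact: cvgB.
  apply: cvg_at_right_filter; apply: continuous_comp; last exact: continuous_expR.
  by apply: cvgN; apply: cvgM; [exact: cvg_cst|exact: cvg_id].
have /eqP := exp_moments_eq0 hi hm t00 ht0.
by rewrite /h mulf_eq0 gt_eqF ?expR_gt0//= subr_eq0 => /eqP.
Qed.

End LaplaceUniqueness.

(** * Laplace transforms of weighted distribution functions *)

Section DistributionLaplace.
Context {R : realType} {d : measure_display} {T : measurableType d}.
Variable P : probability T R.
Notation mu := (@lebesgue_measure R).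
Notation D := (`[0, +oo[%classic : set R).

Definition leR (a b : R) : R := (a <= b)%R%:R.

Section Weighted.
Variables (W X : T -> R) (C : R).
Hypotheses (mW : measurable_fun setT W) (mX : measurable_fun setT X).
Hypotheses (W_ge0 : forall w, 0 <= W w) (X_ge0 : forall w, 0 <= X w).
Hypothesis W_int : (\int[P]_w (W w)%:E = C%:E)%E.

(** The distribution function of [X] under the measure of density [W]. Working with functions of [t]
    allows injectivity of the transform to be used for functions only, without densities. *)
Definition weighted_cdf (t : R) : \bar R := (\int[P]_(w in [set w | (X w <= t)%R]) (W w)%:E)%E.

Let msub t : measurable [set w | X w <= t].
Proof. exact: measurable_sublevel. Qed.

Let weighted_cdfE t :
  (weighted_cdf t = \int[P]_w (W w * leR (X w) t)%:E)%E.
Proof.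
rewrite /weighted_cdf integral_mkcond; apply: eq_integral => w _.
rewrite patchE /leR; case: ifPn => [/set_mem/= ->|]; first by rewrite mulr1.
by rewrite notin_setE /= => /negP/negPf->; rewrite mulr0.
Qed.

Let mjoint v : measurable_fun [set: R * T]
  (fun z => (expR (- (v * z.1)) * (W z.2 * leR (X z.2) z.1))%:E).
Proof.
apply/measurable_EFinP; apply: measurable_funM.
  exact: (measurable_exp_scale v measurable_fst).
apply: measurable_funM; first exact: measurableT_comp.
rewrite (_ : (fun z : R * T => leR (X z.2) z.1) = \1_[set z : R * T | X z.2 <= z.1]).
  apply: measurable_indic; rewrite -[X in measurable X]setTI.
  by apply: measurable_fun_le => //; exact: measurableT_comp.
apply/funext => z; rewrite indicE /leR; congr (nat_of_bool _)%:R.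
by apply/idP/idP => [zX|/set_mem//]; rewrite inE.
Qed.

Let joint_ge0 v z : (0 <= (expR (- (v * z.1)) * (W z.2 * leR (X z.2) z.1))%:E)%E.
Proof. by rewrite lee_fin !mulr_ge0// expR_ge0. Qed.

Lemma weighted_cdf_ge0 t : (0 <= weighted_cdf t)%E.
Proof. by apply: integral_ge0 => w _; rewrite lee_fin. Qed.

Lemma weighted_cdf_le t : (weighted_cdf t <= C%:E)%E.
Proof.
rewrite -W_int; apply: ge0_subset_integral => //.
  exact/measurable_EFinP.
by move=> w _; rewrite lee_fin.
Qed.

Lemma weighted_cdf_fin_num t : weighted_cdf t \is a fin_num.
Proof.
rewrite ge0_fin_numE ?weighted_cdf_ge0//.
by apply: le_lt_trans (weighted_cdf_le t) _; rewrite ltry.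
Qed.

Lemma measurable_weighted_cdf : measurable_fun setT weighted_cdf.
Proof.
have := measurable_fun_fubini_tonelli_F (m2 := P) _ (mjoint 0) (joint_ge0 0).
apply: eq_measurable_fun => t _; rewrite /fubini_F weighted_cdfE.
by apply: eq_integral => w _; rewrite mul0r oppr0 expR0 mul1r.
Qed.

(** By Tonelli, the exponential is integrated over [t >= X w], a half-line contained in the domain
    because [X] is nonnegative. *)
Lemma weighted_cdf_laplace v : 0 < v ->
  (\int[mu]_(t in D) ((expR (- (v * t)))%:E * weighted_cdf t) =
   (v^-1)%:E * \int[P]_w (W w * expR (- (v * X w)))%:E)%E.
Proof.
move=> v0.
have mWT : measurable_fun setT (fun w => (W w * expR (- (v * X w)))%:E).
  apply/measurable_EFinP; apply: measurable_funM => //.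
  exact: measurable_exp_scale.
transitivity (\int[mu]_t \int[P]_w
    (expR (- (v * t)) * (W w * leR (X w) t))%:E)%E.
  rewrite integral_mkcond; apply: eq_integral => t _.
  rewrite patchE; case: ifPn => [_|tD].
    rewrite weighted_cdfE -ge0_integralZl//.
    - apply/measurable_EFinP; apply: measurable_funM => //.
      rewrite (_ : (fun w => leR (X w) t) = \1_[set w | X w <= t]).
        exact: measurable_indic.
      apply/funext => w; rewrite indicE /leR; congr (nat_of_bool _)%:R.
      by apply/idP/idP => [zX|/set_mem//]; rewrite inE.
    - by move=> w _; rewrite lee_fin mulr_ge0.
  rewrite integral0_eq// => w _.
  rewrite /leR; suff -> : (X w <= t) = false by rewrite !mulr0.
  apply: contraNF tD => Xt; rewrite inE /= in_itv/= andbT.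
  exact: le_trans Xt.
rewrite (fubini_tonelli (m1 := mu) (m2 := P) (fun z : R * T =>
  (expR (- (v * z.1)) * (W z.2 * leR (X z.2) z.1))%:E) (mjoint v) (joint_ge0 v)).
rewrite -ge0_integralZl//; last 2 first.
- by move=> w _; rewrite lee_fin mulr_ge0// expR_ge0.
- by rewrite lee_fin invr_ge0 ltW.
apply: eq_integral => w _ /=.
transitivity (\int[mu]_(t in `[X w, +oo[) ((W w)%:E * (expR (- (v * t)))%:E))%E.
  rewrite [RHS]integral_mkcond; apply: eq_integral => t _.
  have tX : (t \in (`[X w, +oo[%classic : set R)) = (X w <= t).
    apply/idP/idP => [/set_mem|Xt]; first by rewrite /= in_itv/= andbT.
    by apply/mem_set; rewrite /= in_itv/= andbT.
  rewrite patchE tX /leR; case: ifP => _; last by rewrite !mulr0.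
  by rewrite mulr1 -EFinM mulrC.
rewrite ge0_integralZl//.
- by rewrite integral_expN// -!EFinM; congr _%:E; ring.
- by apply/measurable_EFinP; exact: measurable_expN.
- by rewrite lee_fin.
Qed.

Lemma weighted_cdf_right_continuous t0 :
  fine (weighted_cdf t) @[t --> t0^'+] --> fine (weighted_cdf t0).
Proof.
apply/cvg_at_rightP => u [ut0 ucvg].
have H : weighted_cdf (u n) @[n --> \oo] --> weighted_cdf t0.
  rewrite weighted_cdfE.
  have -> : (fun n => weighted_cdf (u n)) =
     (fun n => \int[P]_w (W w * leR (X w) (u n))%:E)%E.
    by apply/funext => n; rewrite weighted_cdfE.
  have mt t : measurable_fun setT (fun w => (W w * leR (X w) t)%:E).
    apply/measurable_EFinP; apply: measurable_funM => //.
    rewrite (_ : (fun w => leR (X w) t) = \1_[set w | X w <= t]).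
      exact: measurable_indic.
    apply/funext => w; rewrite indicE /leR; congr (nat_of_bool _)%:R.
    by apply/idP/idP => [zX|/set_mem//]; rewrite inE.
  have Wi : P.-integrable setT (EFin \o W).
    apply/integrableP; split; first exact/measurable_EFinP.
    under eq_integral do rewrite /= ger0_norm//.
    by rewrite W_int ltry.
  have := @dominated_convergence _ _ _ P setT measurableT
    (fun n w => (W w * leR (X w) (u n))%:E) (fun w => (W w * leR (X w) t0)%:E)
    (EFin \o W) (fun n => mt (u n)) (mt t0) _ Wi _.
  case=> //.
  - apply: aeW => w _; apply: cvg_EFin; first exact: nearW.
    apply: cvgM; first exact: cvg_cst.
    apply: cvg_near_cst; have [Xt|tX] := leP (X w) t0.
      by apply: nearW => n; rewrite /leR (le_trans Xt (ltW (ut0 n))) Xt.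
    have : \forall n \near \oo, u n < X w by apply: (cvgr_lt t0).
    by apply: filterS => n uX; rewrite /leR !leNgt uX tX.
  - apply: aeW => w n _; rewrite /= lee_fin ger0_norm; last by rewrite mulr_ge0.
    by rewrite ler_piMr// /leR; case: (X w <= u n).
have := H; rewrite -[weighted_cdf t0]fineK ?weighted_cdf_fin_num//.
by move/fine_cvgP => [].
Qed.

Lemma weighted_cdf_norm t : `|fine (weighted_cdf t)| <= C * expR (0 * t).
Proof.
rewrite mul0r expR0 mulr1 ger0_norm ?fine_ge0 ?weighted_cdf_ge0//.
by rewrite -lee_fin fineK ?weighted_cdf_fin_num// weighted_cdf_le.
Qed.

Lemma measurable_fine_weighted_cdf : measurable_fun D (fun t => fine (weighted_cdf t)).
Proof.
by apply: measurable_funTS; apply: measurableT_comp => //; exact: measurable_weighted_cdf.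
Qed.

Lemma weighted_cdf_laplace_fine v : 0 < v ->
  \int[mu]_(t in D) (expR (- (v * t)) * fine (weighted_cdf t)) =
  v^-1 * fine (\int[P]_w (W w * expR (- (v * X w)))%:E).
Proof.
move=> v0; rewrite /Rintegral.
have fle : (\int[P]_w (W w * expR (- (v * X w)))%:E \is a fin_num)%E.
  rewrite ge0_fin_numE; last by apply: integral_ge0 => w _; rewrite lee_fin mulr_ge0// expR_ge0.
  apply: (@le_lt_trans _ _ C%:E); last by rewrite ltry.
  rewrite -W_int; apply: ge0_le_integral => //.
  - by move=> w _; rewrite lee_fin mulr_ge0// expR_ge0.
  - by apply/measurable_EFinP; apply: measurable_funM => //; exact: measurable_exp_scale.
  - exact/measurable_EFinP.
  - move=> w _; rewrite lee_fin ler_piMr// expR_le1 oppr_le0 mulr_ge0// ltW//.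
rewrite -[v^-1]/(fine (v^-1)%:E) -fineM// -weighted_cdf_laplace//.
congr fine; apply: eq_integral => t _.
by rewrite EFinM fineK ?weighted_cdf_fin_num.
Qed.

End Weighted.

(** The distribution functions of [X] under the density [W] and under [c] times [P] have equal
    transforms, hence coincide; the identity then spreads from half-lines to Borel sets by the
    Dynkin argument. The case [v = 0] identifies [c] as the integral of [W]. *)
Lemma laplace_indep (W X : T -> R) (c : R) :
  measurable_fun setT W -> measurable_fun setT X ->
  (forall w, 0 <= W w) -> (forall w, 0 <= X w) ->
  (forall v, 0 <= v -> (\int[P]_w (W w * expR (- (v * X w)))%:E =
                        c%:E * \int[P]_w (expR (- (v * X w)))%:E)%E) ->
  forall B, measurable B ->
    (\int[P]_(w in X @^-1` B) (W w)%:E = c%:E * P (X @^-1` B))%E.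
Proof.
move=> mW mX W0 X0 H.
have int1 : (\int[P]_w ((fun _ : T => 1 : R) w)%:E = 1%:E)%E.
  by rewrite integral_cst// mul1e; exact: probability_setT.
have cE : (\int[P]_w (W w)%:E = c%:E)%E.
  have := H 0 (lexx 0); under eq_integral do rewrite mul0r oppr0 expR0 mulr1.
  move=> ->; under eq_integral do rewrite mul0r oppr0 expR0.
  by rewrite int1 mule1.
have m1 : measurable_fun [set: T] (fun=> 1 : R) by exact: measurable_cst.
have ge1 (w : T) : 0 <= (fun _ : T => 1 : R) w by [].
have c0 : 0 <= c.
  by rewrite -lee_fin -cE; apply: integral_ge0 => w _; rewrite lee_fin.
have cdf_eq t : (weighted_cdf W X t = c%:E * P [set w | (X w <= t)%R])%E.
  have P1 : weighted_cdf (fun=> 1) X t = P [set w | (X w <= t)%R].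
    by rewrite /weighted_cdf integral_cst ?mul1e//; exact: measurable_sublevel.
  have [t0|t0] := ltP t 0.
    have E0 : [set w | (X w <= t)%R] = set0.
      apply/seteqP; split => // w /= Xt.
      by have := le_lt_trans (le_trans (X0 w) Xt) t0; rewrite ltxx.
    by rewrite /weighted_cdf E0 integral_set0 measure0 mule0.
  have f1 := weighted_cdf_fin_num mW mX W0 cE.
  have f2 := weighted_cdf_fin_num m1 mX ge1 int1.
  rewrite -P1 -[LHS]fineK// -[weighted_cdf (fun=> 1) X t]fineK// -EFinM; congr _%:E.
  pose g s := c * fine (weighted_cdf (fun=> 1) X s).
  apply: (@laplace_inj _ (fun s => fine (weighted_cdf W X s)) g c 0 _ _ _ _ _ _ t t0) => //.
  - exact: measurable_fine_weighted_cdf.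
  - by apply: measurable_funM; [exact: measurable_cst|exact: measurable_fine_weighted_cdf].
  - by move=> s _; exact: weighted_cdf_norm.
  - move=> s _; rewrite /g normrM (ger0_norm c0) ler_wpM2l//.
    by rewrite -[leRHS]mul1r; exact: weighted_cdf_norm.
  - move=> v v0; rewrite (weighted_cdf_laplace_fine mW mX W0 X0 cE v0) (H _ (ltW v0)).
    have L1 := weighted_cdf_laplace_fine m1 mX ge1 X0 int1 v0.
    transitivity (c * \int[mu]_(s in D) (expR (- (v * s)) * fine (weighted_cdf (fun=> 1) X s))).
      rewrite L1 mulrCA; congr (_ * _).
      have fle : (\int[P]_w (expR (- (v * X w)))%:E \is a fin_num)%E.
        rewrite ge0_fin_numE; last by apply: integral_ge0 => w _; rewrite lee_fin expR_ge0.
        apply: (@le_lt_trans _ _ 1%:E); last by rewrite ltry.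
        rewrite -int1; apply: ge0_le_integral => //.
        - by apply/measurable_EFinP; exact: measurable_exp_scale.
        - by move=> w _; rewrite lee_fin expR_le1 oppr_le0 mulr_ge0// ltW.
      under [in RHS]eq_integral do rewrite mul1r.
      by rewrite fineM.
    rewrite -RintegralZl//; first by apply: eq_Rintegral => s _; rewrite mulrCA.
    apply: (le_integrable _ _ _ (integrable_expN v0)) => //.
      apply/measurable_EFinP; apply: measurable_funM; first exact: measurable_expN.
      exact: measurable_fine_weighted_cdf.
    move=> s _; rewrite /= lee_fin normrM ler_piMr//.
    apply: le_trans (weighted_cdf_norm m1 mX ge1 int1 s) _.
    by rewrite mul0r expR0 mul1r.
  - exact: (weighted_cdf_right_continuous mW mX W0 cE).
  - by apply: cvgM; [exact: cvg_cst|exact: (weighted_cdf_right_continuous m1 mX ge1 int1)].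
have mXB B : measurable B -> measurable (X @^-1` B) by exact: measurable_preimageT.
have mWE : measurable_fun [set: T] (EFin \o W) by exact/measurable_EFinP.
have WE0 w : [set: T] w -> (0 <= (W w)%:E)%E by rewrite lee_fin.
have setC_eq (B : set R) : measurable B ->
    (\int[P]_(w in X @^-1` B) (W w)%:E = c%:E * P (X @^-1` B))%E ->
    (\int[P]_(w in X @^-1` ~` B) (W w)%:E = c%:E * P (X @^-1` ~` B))%E.
  move=> mB HB; have mXB' := mXB _ mB; rewrite preimage_setC.
  have Wfin : (\int[P]_(w in X @^-1` B) (W w)%:E \is a fin_num)%E.
    by rewrite HB fin_numM// fin_num_measure.
  have PC : (P (~` (X @^-1` B)) = 1 - P (X @^-1` B))%E by rewrite probability_setC.
  have : (\int[P]_w (W w)%:E = \int[P]_(w in X @^-1` B) (W w)%:E +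
      \int[P]_(w in ~` (X @^-1` B)) (W w)%:E)%E.
    rewrite -ge0_integral_setU ?setUv//; first exact: measurableC.
    exact/disj_setPCl.
  rewrite cE PC muleBr// ?fin_num_measure// mule1 -HB => ->.
  by rewrite addeAC subee// add0e.
have GE : @measurable _ R = <<s [set A | exists x : R, A = `]x, +oo[%classic] >>.
  exact: RGenOInfty.measurableE.
move=> B mB; have : <<s [set A | exists x : R, A = `]x, +oo[%classic] >> B by rewrite -GE.
apply: (@dynkin_induction _ R _ (fun B =>
  (\int[P]_(w in X @^-1` B) (W w)%:E = c%:E * P (X @^-1` B))%E) GE).
- move=> _ _ [a ->] [b ->]; exists (Num.max a b); apply/seteqP; split => x /=;
    by rewrite !in_itv/= !andbT gt_max => /andP.
- by rewrite preimage_setT cE; rewrite [P _]probability_setT mule1.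
- move=> _ [x ->].
  have -> : `]x, +oo[%classic = ~` `]-oo, x]%classic :> set R by rewrite setCitvl.
  by apply: setC_eq => //; rewrite -cdf_eq /weighted_cdf; congr (integral _ _ _);
    apply/seteqP; split => w /=; rewrite in_itv.
- exact: setC_eq.
- move=> F mF tF HF; rewrite preimage_bigcup.
  have mXF n : measurable (X @^-1` F n) by exact: mXB.
  have tXF : trivIset [set: nat] (fun n => X @^-1` F n).
    apply/trivIsetP => i j _ _ ij; rewrite -preimage_setI.
    by move/trivIsetP : tF => -> //; rewrite preimage_set0.
  rewrite ge0_integral_bigcup//; last 2 first.
  - by apply: measurable_funTS.
  - by move=> w _; rewrite lee_fin.
  rewrite measure_bigcup// -nneseriesZl//.
  rewrite [RHS]eseries_mkcond; apply: eq_eseriesr => n _.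
  by rewrite mem_setT; exact: HF.
Qed.

End DistributionLaplace.

(** * The Mittag-Leffler law *)

Section GammaIntegral.
Context {R : realType}.
Notation mu := (@lebesgue_measure R).
Implicit Types (z v A t : R).

Lemma measurable_powR_expN z v (D : set R) :
  measurable_fun D (fun t => t `^ z * expR (- (v * t))).
Proof.
apply: measurable_funM; last exact: measurable_expN.
by apply: measurable_funTS; exact: measurable_powR.
Qed.

Lemma powR_le_expR z : 0 <= z ->
  exists2 C, 0 <= C & forall t, 0 <= t -> t `^ z <= C * expR (t / 2).
Proof.
rewrite le_eqVlt => /orP[/eqP<-|z0].
  exists 1 => // t t0; rewrite powRr0 mul1r -[leLHS]expR0 ler_expR divr_ge0//.
exists (expR (z * ln (2 * z))) => [|t]; first exact: expR_ge0.
rewrite le_eqVlt => /orP[/eqP<-|t0].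
  by rewrite powR0 ?gt_eqF// mulr_ge0 ?expR_ge0.
rewrite /powR gt_eqF// -expRD ler_expR.
have z2 : 0 < 2 * z by rewrite mulr_gt0.
(* From [ln u < u] at [u = t / (2 * z)], multiplied by [z]; the constant [C] is [2 * z] to the power
   [z]. *)
have := ln_sublinear (divr_gt0 t0 z2).
rewrite ln_div ?posrE// => /ltW/(ler_wpM2l (ltW z0)).
have -> : z * (t / (2 * z)) = t / 2 by field; rewrite gt_eqF.
lra.
Qed.

Let gammaE z : Gamma (z + 1) = \int[mu]_(x in `[0%R, +oo[) (x `^ z * expR (- (1 * x))).
Proof.
rewrite /Gamma addrK /Rintegral; congr fine.
have E : (fun t => t `^ z * expR (- t)) = (fun t => t `^ z * expR (- (1 * t))).
  by apply/funext => t; rewrite mul1r.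
rewrite integral_itv_obnd_cbnd; first by apply: eq_integral => t _; rewrite mul1r.
by apply/measurable_EFinP; rewrite E; exact: measurable_powR_expN.
Qed.

Lemma integrable_powR_expN z : 0 <= z ->
  mu.-integrable `[0%R, +oo[ (EFin \o (fun t => t `^ z * expR (- (1 * t)))).
Proof.
move=> z0; have [C C0 HC] := powR_le_expR z0.
have half0 : 0 < 2^-1 :> R by [].
have i2 := @integrableZl _ _ _ mu `[0%R, +oo[ (measurable_itv _) C _ (integrable_expN half0).
apply: (le_integrable _ _ _ i2) => //.
  by apply/measurable_EFinP; exact: measurable_powR_expN.
move=> t; rewrite /= in_itv/= andbT => t0.
rewrite lee_fin ger0_norm ?mulr_ge0 ?powR_ge0 ?expR_ge0//.
apply: le_trans (ler_norm _).
apply: le_trans (ler_wpM2r (expR_ge0 _) (HC t t0)) _.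
rewrite -mulrA -expRD ler_wpM2l// ler_expR; lra.
Qed.

Lemma gamma_integral z : 0 <= z ->
  (\int[mu]_(x in `[0%R, +oo[) (x `^ z * expR (- (1 * x)))%:E = (Gamma (z + 1))%:E)%E.
Proof.
move=> z0; rewrite gammaE /Rintegral fineK//.
exact: integrable_fin_num (integrable_powR_expN z0).
Qed.

(** Restrict the integral to [x >= A] and bound the power below by its value at [A]. The free
    parameter [A] makes this crude bound strong enough for the convergence of the Mittag-Leffler
    series. *)
Lemma gamma_ge A z : 0 < A -> 0 <= z -> A `^ z * expR (- A) <= Gamma (z + 1).
Proof.
move=> A0 z0; rewrite -lee_fin -gamma_integral//.
have -> : (A `^ z * expR (- A))%:E =
    (\int[mu]_(x in `[A, +oo[) ((A `^ z)%:E * (expR (- (1 * x)))%:E))%E.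
  rewrite ge0_integralZl//.
  - by rewrite integral_expN// mul1r divr1 EFinM.
  - by apply/measurable_EFinP; exact: measurable_expN.
  - by rewrite lee_fin powR_ge0.
apply: (@le_trans _ _ (\int[mu]_(x in `[A, +oo[) (x `^ z * expR (- (1 * x)))%:E)%E).
  apply: ge0_le_integral => //.
  - by move=> x _; rewrite -EFinM lee_fin mulr_ge0 ?powR_ge0 ?expR_ge0.
  - by apply: emeasurable_funM; [exact: measurable_cst|
      apply/measurable_EFinP; exact: measurable_expN].
  - by apply/measurable_EFinP; exact: measurable_powR_expN.
  - move=> x; rewrite /= in_itv/= andbT => Ax; rewrite -EFinM lee_fin.
    rewrite ler_wpM2r ?expR_ge0// ge0_ler_powR// ?nnegrE ?ltW//.
    exact: lt_le_trans Ax.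
apply: ge0_subset_integral => //.
- by apply/measurable_EFinP; exact: measurable_powR_expN.
- by move=> x _; rewrite lee_fin mulr_ge0 ?powR_ge0 ?expR_ge0.
- move=> x; rewrite /= !in_itv/= !andbT; apply: le_trans; exact: ltW.
Qed.

Lemma gamma_gt0 z : 0 <= z -> 0 < Gamma (z + 1).
Proof.
move=> z0; apply: lt_le_trans (gamma_ge ltr01 z0).
by rewrite mulr_gt0 ?powR_gt0 ?expR_gt0.
Qed.

Lemma cvg_right_powR z t : 0 <= z -> 0 <= t -> x `^ z @[x --> t^'+] --> t `^ z.
Proof.
rewrite le_eqVlt => /orP[/eqP<- _|z0].
  by rewrite powRr0; under eq_fun do rewrite powRr0; exact: cvg_cst.
rewrite le_eqVlt => /orP[/eqP<-|t0].
  by rewrite powR0 ?gt_eqF//; exact: powR_cvg0.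
have d1 : derivable (fun x : R => x `^ z) t 1.
  by apply: derivable_powR; rewrite in_itv/= t0.
have : {for t, continuous (fun x : R => x `^ z)}.
  exact/differentiable_continuous/derivable1_diffP.
exact: cvg_at_right_filter.
Qed.

Lemma gamma_integral_scale z v : 0 <= z -> 0 < v ->
  (\int[mu]_(x in `[0%R, +oo[) (x `^ z * expR (- (v * x)))%:E =
   (Gamma (z + 1) / (v * v `^ z))%:E)%E.
Proof.
move=> z0 v0.
pose F x : R := v * x.
have F0 : F 0 = 0 by rewrite /F mulr0.
have dF x : derivable F x 1 by apply: derivableM; [exact: derivable_cst|exact: derivable_id].
have F' : (F^`())%classic = cst v.
  by apply/funext => x; rewrite /F derive1Ml// derive1_id mulr1.
have cF (x : R) : F y @[y --> x] --> F x by apply: cvgM; [exact: cvg_cst|exact: cvg_id].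
pose G x : R := x `^ z * expR (- (1 * x)).
have cexp (x : R) : expR (- (1 * y)) @[y --> x] --> expR (- (1 * x)).
  apply: continuous_comp; last exact: continuous_expR.
  by apply: cvgN; apply: cvgM; [exact: cvg_cst|exact: cvg_id].
have H := @increasing_ge0_integration_by_substitutiony R F G 0.
rewrite F' F0 in H.
have {}H : (\int[mu]_(x in `[0%R, +oo[) (((G \o F) * cst v) x)%:E = (Gamma (z + 1))%:E)%E.
  rewrite -gamma_integral//; apply/esym; apply: H.
  - by move=> x y _ _ xy; rewrite /F ltr_pM2l.
  - by move=> x _; exact: cst_continuous.
  - exact: is_cvg_cst.
  - exact: is_cvg_cst.
  - split; first by move=> x _; exact: dF.
    by apply: cvg_at_right_filter; exact: cF.
  - exact: gt0_cvgMry.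
  - apply/continuous_within_itvcyP; split.
      move=> x; rewrite in_itv/= andbT => x0; apply: cvgM; last exact: cexp.
      have d1 : derivable (fun x : R => x `^ z) x 1.
        by apply: derivable_powR; rewrite in_itv/= x0.
      have c1 : {for x, continuous (fun x : R => x `^ z)}.
        exact/differentiable_continuous/derivable1_diffP.
      exact: c1.
    apply: cvgM; first exact: cvg_right_powR.
    by apply: cvg_at_right_filter; exact: cexp.
  - by move=> x _; rewrite /G mulr_ge0 ?powR_ge0 ?expR_ge0.
have vz0 : 0 < v * v `^ z by rewrite mulr_gt0// powR_gt0.
have {}H : ((v * v `^ z)%:E * \int[mu]_(x in `[0%R, +oo[) (x `^ z * expR (- (v * x)))%:E =
    (Gamma (z + 1))%:E)%E.
  rewrite -H -ge0_integralZl//.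
  - apply: eq_integral => x; rewrite inE /= in_itv/= andbT => x0.
    rewrite -EFinM (_ : (_ * _) x = (v * x) `^ z * expR (- (1 * (v * x))) * v)//.
    by rewrite powRM ?(ltW v0)// mul1r; congr _%:E; ring.
  - by apply/measurable_EFinP; exact: measurable_powR_expN.
  - by move=> x _; rewrite lee_fin mulr_ge0 ?powR_ge0 ?expR_ge0.
  - by rewrite lee_fin ltW.
rewrite mulrC EFinM -H muleA -EFinM mulVf ?mul1e// gt_eqF//.
Qed.

End GammaIntegral.

Section MittagLefflerSeries.
Context {R : realType}.
Notation mu := (@lebesgue_measure R).
Notation D := (`[0%R, +oo[%classic : set R).
Variables (nu theta : R).
Hypotheses (nu_gt0 : 0 < nu) (theta_gt0 : 0 < theta).

Definition ml_term (j : nat) (t : R) : R :=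
  (- (theta * t `^ nu)) ^+ j / Gamma (nu * j%:R + 1).

(** Its power [nu] is [2 * theta]; the factor 2 makes the terms of the series decay like [2 ^- j].
    The same number bounds the exponential growth of the sum. *)
Definition ml_rate : R := (2 * theta) `^ nu^-1.

Let nuj0 j : 0 <= nu * j%:R. Proof. by rewrite mulr_ge0// ltW. Qed.

Let rate_gt0 : 0 < ml_rate. Proof. by rewrite powR_gt0// mulr_gt0. Qed.

Let rateE : ml_rate `^ nu = 2 * theta.
Proof. by rewrite /ml_rate -powRrM mulVf ?gt_eqF// powRr1// mulr_ge0// ltW. Qed.

(** [gamma_ge] is applied at [A = ml_rate * s]. The bound depends on [t] only through [s], which
    gives locally uniform convergence. *)
Lemma ml_term_bound j t s : 0 <= t <= s -> 0 < s ->
  `|ml_term j t| <= expR (ml_rate * s) * 2^-1 ^+ j.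
Proof.
move=> /andP[t0 ts] s0.
have A0 : 0 < ml_rate * s by rewrite mulr_gt0.
have g0 := gamma_gt0 (nuj0 j).
have := gamma_ge A0 (nuj0 j).
rewrite powRrM powR_mulrn ?powR_ge0// powRM ?(ltW rate_gt0) ?(ltW s0)// rateE.
rewrite expRN => gge.
rewrite /ml_term normrM normfV (gtr0_norm g0) normrX normrN.
rewrite ger0_norm ?mulr_ge0 ?powR_ge0 ?(ltW theta_gt0)//.
rewrite ler_pdivrMr//.
have e0 := expR_gt0 (ml_rate * s).
have p20 : 0 < 2 ^+ j :> R by rewrite exprn_gt0.
apply: (@le_trans _ _ (expR (ml_rate * s) * 2^-1 ^+ j *
    ((2 * theta * s `^ nu) ^+ j / expR (ml_rate * s)))); last first.
  by rewrite ler_wpM2l// mulr_ge0 ?ltW// exprn_gt0.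
have -> : expR (ml_rate * s) * 2^-1 ^+ j * ((2 * theta * s `^ nu) ^+ j / expR (ml_rate * s)) =
    (theta * s `^ nu) ^+ j.
  rewrite -[2 * theta * _]mulrA exprMn exprVn; field.
  by rewrite !gt_eqF.
apply: lerXn2r; rewrite ?nnegrE ?mulr_ge0 ?powR_ge0 ?(ltW theta_gt0)//.
rewrite ler_wpM2l ?(ltW theta_gt0)//.
by apply: ge0_ler_powR; rewrite ?nnegrE ?(ltW nu_gt0) ?(ltW s0).
Qed.

Definition ml_fun (t : R) : R := mittag_leffler nu (- (theta * t `^ nu)).

Let half_sum N M : (N <= M)%N ->
  \sum_(N <= j < M) 2^-1 ^+ j = 2 * 2^-1 ^+ N - 2 * 2^-1 ^+ M :> R.
Proof.
elim: M => [|M IHM]; first by rewrite leqn0 => /eqP->; rewrite big_geq// subrr.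
rewrite leq_eqVlt => /orP[/eqP->|]; first by rewrite big_geq// subrr.
by rewrite ltnS => NM; rewrite big_nat_recr//= IHM// exprS; field.
Qed.

Lemma ml_series_bound N M t s : 0 <= t <= s -> 0 < s -> (N <= M)%N ->
  `|series (ml_term ^~ t) M - series (ml_term ^~ t) N| <=
  expR (ml_rate * s) * (2 * 2^-1 ^+ N).
Proof.
move=> ts s0 NM; rewrite sub_series_geq//.
apply: le_trans (ler_norm_sum _ _ _) _.
apply: (@le_trans _ _ (\sum_(N <= j < M) expR (ml_rate * s) * 2^-1 ^+ j)).
  by apply: ler_sum => j _; exact: ml_term_bound.
rewrite -mulr_sumr ler_wpM2l ?expR_ge0// half_sum// gerBl.
by rewrite mulr_ge0// exprn_ge0.
Qed.

Lemma ml_cvg t : 0 <= t -> series (ml_term ^~ t) n @[n --> \oo] --> ml_fun t.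
Proof.
(* Taking [s = t + 1] keeps [s] positive also at [t = 0]. *)
move=> t0; have t1 : 0 < t + 1 by rewrite ltr_wpDl.
have tt1 : 0 <= t <= t + 1 by rewrite t0/= lerDl.
suff c : cvgn (series (ml_term ^~ t)) by exact: c.
apply: normed_cvg.
apply: (@series_le_cvg _ _ (geometric (expR (ml_rate * (t + 1))) 2^-1)) => //.
- by move=> n /=; exact: normr_ge0.
- by move=> n; rewrite /geometric /= mulr_ge0 ?expR_ge0 ?exprn_ge0.
- by move=> n /=; exact: ml_term_bound.
- by apply: is_cvg_geometric_series; rewrite ger0_norm// invf_lt1// ltr1n.
Qed.

Lemma ml_tail N t s : 0 <= t <= s -> 0 < s ->
  `|ml_fun t - series (ml_term ^~ t) N| <= expR (ml_rate * s) * (2 * 2^-1 ^+ N).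
Proof.
move=> ts s0; have /andP[t0 _] := ts.
have lim : `|series (ml_term ^~ t) M - series (ml_term ^~ t) N| @[M --> \oo] -->
    `|ml_fun t - series (ml_term ^~ t) N|.
  by apply: cvg_norm; apply: cvgB; [exact: ml_cvg|exact: cvg_cst].
apply: (cvgr_to_le lim); exists N => // M /= NM.
exact: ml_series_bound.
Qed.

Lemma ml_partial_bound N t : 0 <= t ->
  `|series (ml_term ^~ t) N| <= 2 * expR ml_rate * expR (ml_rate * t).
Proof.
move=> t0; have t1 : 0 < t + 1 by rewrite ltr_wpDl.
have tt1 : 0 <= t <= t + 1 by rewrite t0/= lerDl.
have := ml_series_bound tt1 t1 (leq0n N).
have -> : expR (ml_rate * (t + 1)) * (2 * 2^-1 ^+ 0) =
    2 * expR ml_rate * expR (ml_rate * t).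
  by rewrite expr0 mulrDr !mulr1 expRD; ring.
by rewrite [series _ 0]/series/= big_geq// subr0.
Qed.

Lemma ml_fun_bound t : 0 <= t ->
  `|ml_fun t| <= 2 * expR ml_rate * expR (ml_rate * t).
Proof.
move=> t0.
have lim : `|series (ml_term ^~ t) N| @[N --> \oo] --> `|ml_fun t|.
  by apply: cvg_norm; exact: ml_cvg.
by apply: (cvgr_to_le lim); apply: nearW => N; exact: ml_partial_bound.
Qed.

Lemma ml_term_right_continuous j t : 0 <= t ->
  ml_term j x @[x --> t^'+] --> ml_term j t.
Proof.
move=> t0; apply: cvgM; last exact: cvg_cst.
have : - (theta * x `^ nu) @[x --> t^'+] --> - (theta * t `^ nu).
  apply: cvgN; apply: cvgM; first exact: cvg_cst.
  by apply: cvg_right_powR => //; exact: ltW.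
elim: j => [|j IHj] H; first by under eq_fun do rewrite expr0; rewrite expr0; exact: cvg_cst.
under eq_fun do rewrite exprS; rewrite exprS.
by apply: cvgM => //; exact: IHj.
Qed.

Lemma ml_right_continuous t : 0 <= t -> ml_fun x @[x --> t^'+] --> ml_fun t.
Proof.
move=> t0; have t1 : 0 < t + 1 by rewrite ltr_wpDl.
apply/cvgrPdist_lt => e e0.
have e3 : 0 < e / 3 by rewrite divr_gt0.
(* [N] is fixed before [x]: the tail bound is the same for all arguments up to [t + 1]. *)
have [N HN] : exists N, expR (ml_rate * (t + 1)) * (2 * 2^-1 ^+ N) < e / 3.
  have : expR (ml_rate * (t + 1)) * (2 * 2^-1 ^+ n) @[n --> \oo] -->
      expR (ml_rate * (t + 1)) * (2 * 0).
    apply: cvgM; first exact: cvg_cst.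
    apply: cvgM; first exact: cvg_cst.
    by apply: cvg_expr; rewrite ger0_norm// invf_lt1// ltr1n.
  rewrite !mulr0 => /(cvgr_lt 0)/(_ _ e3)[N _ HN].
  by exists N; exact: HN (leqnn N).
have cN : series (ml_term ^~ x) N @[x --> t^'+] --> series (ml_term ^~ t) N.
  rewrite /series /=; elim: N {HN} => [|N IHN].
    by under eq_fun do rewrite big_geq//; rewrite big_geq//; exact: cvg_cst.
  under eq_fun do rewrite big_nat_recr//=; rewrite big_nat_recr//=.
  by apply: cvgD => //; exact: ml_term_right_continuous.
near=> x.
have tx : t < x by near: x; exact: nbhs_right_gt.
have xt1 : x < t + 1 by near: x; apply: nbhs_right_lt; rewrite ltrDl.
have tin : 0 <= t <= t + 1 by rewrite t0/= lerDl.
have xin : 0 <= x <= t + 1 by rewrite (le_trans t0 (ltW tx)) ltW.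
have a1 := le_lt_trans (ml_tail N tin t1) HN.
have a2 := le_lt_trans (ml_tail N xin t1) HN.
have a3 : `|series (ml_term ^~ t) N - series (ml_term ^~ x) N| < e / 3.
  by near: x; move/cvgrPdist_lt : cN; apply.
move: a1 a2 a3; rewrite !ltr_norml => /andP[a1 b1] /andP[a2 b2] /andP[a3 b3].
by apply/andP; split; lra.
Unshelve. all: by end_near.
Qed.

Lemma measurable_ml_term j : measurable_fun D (ml_term j).
Proof.
apply: measurable_funM; last exact: measurable_cst.
apply: measurable_funX; apply: measurableT_comp => //.
apply: measurable_funM; first exact: measurable_cst.
by apply: measurable_funTS; exact: measurable_powR.
Qed.

Lemma measurable_ml_partial N : measurable_fun D (fun t => series (ml_term ^~ t) N).
Proof. by apply: measurable_sum => j; exact: measurable_ml_term. Qed.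

Lemma measurable_ml : measurable_fun D ml_fun.
Proof.
apply: (measurable_fun_cvg (h := fun N t => series (ml_term ^~ t) N)).
  exact: measurable_ml_partial.
by move=> t; rewrite /= in_itv/= andbT => t0; exact: ml_cvg.
Qed.

Section Laplace.
Variable v : R.
Hypothesis v_gt : ml_rate < v.

Let v0 : 0 < v. Proof. exact: lt_trans v_gt. Qed.

Let vnu0 : 0 < v `^ nu. Proof. exact: powR_gt0. Qed.

Let ratio_lt1 : `|- theta / v `^ nu| < 1.
Proof.
rewrite mulNr normrN ger0_norm ?divr_ge0 ?(ltW theta_gt0) ?(ltW vnu0)//.
rewrite ltr_pdivrMr// mul1r.
have : ml_rate `^ nu < v `^ nu.
  by apply: gt0_ltr_powR; rewrite ?nnegrE// ltW.
by apply: lt_trans; rewrite rateE; have := theta_gt0; lra.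
Qed.

Let integrable_ml_term j :
  mu.-integrable D (EFin \o (fun t => expR (- (v * t)) * ml_term j t)).
Proof.
have vr : 0 < v - ml_rate by rewrite subr_gt0.
have i1 := @integrableZl _ _ _ mu D (measurable_itv _)
  (expR ml_rate) _ (integrable_expN vr).
apply: (le_integrable _ _ _ i1) => //.
  apply/measurable_EFinP; apply: measurable_funM; first exact: measurable_expN.
  exact: measurable_ml_term.
move=> t; rewrite /= in_itv/= andbT => t0.
rewrite lee_fin normrM ger0_norm ?expR_ge0//; apply: le_trans (ler_norm _).
have t1 : 0 < t + 1 by rewrite ltr_wpDl.
have tt1 : 0 <= t <= t + 1 by rewrite t0/= lerDl.
apply: (@le_trans _ _ (expR (- (v * t)) * expR (ml_rate * (t + 1)))).
  rewrite ler_wpM2l ?expR_ge0//; apply: le_trans (ml_term_bound j tt1 t1) _.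
  by rewrite ler_piMr ?expR_ge0// exprn_ile1// invf_le1// ler1n.
by rewrite -!expRD ler_expR; lra.
Qed.

Let integral_ml_term j :
  \int[mu]_(t in D) (expR (- (v * t)) * ml_term j t) =
  v^-1 * (- theta / v `^ nu) ^+ j.
Proof.
have g0 := gamma_gt0 (nuj0 j).
pose c : R := (- theta) ^+ j / Gamma (nu * j%:R + 1).
have E t : expR (- (v * t)) * ml_term j t = c * (t `^ (nu * j%:R) * expR (- (v * t))).
  rewrite /ml_term /c powRrM powR_mulrn ?powR_ge0// -(mulNr theta) exprMn.
  by ring.
transitivity (\int[mu]_(t in D) (c * (t `^ (nu * j%:R) * expR (- (v * t))))).
  by apply: eq_Rintegral => t _; exact: E.
rewrite RintegralZl//; last first.
  apply/integrableP; split; first by apply/measurable_EFinP; exact: measurable_powR_expN.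
  under eq_integral do rewrite /= ger0_norm ?mulr_ge0 ?powR_ge0 ?expR_ge0//.
  by rewrite gamma_integral_scale// ltry.
rewrite /Rintegral gamma_integral_scale//= /c powRrM powR_mulrn ?powR_ge0//.
rewrite expr_div_n; have vj0 : (v `^ nu) ^+ j != 0 by rewrite expf_neq0// gt_eqF.
by field; rewrite vj0 !gt_eqF.
Qed.

Let vr : 0 < v - ml_rate. Proof. by rewrite subr_gt0. Qed.

Let bound (u : R -> R) t : 0 <= t ->
  `|u t| <= 2 * expR ml_rate * expR (ml_rate * t) ->
  `|expR (- (v * t)) * u t| <= 2 * expR ml_rate * expR (- ((v - ml_rate) * t)).
Proof.
move=> t0 ut; rewrite normrM ger0_norm ?expR_ge0// mulrC.
apply: le_trans (ler_wpM2r (expR_ge0 _) ut) _.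
by rewrite -[leLHS]mulrA -expRD ler_wpM2l ?mulr_ge0 ?expR_ge0// ler_expR; lra.
Qed.

Lemma integrable_ml :
  mu.-integrable D (EFin \o (fun t => expR (- (v * t)) * ml_fun t)).
Proof.
have i1 := @integrableZl _ _ _ mu D (measurable_itv _) (2 * expR ml_rate) _ (integrable_expN vr).
apply: (le_integrable _ _ _ i1) => //.
  apply/measurable_EFinP; apply: measurable_funM; first exact: measurable_expN.
  exact: measurable_ml.
move=> t; rewrite /= in_itv/= andbT => t0; rewrite lee_fin.
by apply: le_trans (ler_norm _); apply: bound => //; exact: ml_fun_bound.
Qed.

(** The partial sums have as transforms the partial sums of a geometric series of ratio
    [- theta / v ^ nu]; for [v > ml_rate] this ratio is below 1 in absolute value and one integrable
    exponential dominates all partial sums. *)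
Lemma ml_laplace :
  \int[mu]_(t in D) (expR (- (v * t)) * ml_fun t) =
  v^-1 * (v `^ nu / (theta + v `^ nu)).
Proof.
have mD : measurable D by exact: measurable_itv.
have i1 := @integrableZl _ _ _ mu D mD (2 * expR ml_rate) _ (integrable_expN vr).
pose f N t := expR (- (v * t)) * series (ml_term ^~ t) N.
have mf N : measurable_fun D (f N).
  by apply: measurable_funM; [exact: measurable_expN|exact: measurable_ml_partial].
have fi N : mu.-integrable D (EFin \o f N).
  apply: (le_integrable _ _ _ i1) => //; first by apply/measurable_EFinP; exact: mf.
  move=> t; rewrite /= in_itv/= andbT => t0; rewrite lee_fin.
  by apply: le_trans (ler_norm _); apply: (@bound (fun t => series (ml_term ^~ t) N) t) => //;
    exact: ml_partial_bound.
have intf N : \int[mu]_(t in D) f N t =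
    v^-1 * series (geometric 1 (- theta / v `^ nu)) N.
  elim: N => [|N IHN].
    rewrite [series _ 0]/series/= big_geq// mulr0 /f /Rintegral.
    rewrite integral0_eq// => t _; rewrite /f [series _ 0]/series/= big_geq// mulr0//.
  rewrite [series _ N.+1]/series/= big_nat_recr//= mulrDr mul1r -integral_ml_term -IHN.
  rewrite -RintegralD//; apply: eq_Rintegral => t _.
  by rewrite /f /series/= big_nat_recr//= mulrDr.
have gi := integrable_ml; have mg := measurable_int _ gi.
have mEf N : measurable_fun D (EFin \o f N) by apply/measurable_EFinP; exact: mf.
have fg : {ae mu, forall t, D t ->
    (EFin \o f N) t @[N --> \oo] --> (EFin \o (fun t => expR (- (v * t)) * ml_fun t)) t}.
  apply: aeW => t; rewrite /= in_itv/= andbT => t0.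
  apply: cvg_EFin; first exact: nearW.
  by apply: cvgM; [exact: cvg_cst|exact: ml_cvg].
have fb : {ae mu, forall t N, D t -> (`|(EFin \o f N) t| <=
    (fun t => (2 * expR ml_rate)%:E * (expR (- ((v - ml_rate) * t)))%:E) t)%E}.
  apply: aeW => t N; rewrite /= in_itv/= andbT => t0; rewrite lee_fin.
  by apply: (@bound (fun t => series (ml_term ^~ t) N) t) => //; exact: ml_partial_bound.
have [_ _ lim] := @dominated_convergence _ _ _ mu D mD _ _ _ mEf mg fg i1 fb.
have lim' : \int[mu]_(t in D) f N t @[N --> \oo] -->
    \int[mu]_(t in D) (expR (- (v * t)) * ml_fun t).
  rewrite /Rintegral; apply: fine_cvg; rewrite fineK//.
  exact: integrable_fin_num gi.
have E : (fun N => \int[mu]_(t in D) f N t) =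
    (fun N => v^-1 * series (geometric 1 (- theta / v `^ nu)) N).
  by apply/funext => N; exact: intf.
rewrite E in lim'; apply: (cvg_unique _ lim') => //.
have -> : v `^ nu / (theta + v `^ nu) = 1 * (1 - (- theta / v `^ nu))^-1.
  have tv : theta + v `^ nu != 0 by rewrite gt_eqF// addr_gt0.
  have vn := vnu0; rewrite mul1r; field.
  by rewrite gt_eqF//= opprK addrC.
by apply: cvgM; [exact: cvg_cst|exact: cvg_geometric_series].
Qed.

End Laplace.
End MittagLefflerSeries.

Section MittagLefflerLaw.
Context {R : realType} {d : measure_display} {T : measurableType d}.
Variables (P : probability T R) (nu theta : R).
Hypotheses (nu_gt0 : 0 < nu) (theta_gt0 : 0 < theta).
Notation mu := (@lebesgue_measure R).

(** Distribution functions are compared, not densities: both have the transform [1 / v - v ^ nu / (v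
    * (theta + v ^ nu)) = theta / (v * (theta + v ^ nu))] for [v > ml_rate], which is all that
    [laplace_inj] asks. *)
Lemma mittag_leffler_rv_laplace (X : {RV P >-> R}) :
  (forall w, 0 <= X w) ->
  (forall v, 0 < v -> (\int[P]_w (expR (- (v * X w)))%:E =
                       (theta / (theta + v `^ nu))%:E)%E) ->
  mittag_leffler_rv nu theta X.
Proof.
move=> X0 XL t t0.
pose W := fun _ : T => 1 : R.
have mW : measurable_fun [set: T] W by exact: measurable_cst.
have mX : measurable_fun [set: T] X by exact: measurable_funPT.
have W0 w : 0 <= W w by exact: ler01.
have W_int : (\int[P]_w (W w)%:E = 1%:E)%E.
  rewrite (@integral_cst _ _ _ P _ measurableT 1%E) mul1e; exact: probability_setT.
have cdfE r : cdf X r = weighted_cdf P W X r.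
  rewrite /weighted_cdf (@integral_cst _ _ _ P _ (measurable_sublevel r mX) 1%E).
  by rewrite mul1e /cdf /= /distribution /= /pushforward; congr (P _); apply/seteqP; split.
have c0 : 0 <= ml_rate nu theta by rewrite /ml_rate powR_ge0.
rewrite cdfE -(fineK (weighted_cdf_fin_num mW mX W0 W_int t)); congr _%:E.
apply: (@laplace_inj _ (fine \o weighted_cdf P W X) (fun t => 1 - ml_fun nu theta t)
  (1 + 2 * expR (ml_rate nu theta)) (ml_rate nu theta)) => //.
- exact: (measurable_fine_weighted_cdf P mW mX W0).
- apply: measurable_funB; first exact: measurable_cst.
  exact: measurable_ml.
- move=> r r0; apply: le_trans (weighted_cdf_norm mW mX W0 W_int r) _.
  rewrite mul0r expR0 mulr1 -[leLHS]mulr1 ler_pM//.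
    by rewrite lerDl mulr_ge0 ?expR_ge0.
  by rewrite -expR0 ler_expR mulr_ge0.
- move=> r r0; apply: le_trans (ler_normB _ _) _.
  rewrite normr1 mulrDl mul1r lerD//; last exact: ml_fun_bound.
  by rewrite -expR0 ler_expR mulr_ge0.
- move=> v v_gt; have v0 : 0 < v by exact: le_lt_trans v_gt.
  rewrite (weighted_cdf_laplace_fine mW mX W0 X0 W_int v0).
  have -> : (\int[P]_w (W w * expR (- (v * X w)))%:E =
      (theta / (theta + v `^ nu))%:E)%E.
    by rewrite -XL//; apply: eq_integral => w _; rewrite mul1r.
  transitivity (\int[mu]_(r in `[0%R, +oo[) (expR (- (v * r)) -
      expR (- (v * r)) * ml_fun nu theta r)); last first.
    by apply: eq_Rintegral => r _; ring.
  rewrite RintegralB//; [|exact: integrable_expN|exact: integrable_ml].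
  rewrite (ml_laplace nu_gt0 theta_gt0 v_gt) /Rintegral integral_expN//=.
  have tv : theta + v `^ nu != 0 by rewrite gt_eqF// addr_gt0// powR_gt0.
  rewrite mulr0 oppr0 expR0; field; rewrite tv gt_eqF//.
- exact: weighted_cdf_right_continuous mW mX W0 W_int t.
- apply: cvgB; first exact: cvg_cst.
  exact: ml_right_continuous.
Qed.
End MittagLefflerLaw.

(** * Independence from the joint Laplace transform *)

Section LaplaceIndependence.
Context {R : realType} {d : measure_display} {T : measurableType d}.
Variables (P : probability T R) (D : nat -> T -> R) (L : R -> R).
Hypothesis mD : forall j, measurable_fun setT (D j).
Hypothesis D_ge0 : forall j w, 0 <= D j w.
Hypothesis joint_laplace : forall (v : nat -> R) (m : nat),
  (forall j, 0 <= v j) ->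
  (\int[P]_w (expR (- \sum_(j < m) v j * D j w))%:E = (\prod_(j < m) L (v j))%:E)%E.

Let L0 : L 0 = 1.
Proof.
have := joint_laplace (v := fun=> 0) 1 (fun=> lexx _).
under eq_integral do rewrite big_ord1 mul0r oppr0 expR0.
rewrite big_ord1 (@integral_cst _ _ _ P _ measurableT 1%E) mul1e.
by rewrite [X in X = _](@probability_setT _ _ _ P) => -[].
Qed.

Let big_seq_nat (U : Type) (idx : U) (op : Monoid.com_law idx) (s : seq nat) (F : nat -> U) :
  uniq s -> \big[op/idx]_(i <- s) F i =
            \big[op/idx]_(j < (\max_(i <- s) i).+1 | val j \in s) F j.
Proof.
move=> us; rewrite -(big_mkord (fun j => j \in s) F) /index_iota subn0 -[RHS]big_filter.
apply: perm_big; apply: uniq_perm => //; first by rewrite filter_uniq ?iota_uniq.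
move=> i; rewrite mem_filter mem_iota; case si : (i \in s) => //=.
by rewrite add0n ltnS; exact/esym/leq_bigmax_seq.
Qed.

(** Indices outside [s] get the coefficient 0, and [L 0 = 1]. *)
Lemma laplace_seq (s : seq nat) (v : nat -> R) : uniq s -> (forall j, 0 <= v j) ->
  (\int[P]_w (\prod_(i <- s) expR (- (v i * D i w)))%:E = (\prod_(i <- s) L (v i))%:E)%E.
Proof.
move=> us v0; pose v' j := if j \in s then v j else 0.
have v'0 j : 0 <= v' j by rewrite /v'; case: ifP.
have E (F : R -> nat -> R) : (forall j, F 0 j = 1) ->
    \prod_(i <- s) F (v i) i = \prod_(j < (\max_(i <- s) i).+1) F (v' j) j.
  move=> F0; rewrite big_seq_nat// big_mkcond; apply: eq_bigr => j _.
  by rewrite /v'; case: ifP.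
rewrite (E (fun u _ => L u))// -joint_laplace//; apply: eq_integral => w _.
rewrite (E (fun u i => expR (- (u * D i w)))) => [|j]; last by rewrite mul0r oppr0 expR0.
by rewrite -sumrN expR_sum.
Qed.

Variable A : nat -> set R.
Hypothesis mA : forall j, measurable (A j).

(** The induction trades exponentials for indicators one variable at a time. As a function of the
    coefficient [u] of [D i], the integral is a constant times [L u]; [laplace_indep] then replaces
    the exponential by the indicator of any measurable set. *)
Lemma laplace_seq_indic (s1 s2 : seq nat) (v : nat -> R) : uniq (s1 ++ s2) ->
  (forall j, 0 <= v j) ->
  (\int[P]_w ((\prod_(i <- s1) \1_(A i) (D i w)) *
              \prod_(i <- s2) expR (- (v i * D i w)))%:E =
   ((\prod_(i <- s1) fine (P (D i @^-1` A i))) * \prod_(i <- s2) L (v i))%:E)%E.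
Proof.
elim: s1 s2 v => [|i s1 IHs] s2 v us v0.
  rewrite big_nil mul1r -(laplace_seq us v0).
  by apply: eq_integral => w _; rewrite big_nil mul1r.
pose W w := (\prod_(j <- s1) \1_(A j) (D j w)) * \prod_(j <- s2) expR (- (v j * D j w)) : R.
have mind j : measurable_fun setT (fun w => \1_(A j) (D j w) : R).
  by apply: measurableT_comp => //; exact: measurable_indic.
have mW : measurable_fun setT W.
  apply: measurable_funM; first by apply: measurable_prod => j _; exact: mind.
  by apply: measurable_prod => j _; exact: measurable_exp_scale.
have W0 w : 0 <= W w.
  by rewrite mulr_ge0// prodr_ge0// => j _; rewrite ?expR_ge0// indicE.
pose c := (\prod_(j <- s1) fine (P (D j @^-1` A j))) * \prod_(j <- s2) L (v j).
have us' : uniq (s1 ++ i :: s2).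
  by rewrite (perm_uniq (permEl (perm_catCA s1 [:: i] s2))).
have iN2 : i \notin s2 by move: us; rewrite /= mem_cat negb_or => /andP[/andP[]].
have H u : 0 <= u -> (\int[P]_w (W w * expR (- (u * D i w)))%:E =
    c%:E * \int[P]_w (expR (- (u * D i w)))%:E)%E.
  move=> u0.
  have -> : (\int[P]_w (expR (- (u * D i w)))%:E = (L u)%:E)%E.
    have := @laplace_seq [:: i] (fun=> u) isT (fun=> u0); rewrite big_seq1 => <-.
    by apply: eq_integral => w _; rewrite big_seq1.
  pose v' j := if j == i then u else v j.
  have v'0 j : 0 <= v' j by rewrite /v'; case: ifP.
  have v'i : v' i = u by rewrite /v' eqxx.
  have v's2 (F : nat -> R -> R) : \prod_(j <- s2) F j (v' j) = \prod_(j <- s2) F j (v j).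
    apply: eq_big_seq => j js2; rewrite /v'; case: eqP => // ji.
    by move: iN2; rewrite -ji js2.
  have := IHs (i :: s2) v' us' v'0.
  rewrite big_cons (v's2 (fun=> L)) v'i mulrCA [L u * _]mulrC -/c EFinM => <-.
  apply: eq_integral => w _; rewrite big_cons (v's2 (fun j u => expR (- (u * D j w)))).
  by rewrite v'i /W; congr _%:E; ring.
have := laplace_indep mW (mD i) W0 (D_ge0 i) H (mA i).
rewrite -(integral_mul_indic P W (D i) (mA i)) => E.
rewrite big_cons -mulrA EFinM fineK ?fin_num_measure//; last exact: measurable_preimageT.
rewrite -/c muleC -E; apply: eq_integral => w _.
by rewrite big_cons -EFinM /W; congr _%:E; ring.
Qed.

End LaplaceIndependence.

Lemma laplace_mutually_independent {R : realType} {d : measure_display}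
    {T : measurableType d} (P : probability T R) (D : nat -> T -> R) (L : R -> R) :
  (forall j, measurable_fun setT (D j)) -> (forall j w, 0 <= D j w) ->
  (forall (v : nat -> R) (m : nat), (forall j, 0 <= v j) ->
    (\int[P]_w (expR (- \sum_(j < m) v j * D j w))%:E = (\prod_(j < m) L (v j))%:E)%E) ->
  mutually_independent P D.
Proof.
move=> mD D0 HL s A us mA.
have := @laplace_seq_indic R d T P D L mD D0 HL A mA s [::] (fun=> 0).
rewrite cats0 big_nil mulr1 => /(_ us (fun=> lexx _)).
have mDA i : measurable (D i @^-1` A i) by exact: measurable_preimageT.
have -> : (\prod_(i <- s) P (D i @^-1` A i) =
    (\prod_(i <- s) fine (P (D i @^-1` A i)))%:E)%E.
  by rewrite -prodEFin; apply: eq_bigr => i _; rewrite fineK ?fin_num_measure.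
move=> <-.
have mS : measurable (\bigcap_(i in [set` s]) (D i @^-1` A i)).
  by apply: fin_bigcap_measurable => // i _; exact: mDA.
transitivity (\int[P]_w (\1_(\bigcap_(i in [set` s]) (D i @^-1` A i)) w)%:E)%E.
  by rewrite integral_indic// setIT.
apply: eq_integral => w _; rewrite big_nil mulr1; congr _%:E.
rewrite indicE; have [/set_mem/= ws|wNs] := boolP (w \in _).
  rewrite big_seq big1// => i si; rewrite indicE mem_set//; exact: ws.
have [i si /= Ai] : exists2 i, i \in s & ~ A i (D i w).
  apply: contrapT => H; move/negP: wNs; apply; apply/mem_set => i /= si.
  by apply: contrapT => Ai; apply: H; exists i.
rewrite (big_rem i)//= indicE memNset// mul0r//.
Qed.

(** * Inter-phase times *)

Section InterPhase.
Context {R : realType} {d : measure_display} {T : measurableType d}.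
Variable P : probability T R.
Variables (k : nat) (lam mu nu : R) (Q : R -> T -> queue_state k) (sigma : R -> {RV P >-> R}).
Hypotheses (k_gt0 : (0 < k)%N) (lam_gt0 : 0 < lam) (mu_gt0 : 0 < mu) (nu_gt0 : 0 < nu).
Hypothesis mcQ : markov_chain P (queue_rate lam mu) Q.
Hypothesis subP : stable_subordinator nu sigma.
Hypothesis indep :
  independent_processes P [set: set (queue_state k)] (@measurable _ R) Q sigma.

Notation theta := (k%:R * mu).

(* Any mesh with [h n --> 0], [N n * h n --> +oo] and [N n * h n ^+ 2 --> 0]
   would do: the last quantity bounds the discretization error. *)
Let h (n : nat) : R := harmonic n ^+ 2.
Let N (n : nat) : nat := (n.+1 ^ 3)%N.

Let h_gt0 n : 0 < h n. Proof. by rewrite exprn_gt0// harmonic_gt0. Qed.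

Let h_cvg : h n @[n --> \oo] --> (0 : R).
Proof. by rewrite -[0](mulr0 0); apply: cvgM; exact: cvg_harmonic. Qed.

Let NhE n : (N n)%:R * h n = n.+1%:R.
Proof. by rewrite /N /h /harmonic/= natrX; field. Qed.

Let N_cvg t : \forall n \near \oo, t <= (N n)%:R * h n.
Proof.
near=> n; rewrite NhE; apply: (@le_trans _ _ n%:R); last by rewrite ler_nat.
by near: n; exact: nbhs_infty_ger.
Unshelve. all: by end_near.
Qed.

Let error_cvg c : (N n)%:R * c * h n ^+ 2 @[n --> \oo] --> (0 : R).
Proof.
rewrite (_ : (fun n => _) = (fun n => c * harmonic n)); last first.
  apply/funext => n; rewrite mulrAC expr2 mulrA NhE /h /harmonic/=; field.
  by rewrite -mulrS pnatr_eq0.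
by rewrite -[X in _ --> X](mulr0 c); apply: cvgM; [exact: cvg_cst|exact: cvg_harmonic].
Qed.

Definition phase_duration_approx (n j : nat) (w : T) : R :=
  phase_increment k (queue_path Q w) (fun t => sigma t w) (h n) (N n) j.

(** An upper limit is measurable without any knowledge of convergence; [fine] and the maximum with 0
    make it a nonnegative real also on the null set where the approximations do not converge. *)
Definition phase_duration (j : nat) (w : T) : R :=
  Num.max 0 (fine (limn_esup (fun n => (phase_duration_approx n j w)%:E))).

Lemma measurable_phase_duration_approx n j :
  measurable_fun setT (phase_duration_approx n j).
Proof.
apply: measurable_sum => i; apply: measurable_funM; last exact: measurable_increment.
exact: (measurable_skeleton_fun (mc_measurable mcQ) (h_gt0 n)
  (fun a => (a == (j.+1, true))%:R)).
Qed.

Lemma measurable_phase_duration j : measurable_fun setT (phase_duration j).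
Proof.
apply: measurable_maxr; first exact: measurable_cst.
apply: measurableT_comp => //.
apply: measurable_fun_limn_esup => n.
by apply/measurable_EFinP; exact: measurable_phase_duration_approx.
Qed.

Lemma phase_duration_ge0 j w : 0 <= phase_duration j w.
Proof. by rewrite le_max lexx. Qed.

(** The first clause identifies the durations; the others provide the pointwise limit and the
    domination for [phase_duration_laplace]. *)
Lemma ae_inter_phase_times : {ae P, forall w,
  [/\ inter_phase_times k (fun t => val (fractional_process Q sigma t w))
        (fun j => phase_duration j w),
      forall j, phase_duration_approx n j w @[n --> \oo] --> phase_duration j w,
      forall m, \forall n \near \oo,
        (m < (service_state k (skeleton (queue_path Q w) (h n)) (N n)).1)%N &
      forall s t, 0 <= s -> s < t -> sigma s w < sigma t w]}.
Proof.
have qp := ae_queue_step_path k_gt0 lam_gt0 mu_gt0 mcQ.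
have s_incr := ae_subordinator_incr nu_gt0 subP.
have s_unb := ae_subordinator_unbounded subP.
apply: filterS2 (filterI qp (sub_start subP)) (filterI s_incr s_unb).
move=> w [[J [y [xJy ystate ystep ystarts]]] s0] [{}s_incr {}s_unb].
have [rb [rc [rbS rbP rcP rbcP]]] := service_phase_indices ystep ystarts.
have rbc j : (rb j < rc j)%N by have [] := rcP j.
have xJy' := step_path_first_passage s0 s_incr s_unb xJy.
have ipt := step_path_inter_phase_times xJy' ystate ystep rbS rbP rcP.
have cvg j := @cvg_phase_increment _ k _ _ _ xJy ystarts h N h_gt0 h_cvg N_cvg rb rc rbc rbcP
  _ s_incr j.
have DE j : phase_duration j w =
    left_limit (fun t => sigma t w) (J (rc j).+1) -
    left_limit (fun t => sigma t w) (J (rb j).+1).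
  have c : (phase_duration_approx n j w)%:E @[n --> \oo] -->
      (left_limit (fun t => sigma t w) (J (rc j).+1) -
       left_limit (fun t => sigma t w) (J (rb j).+1))%:E.
    by apply: cvg_EFin; [exact: nearW|exact: cvg].
  rewrite /phase_duration (cvg_limn_einf_sup c).2/= max_r// subr_ge0.
  by apply: (step_path_le xJy'); rewrite ltnS ltnW.
split => //.
- rewrite (_ : (fun j => phase_duration j w) = (fun j =>
    left_limit (fun t => sigma t w) (J (rc j).+1) -
    left_limit (fun t => sigma t w) (J (rb j).+1))) //.
  by apply/funext => j; exact: DE.
- by move=> j; rewrite DE; exact: cvg.
- exact: (skeleton_count_unbounded xJy ystarts h_gt0 h_cvg N_cvg).
Qed.

(** Regrouping the cells by phase turns the product over time steps, suited to the martingale, into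
    a sum over phases, suited to the limit. *)
Lemma weighted_pathE (v : nat -> R) m e n w : (forall r, (m <= r)%N -> v r = 0) ->
  weighted_path mu nu Q sigma v m e n w =
  expR (- \sum_(j < m) v j * phase_increment k (queue_path Q w) (fun t => sigma t w) e n j) *
  service_weight k mu (fun r => v r `^ nu) m (service_state k (skeleton (queue_path Q w) e) n).
Proof.
move=> vm; rewrite /weighted_path; congr (_ * _).
have costE (a : nat * bool) : (a.2 -> 0 < a.1)%N ->
    service_cost v a = \sum_(j < m) v j * (a == (j.+1, true))%:R.
  case: a => [[|a] []]//= apos.
  - by have := apos isT.
  - by rewrite big1// => j _; rewrite mulr0.
  - rewrite /service_cost/=; have [am|am] := ltnP a m.
      rewrite (bigD1 (Ordinal am))//= eqxx mulr1 big1 ?addr0// => j ja.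
      have /negPf aj : a != j.
        by apply: contraNneq ja => aj; apply/eqP/val_inj; rewrite /= aj.
      by rewrite xpair_eqE eqSS aj mulr0.
    rewrite vm// big1// => j _; rewrite xpair_eqE eqSS andbT.
    by rewrite gtn_eqF ?mulr0// (leq_trans _ am).
  - by rewrite big1// => j _; rewrite xpair_eqE andbF mulr0.
rewrite -expR_sum; congr expR; rewrite sumrN; congr (- _).
under [RHS]eq_bigr do rewrite mulr_sumr.
rewrite exchange_big/=; apply: eq_bigr => i _.
rewrite costE; last exact: (@service_state_pos k (skeleton (queue_path Q w) e) i.+1).
by rewrite mulr_suml; apply: eq_bigr => j _; rewrite mulrA.
Qed.

(** The expectation of [W n] is computed twice: the grid estimate gives the product, because the
    accumulated error tends to 0, and dominated convergence gives the integral of [G]. *)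
Lemma phase_duration_laplace (v : nat -> R) (m : nat) : (forall j, 0 <= v j) ->
  (\int[P]_w (expR (- \sum_(j < m) v j * phase_duration j w))%:E =
   (\prod_(j < m) (theta / (theta + v j `^ nu)))%:E)%E.
Proof.
move=> v0; pose v' r := if (r < m)%N then v r else 0.
have v'0 r : 0 <= v' r by rewrite /v'; case: ifP.
have v'm r : (m <= r)%N -> v' r = 0 by rewrite /v' ltnNge => ->.
have v'E (j : 'I_m) : v' j = v j by rewrite /v' ltn_ord.
pose B := \sum_(r < m) v r `^ nu.
have v'B r : v' r `^ nu <= B.
  rewrite /v'; case: ifP => [rm|_]; last first.
    by rewrite powR0 ?gt_eqF// sumr_ge0// => i _; exact: powR_ge0.
  rewrite /B (bigD1 (Ordinal rm))//= lerDl sumr_ge0// => i _; exact: powR_ge0.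
have [p pP QP] := mc_markov mcQ; have mQ := mc_measurable mcQ.
pose W n w := weighted_path mu nu Q sigma v' m (h n) (N n) w.
pose G w := expR (- \sum_(j < m) v j * phase_duration j w).
have PLE : phase_laplace k mu (fun r => v' r `^ nu) m 0 =
    \prod_(j < m) (theta / (theta + v j `^ nu)).
  by rewrite /phase_laplace big_mkord; apply: eq_bigr => j _; rewrite v'E.
have lim1 : (\int[P]_w (W n w)%:E)%E @[n --> \oo] -->
    (\prod_(j < m) (theta / (theta + v j `^ nu)))%:E.
  rewrite -PLE.
  have bnd n := weighted_path_expectation k_gt0 lam_gt0 mu_gt0 nu_gt0 pP mQ QP subP indep
    v'0 v'B v'm (h_gt0 n) (N n).
  apply: squeeze_cvge; first by apply: nearW => n; exact: bnd.
    apply: cvg_EFin; first exact: nearW.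
    by rewrite -[X in _ --> X]subr0; apply: cvgB; [exact: cvg_cst|exact: error_cvg].
  apply: cvg_EFin; first exact: nearW.
  by rewrite -[X in _ --> X]addr0; apply: cvgD; [exact: cvg_cst|exact: error_cvg].
have mW n : measurable_fun setT (EFin \o W n).
  by apply/measurable_EFinP; exact: measurable_weighted_path.
have mG : measurable_fun setT (EFin \o G).
  apply/measurable_EFinP; apply: measurableT_comp => //; apply: measurableT_comp => //.
  apply: measurable_sum => j; apply: measurable_funM; first exact: measurable_cst.
  exact: measurable_phase_duration.
have WG : {ae P, forall w, setT w -> (EFin \o W n) w @[n --> \oo] --> (EFin \o G) w}.
  apply: filterS ae_inter_phase_times => w [_ Dcvg count _] _.
  apply: cvg_EFin; first exact: nearW.
  have c : expR (- \sum_(j < m) v j * phase_duration_approx n j w) @[n --> \oo] --> G w.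
    apply: continuous_cvg; first exact: continuous_expR.
    apply: cvgN; apply: cvg_big => [|j _]; first exact: add_continuous.
    apply: cvgM; first exact: cvg_cst.
    exact: Dcvg.
  apply: cvg_trans c; apply: near_eq_cvg.
  near=> n.
  (* If more than [m] phases have begun, at least [m] are completed, since only the last can be in
     progress; the weight is then an empty product. *)
  have mn : (m < (service_state k (skeleton (queue_path Q w) (h n)) (N n)).1)%N.
    by near: n; exact: count.
  rewrite /= /W weighted_pathE// /service_weight /phase_laplace big_geq ?mulr1; last first.
    by case: (service_state _ _ _) mn => a [] /=; lia.
  by congr expR; congr (- _); apply: eq_bigr => j _; rewrite v'E.
(* The increments of [sigma] are nonnegative only almost surely, hence a domination that holds
   almost everywhere. *)
have W1 : {ae P, forall w n, setT w -> (`|(EFin \o W n) w| <= cst 1%E w)%E}.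
  apply: filterS ae_inter_phase_times => w [_ _ _ s_incr] n _.
  rewrite lee_fin ger0_norm ?weighted_path_ge0// /W /weighted_path.
  have /andP[w0 w1] := phase_laplace01 k_gt0 mu_gt0 m (fun r => powR_ge0 (v' r) nu)
    ((service_state k (skeleton (queue_path Q w) (h n)) (N n)).1 -
     (service_state k (skeleton (queue_path Q w) (h n)) (N n)).2).
  rewrite mulr_ile1//; first by apply: prodr_ge0 => i _; exact: expR_ge0.
  apply: prodr_ile1 => i _; rewrite expR_ge0/= -[leRHS]expR0 ler_expR oppr_le0 mulr_ge0//.
    by rewrite /service_cost; case: ifP.
  rewrite subr_ge0; apply/ltW/s_incr; first by rewrite mulr_ge0// ltW.
  by rewrite ltr_pM2r ?ltr_nat.
have i1 : P.-integrable setT (cst 1%E).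
  exact: finite_measure_integrable_cst.
have [_ _ lim2] := @dominated_convergence _ _ _ P setT measurableT _ _ _ mW mG WG i1 W1.
exact: (cvg_unique _ lim2 lim1).
Unshelve. all: by end_near.
Qed.

End InterPhase.

Theorem theorem4p2 (R : realType) (d : measure_display) (T : measurableType d)
    (P : probability T R) (lam mu nu : R) (k : nat)
    (Q : R -> T -> queue_state k) (sigma : R -> {RV P >-> R}) :
  0 < lam -> 0 < mu -> (1 <= k)%N -> 0 < nu -> nu < 1 ->
  markov_chain P (queue_rate lam mu) Q ->
  stable_subordinator nu sigma ->
  independent_processes P [set: set (queue_state k)] (@measurable _ R) Q sigma ->
  exists D : nat -> {RV P >-> R},
    [/\ {ae P, forall w,
          inter_phase_times k
            (fun t => val (fractional_process Q sigma t w))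
            (fun j => D j w)},
        mutually_independent P D &
        forall j, mittag_leffler_rv nu (k%:R * mu) (D j)].
Proof.
move=> lam_gt0 mu_gt0 k_gt0 nu_gt0 nu_lt1 mcQ subP indep.
pose X := @phase_duration R d T P k Q sigma.
have mX j : measurable_fun setT (X j) := measurable_phase_duration sigma mcQ j.
pose D j : {RV P >-> R} :=
  HB.pack (X j) (isMeasurableFun.Build _ _ _ _ (X j) (mX j)).
have L := phase_duration_laplace k_gt0 lam_gt0 mu_gt0 nu_gt0 mcQ subP indep.
have theta_gt0 : 0 < k%:R * mu by rewrite mulr_gt0// ltr0n.
exists D; split.
- apply: filterS (ae_inter_phase_times k_gt0 lam_gt0 mu_gt0 nu_gt0 mcQ subP) => w [].
  by [].
- apply: (@laplace_mutually_independent _ _ _ P D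
    (fun u => k%:R * mu / (k%:R * mu + u `^ nu))) => //.
  by move=> j w; exact: phase_duration_ge0.
- move=> j; apply: mittag_leffler_rv_laplace => //.
    by move=> w; exact: phase_duration_ge0.
  (* Setting the other Laplace variables to 0 makes their factors equal to 1 and isolates the law of
     [D j]. *)
  move=> v v0; pose v' i := if i == j then v else 0.
  have v'0 i : 0 <= v' i by rewrite /v'; case: ifP => // _; exact: ltW.
  have := L v' j.+1 v'0.
  have v'lt (i : 'I_j) : v' i = 0 by rewrite /v' ltn_eqF.
  have v'j : v' j = v by rewrite /v' eqxx.
  rewrite big_ord_recr/= v'j big1 ?mul1r => [<-|i _]; last first.
    by rewrite v'lt powR0 ?gt_eqF// addr0 divff// gt_eqF.
  apply: eq_integral => w _; rewrite big_ord_recr/= v'j big1 ?add0r// => i _.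
  by rewrite v'lt mul0r.
Qed.
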